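(* Under the standing assumptions, the value function $V$ is a viscosity solution on $\mathcal{D}(V)$ of the Hamilton–Jacobi–Bellman equation $$\rho v(\eta)=\langle\eta,A^*\nabla v(\eta)\rangle+f(\eta)v_{\eta_0}(\eta)+U_2(\eta_0)+\mathcal{H}(v_{\eta_0}(\eta)).$$
   Context: Fix $T>0$, $r>0$, $\rho>0$. $L^2_{-T}:=L^2([-T,0];\mathbb{R})$, $W^{1,2}_{-T}:=W^{1,2}([-T,0];\mathbb{R})$, $H:=\mathbb{R}\times L^2_{-T}$ with elements $\eta=(\eta_0,\eta_1)$, inner product $\langle\cdot,\cdot\rangle$ and norm $\|\cdot\|$, $H_+:=(0,+\infty)\times L^2_{-T}$. Standing assumptions: $a\in W^{1,2}_{-T}$, $a\ge0$, $a(-T)=0$; $f_0:[0,\infty)\times\mathbb{R}\to\mathbb{R}$ jointly concave, nondecreasing in its second variable, Lipschitz with constant $C_{f_0}$, $f_0(0,y)>0$ for all $y>0$, extended to $\mathbb{R}^2$ by $f_0(x,y):=f_0(0,y)$ for $x<0$; $U_1\in C([0,\infty))\cap C^2((0,\infty))$ with $U_1'>0$, $U_1'(0^+)=+\infty$, $U_1''<0$, $U_1$ bounded; $U_2\in C((0,\infty))$ increasing, concave, bounded above, with $\int_0^\infty e^{-\rho t}U_2(e^{-C_{f_0}t})dt>-\infty$. For $\eta\in H_+$ and $c\in L^1_{loc}([0,\infty);[0,\infty))$, $x(\cdot;\eta,c)$ is the unique function $x:[-T,\infty)\to\mathbb{R}$, continuous on $[0,\infty)$, with $x=\eta_1$ a.e.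 on $[-T,0)$ and $x(t)=\eta_0+\int_0^t[r x(s)+f_0(x(s),\int_{-T}^0a(\xi)x(s+\xi)d\xi)-c(s)]ds$ for $t\ge 0$. Admissible controls: $\mathcal{C}(\eta):=\{c\in L^1_{loc}([0,\infty);[0,\infty)) : x(t;\eta,c)>0\ \forall t\ge0\}$. $J(\eta;c):=\int_0^\infty e^{-\rho t}[U_1(c(t))+U_2(x(t;\eta,c))]dt$, $V(\eta):=\sup_{c\in\mathcal{C}(\eta)}J(\eta;c)$ ($\sup\emptyset=-\infty$), $\mathcal{D}(V):=\{\eta\in H_+: V(\eta)>-\infty\}$ (an open subset of $H$). Operator $A(\eta_0,\eta_1):=(r\eta_0,\eta_1')$ on $\mathcal{D}(A):=\{\eta\in H:\eta_1\in W^{1,2}_{-T},\eta_1(0)=\eta_0\}$, $A^*$ its adjoint. $f(\eta):=f_0(\eta_0,\int_{-T}^0a(\xi)\eta_1(\xi)d\xi)$, $\hat n:=(1,0)$, $\varphi_{\eta_0}:=\langle\nabla\varphi,\hat n\rangle$. Hamiltonian: $\mathcal{H}(p):=\sup_{c\ge0}(U_1(c)-pc)\in(-\infty,+\infty]$. Test functions: $\tau:=\{\varphi\in C^1(H):\nabla\varphi(\eta)\in\mathcal{D}(A^* )\ \forall\eta,\ \eta_n\to\eta\Rightarrow A^*\nabla\varphi(\eta_n)\rightharpoonup A^*\nabla\varphi(\eta)\}$. A continuous $v:\mathcal{D}(V)\to\mathbb{R}$ is a viscosity subsolution if for every $\varphi\in\tau$ and every $\eta_M\in\mathcal{D}(V)$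 at which $v-\varphi$ has a $\|\cdot\|$-local maximum, $\rho v(\eta_M)\le\langle\eta_M,A^*\nabla\varphi(\eta_M)\rangle+f(\eta_M)\varphi_{\eta_0}(\eta_M)+U_2((\eta_M)_0)+\mathcal{H}(\varphi_{\eta_0}(\eta_M))$; a viscosity supersolution if for every $\varphi\in\tau$ and every $\eta_m\in\mathcal{D}(V)$ at which $v-\varphi$ has a $\|\cdot\|$-local minimum, the reverse inequality $\ge$ holds at $\eta_m$; a viscosity solution if it is both. *)

(* Defs.v *)
From HB Require Import structures.
From mathcomp Require Import all_boot all_order all_algebra.
From mathcomp Require Import all_classical all_reals all_analysis.
Set Implicit Arguments. Unset Strict Implicit. Unset Printing Implicit Defensive.
Import Order.TTheory GRing.Theory Num.Theory.
Import numFieldNormedType.Exports.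
Local Open Scope classical_set_scope.
Local Open Scope ring_scope.

Section Defs.
Variable R : realType.
Local Notation mu := (@lebesgue_measure R).

(* Elements of H = R x L^2([-T,0]) are represented by pairs (eta0, eta1)
   where eta1 is a representative function; membership in H is a predicate. *)
Definition Hpt := (R * (R -> R))%type.

Definition L2 (T : R) (g : R -> R) : Prop :=
  measurable_fun `[- T, 0]%classic g /\
  mu.-integrable `[- T, 0]%classic (fun t => (g t ^+ 2)%:E).

Definition inH (T : R) (eta : Hpt) : Prop := L2 T eta.2.

Definition Hadd (eta xi : Hpt) : Hpt := (eta.1 + xi.1, fun t => eta.2 t + xi.2 t).
Definition Hsub (eta xi : Hpt) : Hpt := (eta.1 - xi.1, fun t => eta.2 t - xi.2 t).

Definition Hinner (T : R) (eta xi : Hpt) : R :=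
  eta.1 * xi.1 + Rintegral mu `[- T, 0]%classic (fun t => eta.2 t * xi.2 t).

Definition Hnorm (T : R) (eta : Hpt) : R := Num.sqrt (Hinner T eta eta).

Definition W12 (T : R) (a : R -> R) : Prop :=
  exists g, L2 T g /\
    forall t, t \in `[- T, 0] -> a t = a (- T) + Rintegral mu `[- T, t]%classic g.

(* q = A^* p, where A(z0,z1) = (r z0, z1') on
   D(A) = {(z0,z1) : z1 in W^{1,2}, z1(0) = z0}; every element of D(A) is
   (a.e.) of the form z1(t) = z0 - int_t^0 g with g in L^2, and then A z = (r z0, g). *)
Definition adjA (T r : R) (p q : Hpt) : Prop :=
  forall (z0 : R) (g : R -> R), L2 T g ->
    Hinner T (r * z0, g) p =
    Hinner T (z0, fun t => z0 - Rintegral mu `[t, 0]%classic g) q.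

Definition test_fun (T r : R) (phi : Hpt -> R) (grad Astar : Hpt -> Hpt) : Prop :=
  (forall eta, inH T eta -> inH T (grad eta) /\ inH T (Astar eta)) /\
  (forall eta, inH T eta -> forall eps : R, 0 < eps -> exists2 del : R, 0 < del &
     forall h, inH T h -> Hnorm T h < del ->
       `| phi (Hadd eta h) - phi eta - Hinner T (grad eta) h | <= eps * Hnorm T h) /\
  (forall eta, inH T eta -> forall eps : R, 0 < eps -> exists2 del : R, 0 < del &
     forall eta', inH T eta' -> Hnorm T (Hsub eta' eta) < del ->
       Hnorm T (Hsub (grad eta') (grad eta)) < eps) /\
  (forall eta, inH T eta -> adjA T r (grad eta) (Astar eta)) /\
  (forall (u : nat -> Hpt) eta, (forall n, inH T (u n)) -> inH T eta ->
     (fun n => Hnorm T (Hsub (u n) eta)) @ \oo --> 0 ->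
     forall zeta, inH T zeta ->
       (fun n => Hinner T (Astar (u n)) zeta) @ \oo --> Hinner T (Astar eta) zeta).

Definition is_state (T r : R) (a : R -> R) (f0 : R -> R -> R) (eta : Hpt)
    (c : R -> R) (x : R -> R) : Prop :=
  {within `[0, +oo[, continuous x} /\
  {ae mu, forall t, t \in `[- T, 0[ -> x t = eta.2 t} /\
  forall t, 0 <= t ->
    let F := fun s => r * x s
        + f0 (x s) (Rintegral mu `[- T, 0]%classic (fun xi => a xi * x (s + xi)))
        - c s in
    mu.-integrable `[0, t]%classic (fun s => (F s)%:E) /\
    x t = eta.1 + Rintegral mu `[0, t]%classic F.

Definition L1loc_nonneg (c : R -> R) : Prop :=
  (forall t, 0 <= t -> 0 <= c t) /\
  measurable_fun (`[0%R, +oo[%classic : set R) c /\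
  (forall t, 0 <= t -> mu.-integrable `[0, t]%classic (fun s => (c s)%:E)).

Definition Jfun (rho : R) (U1 U2 : R -> R) (c x : R -> R) : \bar R :=
  (\int[mu]_(t in (`[0%R, +oo[%classic : set R)) ((expR (- (rho * t)) * (U1 (c t) + U2 (x t)))%:E))%E.

Definition Vfun (T r rho : R) (a : R -> R) (f0 : R -> R -> R) (U1 U2 : R -> R)
    (eta : Hpt) : \bar R :=
  ereal_sup [set J | exists c x, L1loc_nonneg c /\ is_state T r a f0 eta c x /\
      (forall t, 0 <= t -> 0 < x t) /\ J = Jfun rho U1 U2 c x].

Definition DV (T r rho : R) a f0 U1 U2 : set Hpt :=
  [set eta | 0 < eta.1 /\ inH T eta /\ (Vfun T r rho a f0 U1 U2 eta > -oo)%E].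

Definition Ham (U1 : R -> R) (p : R) : \bar R :=
  ereal_sup [set (U1 c - p * c)%:E | c in (`[0%R, +oo[%classic : set R)].

Definition fH (T : R) (a : R -> R) (f0 : R -> R -> R) (eta : Hpt) : R :=
  f0 eta.1 (Rintegral mu `[- T, 0]%classic (fun xi => a xi * eta.2 xi)).

Definition hjb_rhs (T : R) a f0 U1 U2 (Astar grad : Hpt -> Hpt) (eta : Hpt) : \bar R :=
  ((Hinner T eta (Astar eta) + fH T a f0 eta * (grad eta).1 + U2 eta.1)%:E
    + Ham U1 (grad eta).1)%E.

Definition cont_on (T : R) (D : set Hpt) (v : Hpt -> R) : Prop :=
  forall eta, D eta -> forall eps : R, 0 < eps -> exists2 del : R, 0 < del &
    forall eta', D eta' -> Hnorm T (Hsub eta' eta) < del -> `| v eta' - v eta | < eps.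

Definition visc_sub (T r rho : R) a f0 U1 U2 (D : set Hpt) (v : Hpt -> R) : Prop :=
  forall phi grad Astar, test_fun T r phi grad Astar ->
  forall etaM, D etaM ->
    (exists2 del : R, 0 < del & forall eta, D eta -> Hnorm T (Hsub eta etaM) < del ->
        v eta - phi eta <= v etaM - phi etaM) ->
    ((rho * v etaM)%:E <= hjb_rhs T a f0 U1 U2 Astar grad etaM)%E.

Definition visc_super (T r rho : R) a f0 U1 U2 (D : set Hpt) (v : Hpt -> R) : Prop :=
  forall phi grad Astar, test_fun T r phi grad Astar ->
  forall etam, D etam ->
    (exists2 del : R, 0 < del & forall eta, D eta -> Hnorm T (Hsub eta etam) < del ->
        v etam - phi etam <= v eta - phi eta) ->
    ((rho * v etam)%:E >= hjb_rhs T a f0 U1 U2 Astar grad etam)%E.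

Definition visc_sol (T r rho : R) a f0 U1 U2 (D : set Hpt) (v : Hpt -> R) : Prop :=
  cont_on T D v /\ visc_sub T r rho a f0 U1 U2 D v /\ visc_super T r rho a f0 U1 U2 D v.

End Defs.

(* Main.v *)
(** Trajectories are parametrised by their derivative on [0,oo[ and the consumption is
    recovered from the state equation; every positive path whose recovered consumption is
    nonnegative is admissible, so that no existence theory for the delay equation enters.

    Adding k e^(-Ct) to a near-optimal path shows that V has a strictly positive slope in
    the direction (1,0).  Perturbing a near-optimal path by zeta_0 - n (e^(Kt) - 1) shows
    that V is finite and bounded below near every point of its domain; being concave and
    bounded above, it is continuous.

    Let phi be a test function and X(s) the history of a path at time s.  The mean value
    theorem gives phi(X(h)) - phi(eta) = <p, X(h) - eta> with p the gradient of phi at an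
    intermediate point, and the identity defining A^*, applied to the integral of X over
    [0,h], turns the right-hand side into <int_0^h X(s) ds, A^* p> plus p_0 times the
    increment of the non-delayed part.  The error is controlled because A^* grad phi, being
    weakly continuous, is locally bounded (gliding hump).

    The supersolution inequality follows by dynamic programming along paths with constant
    derivative.  For the subsolution inequality near-optimal paths are stopped when the
    elapsed time plus the total consumption reaches a small constant k; any defect in the
    inequality would then cost at least a fixed multiple of k, whereas the path can be taken
    arbitrarily close to optimal. *)

Require Import Defs.
From HB Require Import structures.
From mathcomp Require Import all_boot all_order all_algebra.
From mathcomp Require Import all_classical all_reals all_analysis.
From mathcomp Require Import measurable_realfun ring lra.
Import Order.TTheory GRing.Theory Num.Theory.
Import numFieldNormedType.Exports.
Set Implicit Arguments. Unset Strict Implicit. Unset Printing Implicit Defensive.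
Local Open Scope classical_set_scope.
Local Open Scope ring_scope.

(** * Integrals of real functions *)

(** Three obstacles shape the proof. The history of a state is merely square integrable, so a state
    need not lie in the domain of [A], and [A^*] applied to a gradient is only weakly continuous: a
    limit may be taken against the fixed vector [eta], but against the moving vector X(s) - eta only
    a bound on its norm helps. Consumption is merely locally integrable: a path can leave every
    neighbourhood of its starting point in arbitrarily short time, so elapsed time alone does not
    localise it. Errors in the expansion of a test function are therefore measured against time plus
    total consumption, and the strictly positive slope of V is what makes consumption costly: it
    allows a term proportional to consumption to be set aside at a small price in the Hamiltonian.
    Finally [util2] may tend to minus infinity at 0, so locally uniform lower bounds for V need
    paths with quantitative lower bounds; their model is e^(-Ct), the path in the integrability
    hypothesis on [util2]. *)

Section RealIntegrals.
Variable R : realType.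
Notation mu := (@lebesgue_measure R).
Implicit Types (f g : R -> R) (D : set R).

Definition ig D f := mu.-integrable D (fun x => (f x)%:E).

Lemma ig_meas D f : ig D f -> measurable_fun D f.
Proof. by move=> /integrableP[/measurable_EFinP]. Qed.

Lemma ig_sub D D' f : measurable D -> measurable D' -> D' `<=` D ->
  ig D f -> ig D' f.
Proof. by move=> mD mD' s; apply: integrableS. Qed.

Lemma eq_ig D f g : measurable D -> (forall x, D x -> f x = g x) -> ig D f -> ig D g.
Proof.
move=> mD e; apply: eq_integrable => // x; rewrite inE => Dx.
by rewrite /= e.
Qed.

Lemma igD D f g : measurable D -> ig D f -> ig D g -> ig D (fun x => f x + g x).
Proof. by move=> mD a b; exact: (integrableD _ a b). Qed.

Lemma igB D f g : measurable D -> ig D f -> ig D g -> ig D (fun x => f x - g x).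
Proof. by move=> mD a b; exact: (integrableB _ a b). Qed.

Lemma igZ D k f : measurable D -> ig D f -> ig D (fun x => k * f x).
Proof. by move=> mD a; have H := integrableZl _ k a; exact: (H mD). Qed.

Lemma ig_norm D f : measurable D -> ig D f -> ig D (fun x => `|f x|).
Proof. by move=> mD a; have H := integrable_norm a; exact: H. Qed.

Lemma ig_le D f g : measurable D -> measurable_fun D f ->
  (forall x, D x -> `|f x| <= g x) -> ig D g -> ig D f.
Proof.
move=> mD mf fg; apply: le_integrable => //; first exact/measurable_EFinP.
by move=> x Dx; rewrite lee_fin (le_trans (fg x Dx)) // ler_norm.
Qed.

Lemma ig_cst_itv (a b k : R) (ba bb : bool) :
  ig [set` Interval (BSide ba a) (BSide bb b)] (fun=> k).
Proof.
apply/integrableP; split; first exact: measurable_cst.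
rewrite integral_cst //= lebesgue_measure_itv /=; case: ifP => _.
  by rewrite -EFinD -EFinM ltry.
by rewrite mule0 ltry.
Qed.

Lemma ig_bnd (a b k : R) (ba bb : bool) f :
  measurable_fun [set` Interval (BSide ba a) (BSide bb b)] f ->
  (forall x, x \in Interval (BSide ba a) (BSide bb b) -> `|f x| <= k) ->
  ig [set` Interval (BSide ba a) (BSide bb b)] f.
Proof.
move=> mf fk; apply: (@ig_le _ f (fun=> k)) => //; exact: ig_cst_itv.
Qed.

Lemma ig_ge0_finite D f : measurable D -> measurable_fun D f ->
  (forall x, D x -> 0 <= f x) ->
  (\int[mu]_(x in D) (f x)%:E < +oo)%E -> ig D f.
Proof.
move=> mD mf f0 fi; apply/integrableP; split; first exact/measurable_EFinP.
apply: le_lt_trans fi; rewrite le_eqVlt; apply/orP; left; apply/eqP.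
by apply: eq_integral => x; rewrite inE => Dx; rewrite gee0_abs // lee_fin f0.
Qed.

Lemma EFin_Rintegral D f : measurable D -> ig D f ->
  (\int[mu]_(x in D) (f x)%:E)%E = (Rintegral mu D f)%:E.
Proof. by move=> mD fi; rewrite /Rintegral fineK //; exact: integrable_fin_num. Qed.

Lemma Rint_eq D f g : (forall x, D x -> f x = g x) -> Rintegral mu D f = Rintegral mu D g.
Proof. by move=> e; apply: eq_Rintegral => x; rewrite inE => /e. Qed.

Lemma Rint_le D f g : measurable D -> ig D f -> ig D g ->
  (forall x, D x -> f x <= g x) -> Rintegral mu D f <= Rintegral mu D g.
Proof. by move=> *; apply: le_Rintegral. Qed.

Lemma RintD D f g : measurable D -> ig D f -> ig D g ->
  Rintegral mu D (fun x => f x + g x) = Rintegral mu D f + Rintegral mu D g.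
Proof. by move=> *; apply: RintegralD. Qed.

Lemma RintB D f g : measurable D -> ig D f -> ig D g ->
  Rintegral mu D (fun x => f x - g x) = Rintegral mu D f - Rintegral mu D g.
Proof. by move=> *; apply: RintegralB. Qed.

Lemma RintZ D k f : measurable D -> ig D f ->
  Rintegral mu D (fun x => k * f x) = k * Rintegral mu D f.
Proof. by move=> *; apply: RintegralZl. Qed.

Lemma Rint_abs D f : measurable D -> ig D f ->
  `|Rintegral mu D f| <= Rintegral mu D (fun x => `|f x|).
Proof. by move=> *; apply: le_normr_Rintegral. Qed.

Lemma Rint_cst_itv (a b k : R) : a <= b ->
  Rintegral mu `[a, b] (fun=> k) = k * (b - a).
Proof.
move=> ab; rewrite Rintegral_cst //.
suff -> : fine (mu `[a, b]) = b - a by [].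
rewrite lebesgue_measure_itv /= lte_fin; case: ltP => //= ba.
by rewrite (le_anti (introT andP (conj ab ba))) subrr.
Qed.

Lemma Rint_point (a : R) f : Rintegral mu `[a, a] f = 0.
Proof. by rewrite set_itv1 Rintegral_set1. Qed.

Lemma Rint_le_abs_cst (a b k : R) f : a <= b -> ig `[a, b] f ->
  (forall x, a <= x <= b -> `|f x| <= k) -> `|Rintegral mu `[a, b] f| <= k * (b - a).
Proof.
move=> ab fi fk; apply: (le_trans (Rint_abs _ fi)) => //.
rewrite -Rint_cst_itv //; apply: Rint_le => //.
- exact: ig_norm.
- exact: ig_cst_itv.
Qed.

Lemma Rint_split (a b c : R) f : a <= b -> b <= c -> ig `[a, c] f ->
  Rintegral mu `[a, c] f = Rintegral mu `[a, b] f + Rintegral mu `[b, c] f.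
Proof.
move=> ab bc fi.
have fi2 : ig `[b, c] f.
  apply: ig_sub fi => // x /=; rewrite !in_itv /= => /andP[bx xc].
  by rewrite (le_trans ab bx) xc.
have fi3 : mu.-integrable `]b, c] (EFin \o f).
  by apply: (ig_sub _ _ _ fi2) => // x /=; rewrite !in_itv /= => /andP[/ltW-> ->].
have := @Rintegral_itvB R f (BLeft a) (BRight c) b fi.
rewrite !bnd_simp => /(_ ab bc) /(canRL (subrK _)) ->.
by rewrite Rintegral_itv_obnd_cbnd // addrC.
Qed.

Lemma igU (A B : set R) f : measurable A -> measurable B -> ig A f -> ig B f -> ig (A `|` B) f.
Proof.
move=> mA mB fA fB; have mU : measurable (A `|` B) by exact: measurableU.
have mf : measurable_fun (A `|` B) f.
  by apply/measurable_funU => //; split; [exact: ig_meas fA|exact: ig_meas fB].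
apply/integrableP; split; first exact/measurable_EFinP.
have mn : measurable_fun (A `|` B) (fun x => (`|(f x)%:E|)%E).
  by apply/measurable_EFinP; exact: measurableT_comp.
have mD : measurable ((A `|` B) `\` A) by exact: measurableD.
apply: le_lt_trans (_ : \int[mu]_(x in A) `|(f x)%:E| + \int[mu]_(x in B) `|(f x)%:E| < +oo)%E.
  rewrite -(setDUK (_ : A `<=` A `|` B)); last by move=> x; left.
  rewrite ge0_integral_setU //=; last 2 first.
  - by apply: measurable_funS mn => // x [|[]]//; left.
  - by apply/disj_setPS => x [? []].
  apply: leeD => //; apply: ge0_subset_integral => //.
  - by apply/measurable_EFinP/measurableT_comp => //; exact: ig_meas fB.
  - by move=> x [[]].
by apply: lte_add_pinfty; [case/integrableP: fA|case/integrableP: fB].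
Qed.

Lemma ig_glue (a b c : R) f : a <= b -> b <= c -> ig `[a, b] f -> ig `[b, c] f -> ig `[a, c] f.
Proof.
move=> ab bc fi1 fi2.
have -> : `[a, c]%classic = `[a, b]%classic `|` `[b, c]%classic; last exact: igU.
apply/seteqP; split => x /=; rewrite !in_itv /=.
  move=> /andP[ax xc]; case: (leP x b) => xb; [left|right]; first by rewrite ax.
  by rewrite ltW.
by move=> []; lra.
Qed.

Lemma Rint_ge0 D f : (forall x, D x -> 0 <= f x) -> 0 <= Rintegral mu D f.
Proof. by move=> f0; apply: Rintegral_ge0. Qed.

Lemma Rint_subset_le D D' f : measurable D -> measurable D' -> D' `<=` D ->
  (forall x, D x -> 0 <= f x) -> ig D f -> Rintegral mu D' f <= Rintegral mu D f.
Proof.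
move=> mD mD' s f0 fi; rewrite -lee_fin -!EFin_Rintegral //; last exact: ig_sub fi.
by apply: ge0_subset_integral => //; exact: measurable_int fi.
Qed.

End RealIntegrals.

(** * Integrals of functions that agree off a null set *)

Section NullSets.
Context d (T : measurableType d) (R : realType).
Variable mu : {measure set T -> \bar R}.
Local Open Scope ereal_scope.
Import HBNNSimple.

(** A simple function below [f], multiplied by the indicator of the complement of [N], keeps its
    integral and lies below [g] everywhere. Only the simple functions have to be measurable. *)
Let nonneg_le (N : set T) (f g : T -> \bar R) : measurable N -> mu N = 0 ->
  (forall x, 0 <= f x) -> (forall x, 0 <= g x) -> (forall x, ~ N x -> f x = g x) ->
  \int[mu]_x f x <= \int[mu]_x g x.
Proof.
move=> mN N0 f0 g0 fg; rewrite !ge0_integralTE //.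
apply: ge_ereal_sup => _ [h /= hf <-].
have mCN : measurable (~` N) by exact: measurableC.
apply: le_trans (_ : sintegral mu (proj_nnsfun h mCN) <= _).
  rewrite -mrestrict -integral_nnsfun // -integralT_nnsfun.
  rewrite (ge0_negligible_integral mN) // ?setTD //.
  - exact/measurable_EFinP.
  - by move=> x _; rewrite lee_fin.
apply: ereal_sup_ubound; exists (proj_nnsfun h mCN) => //= x.
rewrite mindicE; have [|] := boolP (x \in ~` N).
  by rewrite inE => /fg e; rewrite mulr1 -e.
by rewrite mulr0.
Qed.

(* Borel representatives only: the functions are not assumed measurable, which
   the library's [ae_eq_integral] requires. *)
Lemma integral_eq_off_null (D N : set T) (f g : T -> \bar R) :
  measurable N -> mu N = 0 -> (forall x, D x -> ~ N x -> f x = g x) ->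
  \int[mu]_(x in D) f x = \int[mu]_(x in D) g x.
Proof.
move=> mN N0 fg; rewrite integral_mkcond [RHS]integral_mkcond.
have e x : ~ N x -> (f \_ D) x = (g \_ D) x.
  by move=> Nx; rewrite /patch; case: ifP => //; rewrite inE => Dx; apply: fg.
rewrite integralE [RHS]integralE; congr (_ - _).
- by apply/eqP; rewrite eq_le; apply/andP; split;
    apply: (nonneg_le mN N0) => // x Nx; rewrite !funeposE e.
- by apply/eqP; rewrite eq_le; apply/andP; split;
    apply: (nonneg_le mN N0) => // x Nx; rewrite !funenegE e.
Qed.

End NullSets.

(** * Translation invariance of Lebesgue measure *)

Section Translation.
Variable R : realType.
Notation mu := (@lebesgue_measure R).
Implicit Types (f : R -> R) (D : set R) (s : R).

Lemma measurable_shift s D : measurable_fun D (fun x : R => s + x).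
Proof. exact: measurable_funD. Qed.

Lemma measurable_shift_preimage s D : measurable D -> measurable ((fun x => s + x) @^-1` D).
Proof. by move=> mD; rewrite -[X in measurable X]setTI; apply: (measurable_shift s). Qed.

(** The image measure under the shift agrees with [mu] on half-open intervals, and these determine
    Lebesgue measure. *)
Lemma lebesgue_measure_shift s D : measurable D -> mu ((fun x => s + x) @^-1` D) = mu D.
Proof.
move=> mD.
have mphi : measurable_fun [set: measurableTypeR R] ((fun x => s + x) : measurableTypeR R -> measurableTypeR R).
  exact: measurable_shift.
pose nu : {measure set (measurableTypeR R) -> \bar R} :=
  measure_function_pushforward__canonical__measure_function_Measure mu mphi.
apply/esym; apply: (@lebesgue_measure_unique R nu) => //.
move=> _ [[a b] _ <-] /=; rewrite /pushforward.
have -> : (fun x => s + x) @^-1` `]a, b] = `]a - s, b - s]%classic.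
  by apply/seteqP; split => x /=; rewrite !in_itv /=; lra.
rewrite !lebesgue_measure_itv /= !lte_fin ltrD2r; case: ifP => // _.
by rewrite -!EFinD; congr (_%:E); ring.
Qed.

Lemma ge0_integral_shift s D (f : R -> \bar R) : measurable D ->
  measurable_fun D f -> (forall x, D x -> 0 <= f x)%E ->
  (\int[mu]_(x in D) f x = \int[mu]_(x in (fun x => s + x)%R @^-1` D) f (s + x)%R)%E.
Proof.
move=> mD mf f0.
have mphi : measurable_fun [set: measurableTypeR R]
    ((fun x => s + x) : measurableTypeR R -> measurableTypeR R).
  exact: measurable_shift.
rewrite -(ge0_integral_pushforward mphi) //; last by move=> x; rewrite inE; exact: f0.
by apply: eq_measure_integral => A mA _; rewrite /= /pushforward lebesgue_measure_shift.
Qed.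

Lemma ig_shift s D f : measurable D -> ig D f -> ig ((fun x => s + x) @^-1` D) (fun x => f (s + x)).
Proof.
move=> mD /integrableP[mf fi]; apply/integrableP; split.
  apply/measurable_EFinP; apply: (measurable_comp mD) => //.
  - by move=> _ [x /= ? <-].
  - exact/measurable_EFinP.
  - exact: measurable_shift.
move: fi; rewrite (ge0_integral_shift s mD (f := fun x => `|(f x)%:E|%E)) //.
by apply: measurableT_comp.
Qed.

Lemma integral_shift s D f : measurable D -> measurable_fun D f ->
  (\int[mu]_(x in D) (f x)%:E = \int[mu]_(x in (fun x => s + x)%R @^-1` D) (f (s + x)%R)%:E)%E.
Proof.
move=> mD /measurable_EFinP mf.
rewrite integralE [RHS]integralE; congr (_ - _)%E.
  rewrite (ge0_integral_shift s) //; last exact: measurable_funepos.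
  by apply: eq_integral => x _; rewrite !funeposE.
rewrite (ge0_integral_shift s) //; last exact: measurable_funeneg.
by apply: eq_integral => x _; rewrite !funenegE.
Qed.

Lemma itv_shift (s a b : R) :
  `[a, b]%classic = (fun x => s + x) @^-1` `[s + a, s + b]%classic.
Proof. by apply/seteqP; split => x /=; rewrite !in_itv /=; lra. Qed.

Lemma measurable_fun_itv_shift (s a b : R) f :
  measurable_fun `[s + a, s + b] f -> measurable_fun `[a, b] (fun x => f (s + x)).
Proof.
move=> mf; apply: (measurable_comp (F := `[s + a, s + b]%classic)) => //.
- by move=> _ [x /= + <-]; rewrite !in_itv /=; lra.
- exact: measurable_shift.
Qed.

Lemma ig_itv_shift (s a b : R) f :
  ig `[s + a, s + b] f -> ig `[a, b] (fun x => f (s + x)).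
Proof. by move=> fi; rewrite (itv_shift s); apply: ig_shift. Qed.

Lemma Rint_itv_shift (s a b : R) f : measurable_fun `[s + a, s + b] f ->
  Rintegral mu `[a, b] (fun x => f (s + x)) = Rintegral mu `[s + a, s + b] f.
Proof.
move=> mf; rewrite /Rintegral (integral_shift s (D := `[s + a, s + b]%classic)) //.
by congr (fine (integral mu _ _)); exact: itv_shift.
Qed.

End Translation.

(** * The state space *)

Section HilbertSpace.
Variable R : realType.
Notation mu := (@lebesgue_measure R).
Variable T : R.
Implicit Types (f g : R -> R) (eta zeta xi : Hpt R) (k : R).
Notation I := (`[- T, 0]%classic : set R).

Lemma L2_meas f : L2 T f -> measurable_fun I f. Proof. by case. Qed.

Lemma L2_sqr f : L2 T f -> ig I (fun x => f x ^+ 2). Proof. by case. Qed.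

Lemma L2_mul f g : L2 T f -> L2 T g -> ig I (fun x => f x * g x).
Proof.
move=> [mf f2] [mg g2]; apply: (@ig_le _ _ _ (fun x => f x ^+ 2 + g x ^+ 2)) => //.
- exact: measurable_funM.
- move=> x _; rewrite ler_norml; apply/andP; split.
    by have := sqr_ge0 (f x + g x); have := sqr_ge0 (f x); have := sqr_ge0 (g x); rewrite sqrrD; nra.
  by have := sqr_ge0 (f x - g x); have := sqr_ge0 (f x); have := sqr_ge0 (g x); rewrite sqrrB; nra.
- exact: igD.
Qed.

Lemma L2D f g : L2 T f -> L2 T g -> L2 T (fun x => f x + g x).
Proof.
move=> F G; have [[mf f2] [mg g2]] := (F, G); split; first exact: measurable_funD.
apply: (@eq_ig _ _ (fun x => f x ^+ 2 + 2 * (f x * g x) + g x ^+ 2)) => //.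
  by move=> x _; ring.
by do 2! apply: igD => //; apply: igZ => //; apply: L2_mul.
Qed.

Lemma L2Z k f : L2 T f -> L2 T (fun x => k * f x).
Proof.
move=> [mf f2]; split; first exact: measurable_funM.
apply: (@eq_ig _ _ (fun x => k ^+ 2 * f x ^+ 2)) => //; last exact: igZ.
by move=> x _; rewrite exprMn.
Qed.

Lemma eq_L2 f g : (forall x, -T <= x <= 0 -> f x = g x) -> L2 T f -> L2 T g.
Proof.
move=> e [mf f2]; split.
  by apply: (eq_measurable_fun f) => // x; rewrite inE /= in_itv /=; apply: e.
by apply: eq_ig f2 => // x /=; rewrite in_itv /= => /e ->.
Qed.

Lemma L2B f g : L2 T f -> L2 T g -> L2 T (fun x => f x - g x).
Proof.
move=> F G; apply: (@eq_L2 (fun x => f x + (-1) * g x)); last by apply: L2D => //; apply: L2Z.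
by move=> x _; rewrite mulN1r.
Qed.

Lemma L2_bnd k f : measurable_fun I f -> (forall x, -T <= x <= 0 -> `|f x| <= k) -> L2 T f.
Proof.
move=> mf fk; split => //; apply: (@ig_bnd _ _ _ (k ^+ 2)).
  exact: measurable_funX.
move=> x; rewrite in_itv /= => /fk h; rewrite normrX lerXn2r ?nnegrE //.
exact: le_trans (normr_ge0 _) h.
Qed.

Lemma L2_cst k : L2 T (fun=> k).
Proof. by apply: (@L2_bnd `|k|) => //; exact: measurable_cst. Qed.

Lemma L2_ig f : L2 T f -> ig I f.
Proof.
move=> F; apply: (@eq_ig _ _ (fun x => f x * 1)) => //.
  by move=> x _; rewrite mulr1.
exact: L2_mul F (L2_cst 1).
Qed.

Definition Hscale k eta : Hpt R := (k * eta.1, fun t => k * eta.2 t).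

Lemma inHD eta zeta : inH T eta -> inH T zeta -> inH T (Hadd eta zeta).
Proof. exact: L2D. Qed.

Lemma inHB eta zeta : inH T eta -> inH T zeta -> inH T (Hsub eta zeta).
Proof. exact: L2B. Qed.

Lemma inHZ k eta : inH T eta -> inH T (Hscale k eta).
Proof. exact: L2Z. Qed.

Lemma HinnerC eta zeta : Hinner T eta zeta = Hinner T zeta eta.
Proof.
by rewrite /Hinner mulrC; congr (_ + _); apply: Rint_eq => x _; rewrite mulrC.
Qed.

Lemma HinnerDl eta zeta xi : inH T eta -> inH T zeta -> inH T xi ->
  Hinner T (Hadd eta zeta) xi = Hinner T eta xi + Hinner T zeta xi.
Proof.
move=> h1 h2 h3; rewrite /Hinner /=.
have -> : Rintegral mu I (fun t => (eta.2 t + zeta.2 t) * xi.2 t) =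
          Rintegral mu I (fun t => eta.2 t * xi.2 t) + Rintegral mu I (fun t => zeta.2 t * xi.2 t).
  rewrite -RintD //; [|exact: L2_mul|exact: L2_mul].
  by apply: Rint_eq => x _; rewrite mulrDl.
by rewrite mulrDl; ring.
Qed.

Lemma HinnerZl k eta zeta : inH T eta -> inH T zeta ->
  Hinner T (Hscale k eta) zeta = k * Hinner T eta zeta.
Proof.
move=> h1 h2; rewrite /Hinner /=.
have -> : Rintegral mu I (fun t => k * eta.2 t * zeta.2 t) =
          k * Rintegral mu I (fun t => eta.2 t * zeta.2 t).
  rewrite -RintZ //; last exact: L2_mul.
  by apply: Rint_eq => x _; rewrite mulrA.
by ring.
Qed.

Lemma HsubE eta zeta : Hsub eta zeta = Hadd eta (Hscale (-1) zeta).
Proof. by congr pair; [|apply/funext => t]; rewrite /= mulN1r. Qed.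

Lemma HinnerBl eta zeta xi : inH T eta -> inH T zeta -> inH T xi ->
  Hinner T (Hsub eta zeta) xi = Hinner T eta xi - Hinner T zeta xi.
Proof.
by move=> h1 h2 h3; rewrite HsubE HinnerDl ?HinnerZl ?mulN1r //; apply: inHZ.
Qed.

Lemma Hinner_ge0 eta : 0 <= Hinner T eta eta.
Proof.
by rewrite addr_ge0 // -?expr2 ?sqr_ge0 //; apply: Rint_ge0 => x _; rewrite -expr2 sqr_ge0.
Qed.

Lemma Hnorm_ge0 eta : 0 <= Hnorm T eta. Proof. exact: sqrtr_ge0. Qed.

Lemma Hnorm_sqr eta : Hnorm T eta ^+ 2 = Hinner T eta eta.
Proof. by rewrite sqr_sqrtr // Hinner_ge0. Qed.

(** The quadratic form in [k] and [l] obtained from [Hscale k eta] plus [Hscale l zeta] is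
    nonnegative; [l = - B] and [k = C] give the inequality unless [zeta] has norm zero. *)
Lemma cauchy_schwarz eta zeta : inH T eta -> inH T zeta ->
  `|Hinner T eta zeta| <= Hnorm T eta * Hnorm T zeta.
Proof.
move=> h1 h2.
have pos k l : 0 <= k ^+ 2 * Hinner T eta eta + 2 * k * l * Hinner T eta zeta
                    + l ^+ 2 * Hinner T zeta zeta.
  have := Hinner_ge0 (Hadd (Hscale k eta) (Hscale l zeta)).
  have i1 := inHZ k h1; have i2 := inHZ l h2; have i3 := inHD i1 i2.
  rewrite HinnerDl // !(HinnerC _ (Hadd _ _)) !HinnerDl // !HinnerZl //.
  rewrite !(HinnerC _ (Hscale _ _)) !HinnerZl // (HinnerC zeta eta).
  by move=> /le_trans; apply; rewrite le_eqVlt; apply/orP; left; apply/eqP; ring.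
suff H : Hinner T eta zeta ^+ 2 <= Hinner T eta eta * Hinner T zeta zeta.
  rewrite -ler_sqr ?nnegrE ?mulr_ge0 ?Hnorm_ge0 //.
  by rewrite exprMn !Hnorm_sqr real_normK ?num_real.
have := Hinner_ge0 eta; have := Hinner_ge0 zeta; move: pos.
set A := Hinner T eta eta; set B := Hinner T eta zeta; set C := Hinner T zeta zeta.
move=> pos C0 A0.
have [C1|C1] := ltP 0 C.
  rewrite -subr_ge0 -(pmulr_rge0 _ C1); have := pos C (- B).
  by congr (0 <= _); ring.
have {C0 C1}C0 : C = 0 by apply/eqP; rewrite eq_le C0 C1.
suff -> : B = 0 by rewrite expr0n mulr_ge0 // C0.
apply/eqP/negPn/negP => B0.
have B2 : 0 < B ^+ 2 by rewrite exprn_even_gt0.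
(* With [C = 0] the form is affine in [l], and this [l] gives it the value [A - (A + 1) = -1]. *)
have := pos 1 (- (A + 1) / (2 * B)); rewrite C0 mulr0 addr0 expr1n mul1r mulr1.
have -> : 2 * (- (A + 1) / (2 * B)) * B = - (A + 1) by field.
by lra.
Qed.

Lemma Hnorm_triangle eta zeta : inH T eta -> inH T zeta ->
  Hnorm T (Hadd eta zeta) <= Hnorm T eta + Hnorm T zeta.
Proof.
move=> h1 h2; rewrite -ler_sqr ?nnegrE ?addr_ge0 ?Hnorm_ge0 //.
have h3 := inHD h1 h2.
rewrite Hnorm_sqr HinnerDl // !(HinnerC _ (Hadd _ _)) !HinnerDl // (HinnerC zeta eta).
rewrite sqrrD !Hnorm_sqr.
have := cauchy_schwarz h1 h2; have := ler_norm (Hinner T eta zeta).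
by rewrite -mulr_natl; lra.
Qed.

Lemma HnormZ k eta : inH T eta -> Hnorm T (Hscale k eta) = `|k| * Hnorm T eta.
Proof.
move=> h; have h' := inHZ k h; rewrite /Hnorm HinnerZl // HinnerC HinnerZl //.
by rewrite mulrA -expr2 sqrtrM ?sqr_ge0 // sqrtr_sqr.
Qed.

Lemma HnormBC eta zeta : inH T eta -> inH T zeta ->
  Hnorm T (Hsub eta zeta) = Hnorm T (Hsub zeta eta).
Proof.
move=> h1 h2; have -> : Hsub eta zeta = Hscale (-1) (Hsub zeta eta).
  by congr pair; [|apply/funext => t]; rewrite /=; ring.
by rewrite HnormZ ?normrN1 ?mul1r //; exact: inHB.
Qed.

Lemma HnormE eta : Hnorm T eta ^+ 2 = eta.1 ^+ 2 + Rintegral mu I (fun t => eta.2 t ^+ 2).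
Proof. by rewrite Hnorm_sqr. Qed.

Lemma Hnorm_fst eta : `|eta.1| <= Hnorm T eta.
Proof.
rewrite -ler_sqr ?nnegrE ?Hnorm_ge0 // real_normK ?num_real // HnormE lerDl.
by apply: Rint_ge0 => x _; rewrite sqr_ge0.
Qed.

Lemma eq_Hnorm eta zeta : eta.1 = zeta.1 ->
  (forall t, -T <= t <= 0 -> eta.2 t = zeta.2 t) -> Hnorm T eta = Hnorm T zeta.
Proof.
move=> e1 e2; rewrite /Hnorm /Hinner e1; congr (Num.sqrt (_ + _)).
by apply: Rint_eq => x /=; rewrite in_itv /= => /e2 ->.
Qed.

Lemma Hnorm_lt eta e : 0 <= e -> eta.1 ^+ 2 + Rintegral mu I (fun t => eta.2 t ^+ 2) < e ^+ 2 ->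
  Hnorm T eta < e.
Proof. by move=> e0; rewrite -HnormE ltr_sqr ?nnegrE ?Hnorm_ge0. Qed.

End HilbertSpace.

(** * Continuity and measurability on subsets of the line *)

Section WithinContinuity.
Variable R : realType.
Implicit Types (f g : R -> R) (A : set R).

Lemma within_contP f A : {within A, continuous f} <->
  forall x, A x -> forall e : R, 0 < e -> exists2 d : R, 0 < d &
    forall y, A y -> `|x - y| < d -> `|f x - f y| < e.
Proof.
rewrite subspace_continuousP; split=> [H x Ax e e0|H x Ax].
  have /cvgrPdist_lt/(_ _ e0) := H x Ax.
  rewrite /within /= => /nbhs_ballP[d /= d0 dh].
  by exists d => // y Ay xy; apply: dh.
apply/cvgrPdist_lt => e e0; have [d d0 dh] := H x Ax e e0.
rewrite /within /=; apply/nbhs_ballP; exists d => //= y xy Ay.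
exact: dh.
Qed.

(** Heine's theorem in near-covering form: [P d x] says that the modulus [d] works at [x]. Half of a
    local modulus works at all nearby points, and compactness makes one [d] serve the whole
    segment. *)
Lemma within_unif_continuous f (a b e : R) : {within `[a, b], continuous f} -> 0 < e ->
  exists2 d : R, 0 < d & forall x z, x \in `[a, b] -> z \in `[a, b] ->
    `|x - z| < d -> `|f x - f z| < e.
Proof.
move=> /within_contP fc e0.
pose P (d x : R) := forall z, z \in `[a, b] -> `|x - z| < d -> `|f x - f z| < e.
have /compact_near_coveringP/near_covering_withinP/(_ _ (0^'+ : set_system R) P _) := @segment_compact R a b.
have H : forall x, `[a, b]%classic x -> \forall x' \near x & d \near 0^'+, `[a, b]%classic x' -> P d x'.
  move=> x xab.
  have e2 : 0 < e / 2 by rewrite divr_gt0.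
  have [d d0 dh] := fc x xab _ e2.
  exists (ball x (d / 2), [set d' | 0 < d' < d / 2]); first split => /=.
  - by apply: nbhsx_ballx; rewrite divr_gt0.
  - near=> d'; rewrite /=; apply/andP; split; near: d'; first exact: nbhs_right_gt.
    by apply: nbhs_right_lt; rewrite divr_gt0.
  - move=> [x' d'] /= [xx' /andP[d'0 d'd]] x'ab z zab x'z.
    have h1 : `|f x - f x'| < e / 2.
      by apply: dh => //; apply: lt_trans xx' _; rewrite ltr_pdivrMr // ltr_pMr // ltr1n.
    have h2 : `|f x - f z| < e / 2.
      apply: dh => //; have := ler_distD x' x z; move: xx'; rewrite /ball /= => xx'.
      by lra.
    by have := ler_distD (f x) (f x') (f z); rewrite (distrC (f x') (f x)); lra.
move=> /(_ H) K; have {}K : \forall d \near 0^'+, `[a, b]%classic `<=` P d by apply: K.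
have FI : \forall d \near 0^'+, 0 < d /\ `[a, b]%classic `<=` P d.
  by near=> d; split; near: d; [exact: nbhs_right_gt|exact: K].
have [d [d0 dP]] := @filter_ex _ _ _ _ FI.
by exists d => // x z xab zab xz; apply: dP.
Unshelve. all: by end_near. Qed.

Lemma within_contD f g A : {within A, continuous f} -> {within A, continuous g} ->
  {within A, continuous (fun x => f x + g x)}.
Proof. by move=> fc gc x; apply: continuousD; [exact: fc|exact: gc]. Qed.

Lemma within_contM f g A : {within A, continuous f} -> {within A, continuous g} ->
  {within A, continuous (fun x => f x * g x)}.
Proof. by move=> fc gc x; apply: (@continuousM _ (subspace A)); [exact: fc|exact: gc]. Qed.

Lemma within_cont_cst (k : R) A : {within A, continuous (fun=> k)}.
Proof. by move=> x; exact: cst_continuous. Qed.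

Lemma within_cont_ray f : (forall h : R, 0 <= h -> {within `[0, h], continuous f}) ->
  {within `[0, +oo[, continuous f}.
Proof.
move=> H; apply/within_contP => x; rewrite /= in_itv /= andbT => x0 e e0.
have x1 : 0 <= x + 1 by rewrite addr_ge0.
have xi : `[0, x + 1]%classic x by rewrite /= in_itv /=; lra.
have [d d0 dh] := (within_contP _ _).1 (H _ x1) x xi e e0.
exists (Num.min d 1) => [|y]; first by rewrite lt_min d0 ltr01.
rewrite /= in_itv /= andbT lt_min => y0 /andP[yd y1]; apply: dh => //.
by rewrite /= in_itv /= y0; move: y1; rewrite ltr_norml; lra.
Qed.

Lemma within_cont_meas f A : measurable A -> {within A, continuous f} -> measurable_fun A f.
Proof. exact: subspace_continuous_measurable_fun. Qed.

Lemma within_cont_ig f (a b : R) : {within `[a, b], continuous f} -> ig `[a, b] f.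
Proof. by move=> fc; apply: continuous_compact_integrable => //; exact: segment_compact. Qed.

Lemma meas_ray (f : R -> R) : (forall h : R, 0 <= h -> measurable_fun `[0, h] f) ->
  measurable_fun (`[0, +oo[%classic : set R) f.
Proof.
move=> H; have -> : (`[0, +oo[%classic : set R) = \bigcup_n `[0, n%:R]%classic.
  apply/seteqP; split => x /=; last by move=> [n _]; rewrite /= !in_itv /= andbT => /andP[].
  rewrite in_itv /= andbT => x0; exists (Num.bound x) => //=.
  by rewrite in_itv /= x0 ltW //; apply: le_lt_trans (archi_boundP x0); rewrite ?lexx.
by apply/measurable_fun_bigcup => // n; apply: H.
Qed.

Lemma meas_glue (a b c : R) f : a <= b -> b <= c ->
  measurable_fun `[a, b[ f -> measurable_fun `[b, c] f -> measurable_fun `[a, c] f.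
Proof.
move=> ab bc m1 m2; have -> : `[a, c]%classic = `[a, b[%classic `|` `[b, c]%classic.
  apply/seteqP; split => x /=; rewrite !in_itv /=.
    move=> /andP[ax xc]; case: (ltP x b) => xb; [left|right]; first by rewrite ax.
    by [].
  by move=> []; lra.
by apply/measurable_funU.
Qed.

End WithinContinuity.

(** * Continuity of translations in L^2 *)

Section TranslationContinuity.
Variable R : realType.
Notation mu := (@lebesgue_measure R).

Definition clamp (M x : R) := Num.max (- M) (Num.min M x).

Lemma clampP M x : 0 <= M ->
  [\/ M <= x /\ clamp M x = M, x <= - M /\ clamp M x = - M
    | (- M <= x /\ x <= M) /\ clamp M x = x].
Proof.
move=> M0; rewrite /clamp; have [Mx|/ltW xM] := leP M x.
  by apply: Or31; split => //; rewrite max_r //; lra.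
by have [h|/ltW h] := leP (- M) x; [apply: Or33; split => //|apply: Or32].
Qed.

Lemma clamp_norm M x : 0 <= M -> `|clamp M x| <= M.
Proof. by move=> M0; rewrite ler_norml; case: (clampP x M0) => -[h ->]; lra. Qed.

Lemma clamp_id M x : `|x| <= M -> clamp M x = x.
Proof. by rewrite ler_norml /clamp => /andP[a b]; rewrite min_r // max_r. Qed.

Lemma clamp_lip M x y : 0 <= M -> `|clamp M x - clamp M y| <= `|x - y|.
Proof.
move=> M0; have := ler_norm (x - y); have := ler_norm (y - x); rewrite (distrC y x) => h1 h2.
by rewrite ler_norml; case: (clampP x M0) => -[h ->]; case: (clampP y M0) => -[h' ->]; lra.
Qed.

Lemma clamp_sqr_le M x : 0 <= M -> (x - clamp M x) ^+ 2 <= x ^+ 2.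
Proof. by move=> M0; case: (clampP x M0) => -[h ->]; nra. Qed.

Lemma measurable_clamp M (D : set R) (g : R -> R) :
  measurable_fun D g -> measurable_fun D (fun x => clamp M (g x)).
Proof.
move=> mg; apply: measurable_maxr; first exact: measurable_cst.
by apply: measurable_minr => //; exact: measurable_cst.
Qed.

Lemma continuous_clamp M (g : R -> R) : 0 <= M ->
  continuous g -> continuous (fun x => clamp M (g x)).
Proof.
move=> M0 gc x; apply/cvgrPdist_lt => e e0.
have /cvgrPdist_lt/(_ _ e0) := gc x.
by apply: filterS => y; apply: le_lt_trans; exact: clamp_lip.
Qed.

Lemma clamp_approx (a b e : R) (g : R -> R) : measurable_fun `[a, b] g ->
  ig `[a, b] (fun x => g x ^+ 2) -> 0 < e ->
  exists2 M : R, 0 < M & Rintegral mu `[a, b] (fun x => (g x - clamp M (g x)) ^+ 2) < e.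
Proof.
move=> mg gi e0.
pose F n x := (g x - clamp n.+1%:R (g x)) ^+ 2.
have mF n : measurable_fun `[a, b] (F n).
  by apply: measurable_funX; apply: measurable_funB => //; exact: measurable_clamp.
have Fi n : ig `[a, b] (F n).
  apply: (ig_le _ _ _ gi) => // x _.
  by rewrite ger0_norm ?sqr_ge0 //; apply: clamp_sqr_le.
have [] := @dominated_convergence _ _ R mu `[a, b] (measurable_itv _) (fun n x => (F n x)%:E) (cst 0)%E
  (fun x => (g x ^+ 2)%:E).
- by move=> n; apply/measurable_EFinP; exact: mF.
- exact: measurable_cst.
- apply: aeW => x _; apply: cvg_near_cst; near=> n.
  rewrite /F clamp_id ?subrr ?expr0n //.
  apply: (@le_trans _ _ n%:R); last by rewrite ler_nat.
  by near: n; exact: nbhs_infty_ger.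
- exact: gi.
- apply: aeW => x n _; rewrite lee_fin ger0_norm ?sqr_ge0 //; exact: clamp_sqr_le.
move=> _ _; rewrite integral0 => /fine_cvgP[_ /cvgrPdist_lt/(_ _ e0)].
move=> /(@filter_ex _ _ _ _)[n]; rewrite sub0r normrN => h.
exists n.+1%:R => //; apply: le_lt_trans h; exact: ler_norm.
Unshelve. all: by end_near. Qed.
(** Density in L^1 is lifted to L^2 by truncation. If [k] and [h] are both bounded by [M], then
    [(k - h)^2 <= 2 M |k - h|], so an L^1 approximation of the truncated function, clamped at the
    same level, is an L^2 approximation. *)
Lemma L2_dense_continuous (a b e : R) (g : R -> R) : measurable_fun `[a, b] g ->
  ig `[a, b] (fun x => g x ^+ 2) -> 0 < e ->
  exists2 h : R -> R, continuous h &
    ig `[a, b] (fun x => (g x - h x) ^+ 2) /\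
    Rintegral mu `[a, b] (fun x => (g x - h x) ^+ 2) < e.
Proof.
move=> mg gi e0.
have e4 : 0 < e / 4 by rewrite divr_gt0.
have [M M0 gM] := clamp_approx mg gi e4.
pose k x := clamp M (g x).
have mk : measurable_fun `[a, b] k by exact: measurable_clamp.
have ki : ig `[a, b] k by apply: (ig_bnd (k := M)) => // x _; apply: clamp_norm; exact: ltW.
have [] := @approximation_continuous_integrable R `[a, b] k.
- exact: measurable_itv.
- by rewrite /= lebesgue_measure_itv /=; case: ifP => // _; rewrite -EFinD ltry.
- exact: ki.
move=> g_ [gc gint /fine_cvgP[_ /cvgrPdist_lt]].
have e8 : 0 < e / (8 * M) by rewrite divr_gt0 // mulr_gt0.
move=> /(_ _ e8) /(@filter_ex _ _ _ _)[n]; rewrite sub0r normrN => hn.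
pose h x := clamp M (g_ n x).
have hc : continuous h by apply: continuous_clamp => //; exact: ltW.
have mh : measurable_fun `[a, b] h by apply: measurable_clamp; exact: (ig_meas (gint n)).
have i1 : ig `[a, b] (fun x => `|k x - g_ n x|).
  by apply: ig_norm => //; apply: igB => //; exact: gint.
have i2 : ig `[a, b] (fun x => (g x - k x) ^+ 2).
  apply: (ig_le _ _ _ gi) => //; first by apply: measurable_funX; exact: measurable_funB.
  by move=> x _; rewrite ger0_norm ?sqr_ge0 //; apply: clamp_sqr_le; exact: ltW.
have le2 x : `[a, b]%classic x -> (g x - h x) ^+ 2 <= 2 * (g x - k x) ^+ 2 + 4 * M * `|k x - g_ n x|.
  move=> _.
  have kM : `|k x| <= M by apply: clamp_norm; exact: ltW.
  have hM : `|h x| <= M by apply: clamp_norm; exact: ltW.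
  have b1 : `|k x - h x| <= `|k x - g_ n x|.
    by rewrite -{1}(clamp_id kM); apply: clamp_lip; exact: ltW.
  have b2 : `|k x - h x| <= 2 * M by have := ler_normB (k x) (h x); lra.
  have b3 : (k x - h x) ^+ 2 <= 2 * M * `|k x - g_ n x|.
    by rewrite -real_normK ?num_real // expr2; apply: ler_pM.
  have := sqr_ge0 ((g x - k x) - (k x - h x)); rewrite -subr_ge0; move: b3; nra.
have i3 : ig `[a, b] (fun x => 2 * (g x - k x) ^+ 2 + 4 * M * `|k x - g_ n x|).
  by apply: igD => //; apply: igZ.
have i4 : ig `[a, b] (fun x => (g x - h x) ^+ 2).
  apply: (ig_le _ _ _ i3) => //; first by apply: measurable_funX; exact: measurable_funB.
  by move=> x xab; rewrite ger0_norm ?sqr_ge0 //; exact: le2.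
exists h => //; split => //.
apply: le_lt_trans (Rint_le _ i4 i3 le2) _ => //.
rewrite RintD ?RintZ //; [|exact: igZ|exact: igZ].
have {}hn : Rintegral mu `[a, b] (fun x => `|k x - g_ n x|) < e / (8 * M).
  by apply: le_lt_trans hn; exact: ler_norm.
have : 4 * M * Rintegral mu `[a, b] (fun x => `|k x - g_ n x|) < e / 2.
  by rewrite -ltr_pdivlMl ?mulr_gt0 //; apply: lt_le_trans hn _; rewrite le_eqVlt; apply/orP; left; apply/eqP; field; lra.
by move: gM; rewrite -/(k _); lra.
Qed.

(** The function is replaced by a continuous one, which is uniformly continuous on the segment; the
    two replacement errors do not depend on the shift, because translation preserves the
    integral. *)
Lemma translation_L2_continuous (T N e : R) (g : R -> R) : 0 <= T -> 0 <= N ->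
  measurable_fun `[- T, N] g -> ig `[- T, N] (fun x => g x ^+ 2) -> 0 < e ->
  exists2 d : R, 0 < d & forall s s', s \in `[0, N] -> s' \in `[0, N] -> `|s - s'| < d ->
    Rintegral mu `[- T, 0] (fun xi => (g (s + xi) - g (s' + xi)) ^+ 2) < e.
Proof.
move=> T0 N0 mg gi e0.
have e12 : 0 < e / 12 by rewrite divr_gt0.
have [h hc [hi hlt]] := L2_dense_continuous mg gi e12.
have m0 : 0 < Num.sqrt (e / (6 * (T + 1))).
  by rewrite sqrtr_gt0 divr_gt0 // mulr_gt0 //; lra.
have hw : {within `[- T, N], continuous h} by exact: continuous_subspaceT.
have [d d0 hd] := within_unif_continuous hw m0.
have mh (D : set R) : measurable_fun D h by apply: measurable_funTS; exact: continuous_measurable_fun.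
have sub s : s \in `[0, N] -> `[s - T, s + 0]%classic `<=` `[- T, N]%classic.
  by rewrite in_itv /= => /andP[s0 sN] x /=; rewrite !in_itv /=; lra.
have shift_i (f : R -> R) s : s \in `[0, N] -> ig `[- T, N] f -> ig `[- T, 0] (fun xi => f (s + xi)).
  by move=> sN fi; apply: ig_itv_shift; apply: ig_sub fi => //; exact: sub.
have bnd s : s \in `[0, N] -> Rintegral mu `[- T, 0] (fun xi => (g (s + xi) - h (s + xi)) ^+ 2) < e / 12.
  move=> sN; rewrite (Rint_itv_shift (f := fun x => (g x - h x) ^+ 2)).
    apply: le_lt_trans hlt; apply: Rint_subset_le => //; first exact: sub.
    by move=> x _; exact: sqr_ge0.
  apply: ig_meas; apply: ig_sub hi => //; exact: sub.
exists d => // s s' sN s'N ss'.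
(* From [(A + B + C)^2 <= 3 (A^2 + B^2 + C^2)]: the two approximation errors contribute [3 e / 12]
   each, and the continuous part, [3 e / (6 (T + 1))] pointwise, contributes less than [e / 2]. *)
pose F xi := 3 * (g (s + xi) - h (s + xi)) ^+ 2 + (3 * (g (s' + xi) - h (s' + xi)) ^+ 2 + e / (2 * (T + 1))).
have Fi : ig `[- T, 0] F.
  apply: igD => //; first by apply: igZ => //; apply: (shift_i (fun x => (g x - h x) ^+ 2)).
  apply: igD => //; first by apply: igZ => //; apply: (shift_i (fun x => (g x - h x) ^+ 2)).
  exact: ig_cst_itv.
have ms s0 : s0 \in `[0, N] -> measurable_fun `[- T, 0] (fun xi => g (s0 + xi)).
  by move=> s0N; apply: measurable_fun_itv_shift; apply: measurable_funS mg => //; exact: sub.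
have le3 x : `[- T, 0]%classic x -> (g (s + x) - g (s' + x)) ^+ 2 <= F x.
  rewrite /= in_itv /= => /andP[x1 x2].
  have : `|h (s + x) - h (s' + x)| < Num.sqrt (e / (6 * (T + 1))).
    apply: hd; last by rewrite (_ : s + x - (s' + x) = s - s') //; ring.
      by apply: (sub s sN); rewrite /= in_itv /=; move: sN; rewrite in_itv /=; lra.
    by apply: (sub s' s'N); rewrite /= in_itv /=; move: s'N; rewrite in_itv /=; lra.
  rewrite -ltr_sqr ?nnegrE ?sqrtr_ge0 // sqr_sqrtr; last by rewrite divr_ge0 // ?mulr_ge0 //; lra.
  rewrite real_normK ?num_real // => hh.
  have e1 : e / (2 * (T + 1)) = 3 * (e / (6 * (T + 1))) by field; lra.
  rewrite /F e1; move: hh; set A := g _ ; set B := g _; set C := h _; set D := h _ => hh.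
  have := sqr_ge0 ((A - C) - (C - D)); have := sqr_ge0 ((A - C) + (B - D)); have := sqr_ge0 ((C - D) + (B - D)).
  nra.
have gi2 : ig `[- T, 0] (fun xi => (g (s + xi) - g (s' + xi)) ^+ 2).
  apply: (ig_le _ _ _ Fi) => //.
    by apply: measurable_funX; apply: measurable_funB; apply: ms.
  by move=> x xT; rewrite ger0_norm ?sqr_ge0 //; exact: le3.
apply: le_lt_trans (Rint_le _ gi2 Fi le3) _ => //.
have i1 s0 : s0 \in `[0, N] -> ig `[- T, 0] (fun xi => (g (s0 + xi) - h (s0 + xi)) ^+ 2).
  by move=> s0N; apply: (shift_i (fun x => (g x - h x) ^+ 2)).
rewrite /F RintD ?RintZ //; try exact: i1; try exact: igZ (i1 _ _); last first.
  by apply: igD => //; [apply: igZ => //; exact: i1|exact: ig_cst_itv].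
rewrite RintD ?RintZ //; try exact: i1; try exact: ig_cst_itv; last by apply: igZ => //; exact: i1.
rewrite Rint_cst_itv; last lra.
have -> : e * ((2 * (T + 1))^-1 * (0 - - T)) = (e / 2) * (T / (T + 1)) by field; lra.
have : T / (T + 1) <= 1 by rewrite ler_pdivrMr; lra.
have := bnd s sN; have := bnd s' s'N; nra.
Qed.

End TranslationContinuity.

(** * Paths and admissible controls *)

(** The data are packed with hypotheses on them, so that each later lemma takes a single argument;
    the final theorem builds one instance. *)
Record model (R : realType) := Model {
  delay : R; rate : R; discount : R; lipc : R;
  memory : R -> R; income : R -> R -> R; util1 : R -> R; util2 : R -> R;
  delay_gt0 : 0 < delay;
  rate_gt0 : 0 < rate;
  discount_gt0 : 0 < discount;
  memory_W12 : W12 delay memory;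
  memory_ge0 : forall t, t \in `[- delay, 0] -> 0 <= memory t;
  income_concave : forall (x1 y1 x2 y2 l : R), 0 <= x1 -> 0 <= x2 -> 0 <= l <= 1 ->
    l * income x1 y1 + (1 - l) * income x2 y2
      <= income (l * x1 + (1 - l) * x2) (l * y1 + (1 - l) * y2);
  income_mono : forall x y y' : R, 0 <= x -> y <= y' -> income x y <= income x y';
  lipc_ge0 : 0 <= lipc;
  income_lip : forall x y x' y' : R, 0 <= x -> 0 <= x' ->
    `| income x y - income x' y' | <= lipc * (`| x - x' | + `| y - y' |);
  income_pos : forall y : R, 0 < y -> 0 < income 0 y;
  income_neg : forall x y : R, x < 0 -> income x y = income 0 y;
  util1_cont : {within (`[0%R, +oo[%classic : set R), continuous util1};
  util1_diff : forall t : R, 0 < t -> derivable util1 t 1 /\ derivable (derive1 util1) t 1 /\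
    {for t, continuous (derive1 (derive1 util1))};
  util1_incr : forall t : R, 0 < t -> 0 < (derive1 util1) t;
  util1_concave : forall t : R, 0 < t -> (derive1 (derive1 util1)) t < 0;
  util1_bounded : exists M : R, forall c : R, 0 <= c -> `| util1 c | <= M;
  util2_cont : {within (`]0%R, +oo[%classic : set R), continuous util2};
  util2_incr : forall x y : R, 0 < x -> x < y -> util2 x < util2 y;
  util2_concave : forall x y l : R, 0 < x -> 0 < y -> 0 <= l <= 1 ->
    l * util2 x + (1 - l) * util2 y <= util2 (l * x + (1 - l) * y);
  util2_bounded : exists M : R, forall x : R, 0 < x -> util2 x <= M;
  util2_int : (\int[@lebesgue_measure R]_(t in (`[0%R, +oo[%classic : set R))
    ((expR (- (discount * t)) * util2 (expR (- (lipc * t))))%:E) > -oo)%E }.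

Section Paths.
Variables (R : realType) (M : model R).
Notation mu := (@lebesgue_measure R).
Notation T := (delay M).
Notation r := (rate M).
Notation C := (lipc M).
Notation a := (memory M).
Notation f0 := (income M).
Let T0 : 0 < T := delay_gt0 M.
Let aW : W12 T a := memory_W12 M.
Let a0 := @memory_ge0 _ M.
Let C0 : 0 <= C := lipc_ge0 M.
Let f0lip := @income_lip _ M.
Let f0neg := @income_neg _ M.
Notation I := (`[- T, 0]%classic : set R).
Implicit Types (x dx : R -> R) (eta zeta : Hpt R) (h s t : R).

Lemma W12_cont : {within `[- T, 0], continuous a}.
Proof.
case: aW => g [gL ag].
have gi := L2_ig gL.
have Tle : - T <= 0 by rewrite oppr_le0 ltW.
have /within_contP H := parameterized_integral_continuous Tle gi.
apply/within_contP => x xI e e0; have [d d0 dh] := H x xI e e0.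
exists d => // y yI xy; have := dh y yI xy.
by rewrite (ag x xI) (ag y yI) opprD addrACA subrr add0r.
Qed.

Lemma W12_bounded : exists2 A : R, 0 <= A & forall t, t \in `[- T, 0] -> `|a t| <= A.
Proof.
have Tle : - T <= 0 by rewrite oppr_le0 ltW.
have [c cI ac] := EVT_max Tle W12_cont.
exists (a c); first exact: a0.
by move=> t tI; rewrite ger0_norm; [apply: ac|apply: a0].
Qed.

Lemma W12_L2 : L2 T a.
Proof.
have [A A0 aA] := W12_bounded; apply: (@L2_bnd _ _ A).
  by apply: within_cont_meas => //; exact: W12_cont.
by move=> x xI; apply: aA; rewrite in_itv /=.
Qed.

(** Extending [f0] to negative [x] by its value at 0 means composing it with [x |-> max 0 x], which
    does not increase distances. *)
Lemma f0_lipschitz (x y x' y' : R) : `| f0 x y - f0 x' y' | <= C * (`| x - x' | + `| y - y' |).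
Proof.
have e (u v : R) : f0 u v = f0 (Num.max 0 u) v.
  by case: leP => // u0; exact: f0neg.
rewrite (e x) (e x'); apply: (le_trans (f0lip _ _ _ _)); rewrite ?le_max ?lexx //.
apply: ler_wpM2l => //; rewrite lerD2r.
have := ler_norm (x - x'); have := ler_norm (x' - x); rewrite (distrC x' x) ler_norml.
by case: (leP 0 x) => h1; case: (leP 0 x') => h2; lra.
Qed.

Lemma f0_within_cont (A : set R) (x y : R -> R) : {within A, continuous x} -> {within A, continuous y} ->
  {within A, continuous (fun s => f0 (x s) (y s))}.
Proof.
move=> /within_contP xc /within_contP yc; apply/within_contP => s As e e0.
have C1 : 0 < C + 1 by rewrite ltr_wpDl.
have e1 : 0 < e / (2 * (C + 1)) by rewrite divr_gt0 // mulr_gt0.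
have [d1 d10 h1] := xc s As _ e1; have [d2 d20 h2] := yc s As _ e1.
exists (Num.min d1 d2) => [|t At]; first by rewrite lt_min d10.
rewrite lt_min => /andP[/(h1 _ At) k1 /(h2 _ At) k2].
apply: le_lt_trans (f0_lipschitz _ _ _ _) _.
have k3 : `|x s - x t| + `|y s - y t| < e / (C + 1).
  have -> : e / (C + 1) = e / (2 * (C + 1)) + e / (2 * (C + 1)) by field; lra.
  exact: ltrD.
move: k3; rewrite ltr_pdivlMr // => k3.
have := normr_ge0 (x s - x t); have := normr_ge0 (y s - y t); nra.
Qed.

Definition hist (x : R -> R) s : Hpt R := (x s, fun xi => x (s + xi)).
Definition delayed_term x s := Rintegral mu I (fun xi => a xi * x (s + xi)).
(** Agreement with [eta.2] is required at every negative time and not only almost everywhere; this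
    makes [x] measurable on [[-T, h]]. The value at time 0 is [eta.1], which is unrelated to
    [eta.2 0]. *)
Definition traj eta x dx h :=
  [/\ inH T eta, forall t, - T <= t < 0 -> x t = eta.2 t, ig `[0, h] dx &
      forall t, 0 <= t <= h -> x t = eta.1 + Rintegral mu `[0, t] dx].
Definition consumption x dx t := r * x t + f0 (x t) (delayed_term x t) - dx t.

Lemma traj_sub eta x dx h h' : 0 <= h' <= h -> traj eta x dx h -> traj eta x dx h'.
Proof.
move=> hh [eH x1 di x2]; split => //.
  by apply: ig_sub di => // t /=; rewrite !in_itv /=; lra.
by move=> t th; apply: x2; lra.
Qed.

Lemma traj_cont eta x dx h : 0 <= h -> traj eta x dx h -> {within `[0, h], continuous x}.
Proof.
move=> h0 [_ _ di x2].
have /within_contP H := parameterized_integral_continuous h0 di.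
apply/within_contP => s sI e e0; have [d d0 dh] := H s sI e e0.
exists d => // t tI st; have := dh t tI st.
by rewrite (x2 s) ?(x2 t) // opprD addrACA subrr add0r.
Qed.

Lemma traj_meas eta x dx h : 0 <= h -> traj eta x dx h -> measurable_fun `[- T, h] x.
Proof.
move=> h0 tr; have xc := traj_cont h0 tr; case: tr => [[em _] x1 _ _].
apply: (@meas_glue _ _ 0) => //; first by rewrite oppr_le0 ltW.
  apply: (eq_measurable_fun eta.2); last first.
    by apply: measurable_funS em => // t /=; rewrite !in_itv /=; lra.
  by move=> t; rewrite inE /= in_itv /= => /x1.
exact: within_cont_meas.
Qed.

Lemma traj_sqr eta x dx h : 0 <= h -> traj eta x dx h -> ig `[- T, h] (fun t => x t ^+ 2).
Proof.
move=> h0 tr; have xm := traj_meas h0 tr; have xc := traj_cont h0 tr.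
case: tr => [[em e2] x1 _ x2].
have T' : - T <= 0 by rewrite oppr_le0 ltW.
apply: (@ig_glue _ _ 0) => //.
  (* The constant [x 0 ^+ 2] takes care of the endpoint 0, where [x] need not equal [eta.2]. *)
  apply: (@ig_le _ _ _ (fun t => eta.2 t ^+ 2 + x 0 ^+ 2)) => //.
  - by apply: measurable_funX; apply: measurable_funS xm => // t /=; rewrite !in_itv /=; lra.
  - move=> t /=; rewrite in_itv /= => /andP[t1]; rewrite ger0_norm ?sqr_ge0 //.
    rewrite le_eqVlt => /predU1P[->|t0]; first by rewrite lerDr sqr_ge0.
    by rewrite x1 ?t1 // lerDl sqr_ge0.
  - by apply: igD => //; exact: ig_cst_itv.
by apply: within_cont_ig; exact: within_contM.
Qed.

Lemma traj_hist eta x dx h s : 0 <= s <= h -> traj eta x dx h -> inH T (hist x s).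
Proof.
move=> sh tr; have h0 : 0 <= h by lra.
have sub : `[s - T, s + 0]%classic `<=` `[- T, h]%classic.
  by move=> t /=; rewrite !in_itv /=; lra.
split.
  apply: measurable_fun_itv_shift; apply: measurable_funS (traj_meas h0 tr) => //.
apply: (ig_itv_shift (f := fun t => x t ^+ 2)).
by apply: ig_sub (traj_sqr h0 tr).
Qed.

Lemma traj_inH eta x dx h : traj eta x dx h -> inH T eta. Proof. by case. Qed.

Lemma traj0 eta x dx h : 0 <= h -> traj eta x dx h -> x 0 = eta.1.
Proof. by move=> h0 [_ _ _ x2]; rewrite x2 ?lexx // Rint_point addr0. Qed.

Lemma traj_diff eta x dx h s t : 0 <= s <= t -> t <= h -> traj eta x dx h ->
  x t = x s + Rintegral mu `[s, t] dx.
Proof.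
move=> st th [_ _ di x2]; rewrite (x2 t) ?(x2 s); [|lra|lra].
rewrite (@Rint_split _ 0 s t) ?addrA //; [lra|lra|].
by apply: ig_sub di => // u /=; rewrite !in_itv /=; lra.
Qed.

(** The current value is an indefinite integral, and the past moves by translation, which is
    continuous in L^2; the initial history needs no continuity. *)
Lemma traj_hist_cont eta x dx h e : 0 <= h -> traj eta x dx h -> 0 < e ->
  exists2 d : R, 0 < d & forall s t, s \in `[0, h] -> t \in `[0, h] -> `|s - t| < d ->
    Hnorm T (Hsub (hist x s) (hist x t)) < e.
Proof.
move=> h0 tr e0.
have e2 : 0 < e ^+ 2 / 2 by rewrite divr_gt0 // exprn_gt0.
have [d1 d10 h1] := within_unif_continuous (traj_cont h0 tr) (divr_gt0 e0 (ltr0Sn R 1)).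
have [d2 d20 h2] := translation_L2_continuous (ltW T0) h0 (traj_meas h0 tr) (traj_sqr h0 tr) e2.
exists (Num.min d1 d2) => [|s t sI tI]; first by rewrite lt_min d10.
rewrite lt_min => /andP[/(h1 s t sI tI) k1 /(h2 s t sI tI) k2].
apply: Hnorm_lt; first exact: ltW.
rewrite /=; move: k1; rewrite -ltr_sqr ?nnegrE ?divr_ge0 //; [|exact: ltW].
by rewrite real_normK ?num_real // expr_div_n; move: k2; nra.
Qed.

Lemma inH_memory : inH T (0, a). Proof. exact: W12_L2. Qed.

Lemma delayed_lip eta zeta : inH T eta -> inH T zeta ->
  `|Rintegral mu I (fun xi => a xi * eta.2 xi) - Rintegral mu I (fun xi => a xi * zeta.2 xi)|
    <= Hnorm T (0, a) * Hnorm T (Hsub eta zeta).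
Proof.
move=> h1 h2; have e eta' : Rintegral mu I (fun xi => a xi * eta'.2 xi) = Hinner T eta' (0, a).
  by rewrite /Hinner mulr0 add0r; apply: Rint_eq => t _; rewrite mulrC.
have k := inH_memory; rewrite !e -HinnerBl // mulrC; apply: cauchy_schwarz => //.
exact: inHB.
Qed.

Lemma delayed_cont eta x dx h : 0 <= h -> traj eta x dx h -> {within `[0, h], continuous (delayed_term x)}.
Proof.
move=> h0 tr; apply/within_contP => s sI e e0.
have N0 := Hnorm_ge0 T ((0, a) : Hpt R).
have e1 : 0 < e / (Hnorm T (0, a) + 1) by rewrite divr_gt0 //; lra.
have [d d0 dh] := traj_hist_cont h0 tr e1; exists d => // t tI st.
have sH : inH T (hist x s) by apply: traj_hist tr; move: sI; rewrite /= in_itv.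
have tH : inH T (hist x t) by apply: traj_hist tr; move: tI; rewrite /= in_itv.
have := dh s t sI tI st; rewrite ltr_pdivlMr; last lra.
have := delayed_lip sH tH; rewrite /= -/(delayed_term x s) -/(delayed_term x t).
have := Hnorm_ge0 T (Hsub (hist x s) (hist x t)); nra.
Qed.

Lemma drift_cont eta x dx h : 0 <= h -> traj eta x dx h ->
  {within `[0, h], continuous (fun s => r * x s + f0 (x s) (delayed_term x s))}.
Proof.
move=> h0 tr; have xc := traj_cont h0 tr; have yc := delayed_cont h0 tr.
have fc := f0_within_cont xc yc.
by apply: within_contD => //; apply: within_contM => //; exact: within_cont_cst.
Qed.

Lemma consume_ig eta x dx h : 0 <= h -> traj eta x dx h -> ig `[0, h] (consumption x dx).
Proof.
move=> h0 tr; apply: igB => //; first exact: within_cont_ig (drift_cont h0 tr).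
by case: tr.
Qed.

Lemma dxE x dx t : dx t = r * x t + f0 (x t) (delayed_term x t) - consumption x dx t.
Proof. by rewrite /consumption opprB addrC subrK. Qed.

End Paths.

(** * Integrability of functions bounded above *)

Section IntegrableOfPositivePart.
Context d (X : measurableType d) (R : realType).
Variable mu : {measure set X -> \bar R}.
Local Open Scope ereal_scope.

(** If the negative part had infinite integral, the integral itself would be [-oo], the positive
    part being finite. This fits utilities that are bounded above but possibly unbounded below. *)
Lemma integrable_of_funepos (D : set X) (f : X -> \bar R) : measurable D ->
  measurable_fun D f -> \int[mu]_(x in D) f^\+ x < +oo -> \int[mu]_(x in D) f x > -oo ->
  mu.-integrable D f.
Proof.
move=> mD mf posi J; apply/integrableP; split => //.
rewrite (eq_integral (fun t => f^\+ t + f^\- t)); last first.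
  by move=> t _; rewrite -[LHS]/((abse \o f) t) fune_abse.
rewrite ge0_integralD //; [|exact: measurable_funepos|exact: measurable_funeneg].
apply: lte_add_pinfty => //; rewrite ltNge leye_eq; apply/negP => /eqP ny.
move: J; rewrite integralE ny.
by case: (\int[mu]_(t in D) f^\+ t) posi.
Qed.

End IntegrableOfPositivePart.

(** * Admissible paths and the value function *)

Section Value.
Variables (R : realType) (M : model R).
Notation mu := (@lebesgue_measure R).
Notation T := (delay M).
Notation r := (rate M).
Notation rho := (discount M).
Notation a := (memory M).
Notation f0 := (income M).
Notation U1 := (util1 M).
Notation U2 := (util2 M).
Notation I := (`[- T, 0]%classic : set R).
Notation ray := (`[0%R, +oo[%classic : set R).
Notation traj := (traj M).
Notation delayed := (delayed_term M).
Notation consume := (consumption M).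
Notation DVM := (DV T r rho a f0 U1 U2).
Notation VM := (Vfun T r rho a f0 U1 U2).
Notation stateM := (is_state T r a f0).
Implicit Types (x dx c : R -> R) (eta zeta : Hpt R) (h s t : R).

Definition adm eta x dx :=
  (forall h, 0 <= h -> traj eta x dx h) /\ (forall t, 0 <= t -> 0 < x t /\ 0 <= consume x dx t).

Definition discounted_gain x dx t := expR (- (rho * t)) * (U1 (consume x dx t) + U2 (x t)).

(** A state matches the initial history only almost everywhere. Replacing its past by [eta.2] gives
    a pointwise path with the same consumption, because the delayed integrals do not see null
    sets. *)
Lemma state_path eta c x : inH T eta -> stateM eta c x ->
  exists x' dx', [/\ forall h, 0 <= h -> traj eta x' dx' h,
    forall t, 0 <= t -> x' t = x t & forall t, 0 <= t -> consume x' dx' t = c t].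
Proof.
move=> eH [xc [[N [mN N0 subN]] F]].
pose x' t := if t < 0 then eta.2 t else x t.
pose dx' s := r * x s + f0 (x s) (Rintegral mu I (fun xi => a xi * x (s + xi))) - c s.
have x'x t : 0 <= t -> x' t = x t by move=> t0; rewrite /x' ltNge t0.
exists x', dx'; split => //.
- move=> h h0; split => //.
  + by move=> t /andP[_ t0]; rewrite /x' t0.
  + by have [Fi _] := F h h0.
  + by move=> t /andP[t0 _]; rewrite x'x //; have [_ ->] := F t t0.
- move=> t t0; rewrite /consume /dx' x'x //.
  suff -> : delayed x' t = Rintegral mu I (fun xi => a xi * x (t + xi)) by ring.
  rewrite /delayed /Rintegral; congr fine.
  (* The integrand at time [t] can change only on the exceptional set [N] translated by [t]. The
     original [x] need not be measurable on its past. *)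
  apply: (@integral_eq_off_null _ (measurableTypeR R) _ mu _ ((fun u => t + u) @^-1` N)).
  - exact: measurable_shift_preimage.
  - exact: (etrans (lebesgue_measure_shift t mN) N0).
  - move=> xi /=; rewrite in_itv /= => /andP[x1 x2] nN; congr (a xi * _)%:E.
    rewrite /x'; case: ltP => // tx; apply/esym.
    apply: contrapT => ne; apply: nN; apply: subN => /= H; apply: ne; apply: H.
    by rewrite in_itv /= tx andbT; lra.
Qed.

Lemma path_state eta x dx : adm eta x dx ->
  [/\ L1loc_nonneg (consume x dx), stateM eta (consume x dx) x & inH T eta].
Proof.
move=> [tr pos]; have eH := traj_inH (tr 0 (lexx 0)); split => //.
  split; first by move=> t /pos[].
  have ci h : 0 <= h -> ig `[0, h] (consume x dx) by move=> h0; apply: consume_ig h0 (tr h h0).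
  by split => //; apply: meas_ray => h h0; apply: ig_meas; exact: ci.
split; first by apply: within_cont_ray => h h0; apply: traj_cont h0 (tr h h0).
split.
  apply: aeW => t; rewrite in_itv /= => tT.
  by case: (tr 0 (lexx 0)) => _ x1 _ _; apply: x1.
move=> t t0 F.
have FE s : F s = dx s by rewrite /F [RHS](dxE M x).
have -> : F = dx by apply/funext.
by case: (tr t t0) => _ _ di x2; split => //; rewrite (x2 t) // t0 lexx.
Qed.

Lemma exp_ig k : ig ray (fun t => k * expR (- (rho * t))).
Proof.
have rho0 := discount_gt0 M.
apply: (@eq_ig _ _ (fun t => k / rho * exponential_pdf rho t)) => //.
  move=> t /=; rewrite in_itv /= andbT => t0; rewrite exponential_pdfE //.
  by rewrite mulrA divfK ?gt_eqF // mulNr.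
apply: igZ => //; apply: (@ig_sub _ setT) => //.
exact: integrable_exponential_pdf.
Qed.

Lemma gain_meas eta x dx : adm eta x dx -> measurable_fun ray (discounted_gain x dx).
Proof.
move=> ad; have [[c0 [cm _]] [xc _] _] := path_state ad; case: ad => tr pos.
apply: measurable_funM.
  apply: measurable_funTS; apply: continuous_measurable_fun => t.
  apply: continuous_comp; last exact: continuous_expR.
  by apply: continuousN; apply: continuousM => //; exact: cst_continuous.
apply: measurable_funD.
  apply: (measurable_comp (F := ray)) => //.
    by move=> _ [t /= + <-]; rewrite !in_itv /= !andbT => /c0.
  by apply: within_cont_meas => //; exact: util1_cont.
apply: (measurable_comp (F := (`]0%R, +oo[%classic : set R))) => //.
- by move=> _ [t /= + <-]; rewrite !in_itv /= !andbT => /pos[].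
- by apply: within_cont_meas => //; exact: util2_cont.
- exact: within_cont_meas.
Qed.

Lemma util_bound : exists2 K : R, 0 <= K & (forall c : R, 0 <= c -> `|U1 c| <= K) /\
  (forall c y : R, 0 <= c -> 0 < y -> U1 c + U2 y <= K).
Proof.
have [M1 h1] := util1_bounded M; have [M2 h2] := util2_bounded M.
exists (`|M1| + `|M2|); first by rewrite addr_ge0.
split=> [c /h1|c y /h1 k1 /h2 k2].
  by have := ler_norm M1; have := normr_ge0 M2; lra.
by move: k1; rewrite ler_norml; have := ler_norm M1; have := ler_norm M2; lra.
Qed.

Lemma gain_ig eta x dx : adm eta x dx ->
  (\int[mu]_(t in ray) (discounted_gain x dx t)%:E > -oo)%E -> ig ray (discounted_gain x dx).
Proof.
move=> ad J; have gm := gain_meas ad; have [K K0 [_ UK]] := util_bound.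
have gm' : measurable_fun ray (fun t => (discounted_gain x dx t)%:E) by exact/measurable_EFinP.
have posi : (\int[mu]_(t in ray) ((fun t => (discounted_gain x dx t)%:E)^\+ t) < +oo)%E.
  have /integrableP[km] := exp_ig K; apply: le_lt_trans.
  apply: ge0_le_integral => //.
  - exact: measurable_funepos.
  - exact: measurableT_comp.
  - move=> t /=; rewrite in_itv /= andbT => t0; rewrite funeposE /= -EFin_max lee_fin.
    case: ad => _ /(_ t t0)[x0 c0].
    rewrite ge_max normr_ge0 andbT; apply: le_trans (ler_norm _).
    by rewrite mulrC /discounted_gain ler_wpM2l ?expR_ge0 // UK.
exact: integrable_of_funepos.
Qed.

Lemma gain_bound : exists K : R, forall eta x dx, adm eta x dx -> ig ray (discounted_gain x dx) ->
  Rintegral mu ray (discounted_gain x dx) <= K.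
Proof.
have [K K0 [_ UK]] := util_bound.
exists (Rintegral mu ray (fun t => K * expR (- (rho * t)))) => eta x dx ad gi.
apply: Rint_le => //; first exact: exp_ig.
move=> t /=; rewrite in_itv /= andbT => t0.
case: ad => _ /(_ t t0)[x0 c0].
by rewrite mulrC /discounted_gain ler_wpM2l ?expR_ge0 // UK.
Qed.

Lemma Jfun_gain eta c x x' dx' : (forall t, 0 <= t -> x' t = x t) ->
  (forall t, 0 <= t -> consume x' dx' t = c t) ->
  Jfun rho U1 U2 c x = (\int[mu]_(t in ray) (discounted_gain x' dx' t)%:E)%E.
Proof.
move=> e1 e2; apply: eq_integral => t; rewrite inE /= in_itv /= andbT => t0.
by rewrite /discounted_gain e1 ?e2.
Qed.

Lemma V_fin eta : DVM eta -> VM eta = (fine (VM eta))%:E.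
Proof.
move=> [e0 [eH Vy]]; rewrite fineK // fin_numE gt_eqF //=.
have [K KP] := gain_bound.
suff : (VM eta <= K%:E)%E by move=> h; rewrite lt_eqF // (le_lt_trans h) // ltry.
apply: ge_ereal_sup => _ [c [x [cL [st [x0 ->]]]]].
have [x' [dx' [tr ex ec]]] := state_path eH st.
have ad : adm eta x' dx'.
  split => // t t0; rewrite ex // ec //; split; first exact: x0.
  by case: cL => c0 _; exact: c0.
rewrite (Jfun_gain eta ex ec).
have [Jy|] := ltP -oo%E (\int[mu]_(t in ray) (discounted_gain x' dx' t)%:E)%E; last first.
  by rewrite leeNy_eq => /eqP ->; rewrite leNye.
have gi := gain_ig ad Jy.
by rewrite EFin_Rintegral // lee_fin; exact: KP ad gi.
Qed.

(** Together with [V_approx] this is the interface to [Vfun]: later arguments deal with paths of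
    integrable gain and never unfold the supremum. *)
Lemma V_lower eta x dx : adm eta x dx -> ig ray (discounted_gain x dx) ->
  DVM eta /\ Rintegral mu ray (discounted_gain x dx) <= fine (VM eta).
Proof.
move=> ad gi; have [cL st eH] := path_state ad.
have le : ((Rintegral mu ray (discounted_gain x dx))%:E <= VM eta)%E.
  apply: ereal_sup_ubound; exists (consume x dx), x; split => //; split => //; split.
    by move=> t t0; case: ad => _ /(_ t t0)[].
  by rewrite -EFin_Rintegral // (@Jfun_gain eta _ x x dx).
have D : DVM eta.
  split; last by split => //; apply: lt_le_trans le; exact: ltNyr.
  case: ad => tr /(_ 0 (lexx 0))[x0 _].
  by rewrite -(traj0 (lexx 0) (tr 0 (lexx 0))).
by split => //; rewrite -lee_fin -V_fin.
Qed.

Lemma V_approx eta e : DVM eta -> 0 < e -> exists x dx,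
  [/\ adm eta x dx, ig ray (discounted_gain x dx) & fine (VM eta) - e < Rintegral mu ray (discounted_gain x dx)].
Proof.
move=> D e0; have VE := V_fin D; case: D => [_ [eH _]].
have fn : VM eta \is a fin_num by rewrite VE.
have [_ [c [x [cL [st [x0 ->]]]]]] := ub_ereal_sup_adherent e0 fn.
rewrite -/(VM eta) VE.
have [x' [dx' [tr ex ec]]] := state_path eH st.
have ad : adm eta x' dx'.
  split => // t t0; rewrite ex // ec //; split; first exact: x0.
  by case: cL => c0 _; exact: c0.
rewrite (Jfun_gain eta ex ec) -EFinB => lt.
have gi : ig ray (discounted_gain x' dx') by apply: gain_ig ad _; apply: lt_trans lt; exact: ltNyr.
by exists x', dx'; split => //; rewrite -lte_fin -EFin_Rintegral.
Qed.

End Value.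

(** * Cutting and shifting integrals on intervals and half-lines *)

Section Intervals.
Variable R : realType.
Notation mu := (@lebesgue_measure R).
Notation ray := (`[0%R, +oo[%classic : set R).
Implicit Types (f g : R -> R).

(** Paths glued at time [v] follow the second piece there, so the integrands are known to agree on
    [[u, v[] only. *)
Lemma ig_eq_co (u v : R) f g : u <= v -> (forall x, u <= x < v -> f x = g x) ->
  ig `[u, v] f -> ig `[u, v] g.
Proof.
move=> uv fg fi.
have -> : `[u, v]%classic = `[u, v[%classic `|` `[v, v]%classic.
  apply/seteqP; split => x /=; rewrite !in_itv /=.
    by move=> ?; case: (ltP x v) => xb; [left|right]; lra.
  by move=> []; lra.
apply: igU => //.
  apply: (@eq_ig _ _ f) => //.
  by apply: ig_sub fi => // x; rewrite /= !in_itv /=; lra.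
apply: (@eq_ig _ _ (fun=> g v)) => //; last exact: ig_cst_itv.
by move=> x; rewrite /= in_itv /= => xv; congr g; lra.
Qed.

Lemma Rint_eq_co (u v : R) f g : u <= v -> (forall x, u <= x < v -> f x = g x) ->
  Rintegral mu `[u, v] f = Rintegral mu `[u, v] g.
Proof.
move=> uv fg; rewrite /Rintegral; congr fine.
apply: (@integral_eq_off_null _ (measurableTypeR R) _ mu _ [set v]) => //.
  exact: lebesgue_measure_set1.
move=> x; rewrite /= in_itv /= => /andP[ux xv] nv; congr EFin; apply: fg.
by rewrite ux lt_neqAle xv andbT; apply/eqP.
Qed.

Lemma ray_split h : 0 <= h -> ray = `[0, h]%classic `|` (`]h, +oo[%classic : set R).
Proof.
move=> h0; apply/seteqP; split => x /=; rewrite !in_itv /= !andbT.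
  by move=> x0; case: (leP x h) => xb; [left|right] => //; rewrite x0.
by move=> [/andP[]//|]; lra.
Qed.

Lemma ray_shift (h : R) : (fun x => h + x) @^-1` (`[h, +oo[%classic : set R) = ray.
Proof. by apply/seteqP; split => x /=; rewrite !in_itv /= !andbT; lra. Qed.

Lemma ray_shiftN (h : R) : (fun x => - h + x) @^-1` ray = (`[h, +oo[%classic : set R).
Proof. by apply/seteqP; split => x /=; rewrite !in_itv /= !andbT; lra. Qed.

Lemma ig_ray_cat (h : R) f : 0 <= h -> ig `[0, h] f -> ig ray (fun t => f (h + t)) -> ig ray f.
Proof.
move=> h0 f1 f2; rewrite (ray_split h0); apply: igU => //.
have /(_ (measurable_itv _)) := @ig_shift R (- h) ray _ _ f2; rewrite ray_shiftN => f3.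
apply: (@ig_sub _ (`[h, +oo[%classic : set R)) => //.
  by move=> x /=; rewrite !in_itv /= !andbT; exact: ltW.
by apply: eq_ig f3 => // x _; congr f; ring.
Qed.

Lemma ig_ray_shift (h : R) f : 0 <= h -> ig ray f -> ig ray (fun t => f (h + t)).
Proof.
move=> h0 fi; rewrite -(ray_shift h); apply: ig_shift => //.
by apply: ig_sub fi => // x /=; rewrite !in_itv /= !andbT; lra.
Qed.

Lemma Rint_ray_cat (h : R) f : 0 <= h -> ig ray f ->
  Rintegral mu ray f = Rintegral mu `[0, h] f + Rintegral mu ray (fun t => f (h + t)).
Proof.
move=> h0 fi.
have fi2 : mu.-integrable `]h, +oo[ (EFin \o f).
  by apply: (ig_sub _ _ _ fi) => // x /=; rewrite !in_itv /= !andbT; lra.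
have fi3 : ig (`[h, +oo[%classic : set R) f.
  by apply: (ig_sub _ _ _ fi) => // x /=; rewrite !in_itv /= !andbT; lra.
have := @Rintegral_itvB R f (BLeft 0) (BInfty _ false) h fi.
rewrite !bnd_simp => /(_ h0 isT) /(canRL (subrK _)) ->.
rewrite Rintegral_itv_obnd_cbnd // addrC; congr (_ + _).
rewrite /Rintegral (integral_shift h (D := (`[h, +oo[%classic : set R))) //; last exact: ig_meas.
by congr (fine (integral mu _ _)); exact: ray_shift.
Qed.

End Intervals.

Lemma le_discounted_slack (R : realType) (q e V J G W : R) : 0 <= q <= 1 -> 0 < e ->
  V - e < J -> G + q * J <= W -> G + q * V <= W + e.
Proof. by move=> /andP[q0 q1] e0 VJ; nra. Qed.

(** * Dynamic programming *)

Section Dynamics.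
Variables (R : realType) (M : model R).
Notation mu := (@lebesgue_measure R).
Notation T := (delay M).
Notation r := (rate M).
Notation rho := (discount M).
Notation a := (memory M).
Notation f0 := (income M).
Notation U1 := (util1 M).
Notation U2 := (util2 M).
Notation ray := (`[0%R, +oo[%classic : set R).
Notation traj := (traj M).
Notation delayed := (delayed_term M).
Notation consume := (consumption M).
Notation DVM := (DV T r rho a f0 U1 U2).
Notation VM := (Vfun T r rho a f0 U1 U2).
Notation adm := (adm M).
Notation gain := (discounted_gain M).
Implicit Types (x dx c : R -> R) (eta zeta : Hpt R) (h s t : R).

Lemma delayed_shift x h t : delayed (fun u => x (h + u)) t = delayed x (h + t).
Proof. by apply: Rint_eq => xi _; rewrite addrA. Qed.

Lemma consume_shift x dx h t :
  consume (fun u => x (h + u)) (fun u => dx (h + u)) t = consume x dx (h + t).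
Proof. by rewrite /consumption delayed_shift. Qed.

Lemma traj_shift eta x dx h k : 0 <= h -> 0 <= k -> traj eta x dx (h + k) ->
  traj (hist x h) (fun u => x (h + u)) (fun u => dx (h + u)) k.
Proof.
move=> h0 k0 tr; split => //.
- by apply: traj_hist tr; lra.
- have [_ _ di _] := tr; apply: ig_itv_shift.
  by apply: ig_sub di => // t /=; rewrite !in_itv /=; lra.
- move=> t /andP[t0 tk]; rewrite (traj_diff (s := h) (t := h + t) _ _ tr); [|lra|lra].
  rewrite Rint_itv_shift ?addr0 //; have [_ _ di _] := tr; apply: ig_meas.
  by apply: ig_sub di => // u /=; rewrite !in_itv /=; lra.
Qed.

Definition admissible_upto eta x dx h :=
  traj eta x dx h /\ forall t, 0 <= t <= h -> 0 < x t /\ 0 <= consume x dx t.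

Lemma adm_shift eta x dx h : 0 <= h -> adm eta x dx ->
  adm (hist x h) (fun u => x (h + u)) (fun u => dx (h + u)).
Proof.
move=> h0 [tr pos]; split.
  by move=> k k0; apply: (traj_shift h0 k0); apply: tr; exact: addr_ge0.
by move=> t t0; rewrite consume_shift; apply: pos; exact: addr_ge0.
Qed.

Lemma gain_shift x dx h t :
  gain x dx (h + t) = expR (- (rho * h)) * gain (fun u => x (h + u)) (fun u => dx (h + u)) t.
Proof. by rewrite /discounted_gain consume_shift mulrA -expRD -opprD -mulrDr. Qed.

(** The upper half of dynamic programming: the path seen from time [h] is admissible for [hist x h],
    so its gain is at most the value there. *)
Lemma dpp_shift eta x dx h : 0 <= h -> adm eta x dx -> ig ray (gain x dx) ->
  DVM (hist x h) /\ Rintegral mu ray (gain x dx) <=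
    Rintegral mu `[0, h] (gain x dx) + expR (- (rho * h)) * fine (VM (hist x h)).
Proof.
move=> h0 ad gi; have ad' := adm_shift h0 ad.
have gi1 := ig_ray_shift h0 gi.
pose g' := gain (fun u => x (h + u)) (fun u => dx (h + u)).
have gi' : ig ray g'.
  apply: (@eq_ig _ _ (fun t => expR (rho * h) * gain x dx (h + t))) => //; last exact: igZ.
  by move=> t _; rewrite gain_shift mulrA -expRD subrr expR0 mul1r.
have [D le] := V_lower ad' gi'; split => //.
rewrite (Rint_ray_cat h0 gi) lerD2l.
rewrite (Rint_eq (g := fun t => expR (- (rho * h)) * g' t)); last by move=> t _; exact: gain_shift.
by rewrite RintZ // ler_wpM2l ?expR_ge0.
Qed.

(** On a compact interval a positive continuous path stays in a region where [util2] is continuous,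
    while [util1] of the consumption is only measurable and bounded. *)
Lemma gain_upto_ig eta x dx h : 0 <= h -> admissible_upto eta x dx h -> ig `[0, h] (gain x dx).
Proof.
move=> h0 [tr pos]; have [K K0 [UK _]] := util_bound M.
have xc := traj_cont h0 tr; have ci := consume_ig h0 tr.
have U2c : {within `[0, h], continuous (fun t => U2 (x t))}.
  have /within_contP c2 := @util2_cont _ M; have /within_contP c1 := xc.
  apply/within_contP => t tI e e0.
  have xt : `]0%R, +oo[%classic (x t) by rewrite /= in_itv /= andbT; case: (pos t tI).
  have [d d0 dh] := c2 _ xt e e0; have [d' d'0 dh'] := c1 t tI d d0.
  exists d' => // s sI /(dh' s sI); apply: dh.
  by rewrite /= in_itv /= andbT; case: (pos s sI).
have ec : {within `[0, h], continuous (fun t => expR (- (rho * t)))}.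
  apply: continuous_subspaceT => t; apply: continuous_comp; last exact: continuous_expR.
  by apply: continuousN; apply: continuousM => //; exact: cst_continuous.
apply: (@eq_ig _ _ (fun t => expR (- (rho * t)) * U1 (consume x dx t) + expR (- (rho * t)) * U2 (x t))) => //.
  by move=> t _; rewrite -mulrDr.
apply: igD => //; last by apply: within_cont_ig; exact: within_contM.
apply: (@ig_bnd _ _ _ K).
  apply: measurable_funM; first exact: within_cont_meas.
  apply: (measurable_comp (F := ray)) => //.
  - by move=> _ [t /= + <-]; rewrite !in_itv /= => /pos[_ ->].
  - by apply: within_cont_meas => //; exact: util1_cont.
  - exact: ig_meas ci.
move=> t tI; have [_ c0] := pos t tI; rewrite normrM ger0_norm ?expR_ge0 //.
have t0 : 0 <= t by move: tI; rewrite in_itv /= => /andP[].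
have : expR (- (rho * t)) <= 1.
  by rewrite expR_le1 oppr_le0 mulr_ge0 // ltW // discount_gt0.
have := UK _ c0; have := normr_ge0 (U1 (consume x dx t)); have := expR_ge0 (- (rho * t)); nra.
Qed.

(** The lower half of dynamic programming: a near-optimal continuation from [hist x h] is attached
    at time [h]. Only positivity and nonnegative consumption up to [h] are asked of the first piece,
    and membership of [eta] in the domain is part of the conclusion. *)
Lemma dpp_concat eta x dx h : 0 <= h -> admissible_upto eta x dx h -> DVM (hist x h) ->
  DVM eta /\ Rintegral mu `[0, h] (gain x dx) + expR (- (rho * h)) * fine (VM (hist x h))
    <= fine (VM eta).
Proof.
move=> h0 [tr pos] D.
have g1 := gain_upto_ig h0 (conj tr pos).
suff H x2 dx2 : adm (hist x h) x2 dx2 -> ig ray (gain x2 dx2) ->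
    DVM eta /\ Rintegral mu `[0, h] (gain x dx)
      + expR (- (rho * h)) * Rintegral mu ray (gain x2 dx2) <= fine (VM eta).
  split; first by have [x2 [dx2 [ad gi _]]] := V_approx D ltr01; case: (H x2 dx2 ad gi).
  apply/ler_addgt0Pr => e e0; have [x2 [dx2 [ad gi lt]]] := V_approx D e0.
  have [_ le] := H x2 dx2 ad gi.
  apply: le_discounted_slack lt le => //.
  by rewrite expR_ge0 expR_le1 oppr_le0 mulr_ge0 // ltW // discount_gt0.
move=> ad gi; have [tr2 pos2] := ad.
pose x' t := if t < h then x t else x2 (t - h).
pose dx' t := if t < h then dx t else dx2 (t - h).
have x20 : x2 0 = x h by rewrite (traj0 (lexx 0) (tr2 0 (lexx 0))).
have x'1 t : t <= h -> x' t = x t.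
  by rewrite /x' le_eqVlt => /predU1P[->|->] //; rewrite ltxx subrr.
(* The continuation has [hist x h] as its past, so the glued path, seen from time [h], coincides
   with it on all of [[-T, oo[]; hence the delayed terms agree as well. *)
have x'2 t : - T <= t -> x' (h + t) = x2 t.
  move=> t1; rewrite /x'; case: ltP => // th; last by congr x2; ring.
  by have [_ xe _ _] := tr2 0 (lexx 0); rewrite (xe t) //; lra.
have dx'2 t : 0 <= t -> dx' (h + t) = dx2 t.
  by move=> t1; rewrite /dx' ltNge lerDl t1 /=; congr dx2; ring.
have c1 t : 0 <= t < h -> consume x' dx' t = consume x dx t.
  move=> /andP[t0 th]; rewrite /consumption x'1 ?ltW // /dx' th; congr (_ + f0 _ _ - _).
  by apply: Rint_eq => xi; rewrite /= in_itv /= => xiI; rewrite x'1 //; lra.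
have c2 t : 0 <= t -> consume x' dx' (h + t) = consume x2 dx2 t.
  move=> t0; have T0 := delay_gt0 M.
  rewrite /consumption x'2 ?dx'2 //; last lra.
  congr (_ + f0 _ _ - _); apply: Rint_eq => xi; rewrite /= in_itv /= => xiI.
  by rewrite -addrA x'2 //; lra.
have x'h : x' h = x h by exact: x'1.
have tr' : forall k, 0 <= k -> traj eta x' dx' (h + k).
  move=> k k0; have [eH xe di xi] := tr; have [_ _ di2 xi2] := tr2 k k0.
  have dih : ig `[0, h] dx'.
    by apply: (ig_eq_co (f := dx)) => // t /andP[_ th]; rewrite /dx' th.
  have dis : ig `[h, h + k] dx'.
    have := @ig_itv_shift R (- h) h (h + k) dx2.
    rewrite addNr addKr => /(_ di2); apply: eq_ig => // t.
    rewrite /= in_itv /= => th; rewrite -[in RHS](subrK h t) (addrC _ h) dx'2; last lra.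
    by congr dx2; ring.
  have dit : ig `[0, h + k] dx' by apply: ig_glue dis => //; lra.
  split => //.
    by move=> t tT; rewrite x'1 ?xe //; lra.
  move=> t tk; case: (leP t h) => th.
    rewrite x'1 // xi; last lra.
    by congr (_ + _); apply: Rint_eq_co => [|u]; [lra|rewrite /dx' => /andP[_ ut]; rewrite (lt_le_trans ut th)].
  rewrite (@Rint_split _ 0 h t); [|lra|lra|]; last first.
    by apply: ig_sub dit => // u; rewrite /= !in_itv /=; lra.
  have -> : Rintegral mu `[0, h] dx' = Rintegral mu `[0, h] dx.
    by apply: Rint_eq_co => // u /andP[_ uh]; rewrite /dx' uh.
  rewrite addrA -xi ?h0 ?lexx //.
  have {1}-> : t = h + (t - h) by ring.
  rewrite x'2; last by have := delay_gt0 M; lra.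
  rewrite xi2; last lra.
  have -> : Rintegral mu `[h, t] dx' = Rintegral mu `[0, t - h] dx2; last by [].
  have e : `[h, t]%classic = `[h + 0, h + (t - h)]%classic by rewrite addr0 addrC subrK.
  rewrite e -Rint_itv_shift; last first.
    rewrite -e; apply: ig_meas; apply: ig_sub dit => // u; rewrite /= !in_itv /=; lra.
  by apply: Rint_eq => u; rewrite /= in_itv /= => /andP[u0 _]; rewrite dx'2.
have ad' : adm eta x' dx'.
  split.
    by move=> k k0; apply: traj_sub (tr' k k0); lra.
  move=> t t0; case: (ltP t h) => th.
    have tI : 0 <= t <= h by lra.
    by have [p1 p2] := pos t tI; rewrite c1 ?t0 // x'1 //; lra.
  have -> : t = h + (t - h) by ring.
  rewrite c2; last lra.
  rewrite x'2; last by have := delay_gt0 M; lra.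
  by apply: pos2; lra.
have g'2 t : 0 <= t -> gain x' dx' (h + t) = expR (- (rho * h)) * gain x2 dx2 t.
  move=> t0; rewrite /discounted_gain c2 // x'2; last by have := delay_gt0 M; lra.
  by rewrite mulrA -expRD -opprD -mulrDr.
have g'1 t : 0 <= t < h -> gain x dx t = gain x' dx' t.
  by move=> /andP[t0 th]; rewrite /discounted_gain c1 ?t0 // x'1 //; lra.
have gi' : ig ray (gain x' dx').
  apply: (ig_ray_cat h0); first exact: ig_eq_co g'1 g1.
  apply: (@eq_ig _ _ (fun t => expR (- (rho * h)) * gain x2 dx2 t)) => //; last exact: igZ.
  by move=> t; rewrite /= in_itv /= andbT => /g'2.
have [D' le] := V_lower ad' gi'; split => //; apply: le_trans le.
rewrite (Rint_ray_cat h0 gi') (Rint_eq_co h0 g'1) lerD2l -RintZ //.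
rewrite le_eqVlt; apply/orP; left; apply/eqP; apply: Rint_eq => t.
by rewrite /= in_itv /= andbT => /g'2.
Qed.

End Dynamics.

(** * Regularity of the value function *)

Section ConcaveFunctions.
Variable R : realType.
Notation ray := (`[0%R, +oo[%classic : set R).
Variable U : R -> R.
Hypothesis U_cont : {within ray, continuous U}.
Hypothesis U_diff : forall t : R, 0 < t -> derivable U t 1 /\ derivable (derive1 U) t 1.

Lemma mvt_ray (x y : R) : 0 <= x -> x < y ->
  exists2 z, x < z < y & U y - U x = derive1 U z * (y - x).
Proof.
move=> x0 xy; have [||z zI e] := @MVT R U (derive1 U) x y xy.
- move=> z; rewrite in_itv /= => /andP[xz _].
  have [d _] := U_diff (le_lt_trans x0 xz).
  by rewrite derive1E; apply: derivableP.
- apply: continuous_subspaceW U_cont => t /=; rewrite !in_itv /= andbT => /andP[xt _].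
  exact: le_trans xt.
- by exists z => //; move: zI; rewrite in_itv.
Qed.

Lemma mvt_derive (x y : R) : 0 < x -> x < y ->
  exists2 z, x < z < y & derive1 U y - derive1 U x = derive1 (derive1 U) z * (y - x).
Proof.
move=> x0 xy; have [||z zI e] := @MVT R (derive1 U) (derive1 (derive1 U)) x y xy.
- move=> z; rewrite in_itv /= => /andP[xz _].
  have [_ d] := U_diff (lt_trans x0 xz).
  by rewrite derive1E; apply: derivableP.
- apply/within_contP => t; rewrite /= in_itv /= => /andP[xt _] e e0.
  have [_ d] := U_diff (lt_le_trans x0 xt).
  have /differentiable_continuous/cvgrPdist_lt/(_ _ e0)/nbhs_ballP[k /= k0 kh] := (derivable1_diffP _ _).1 d.
  by exists k => // s _ ts; apply: kh.
- by exists z => //; move: zI; rewrite in_itv.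
Qed.

Hypothesis U_incr : forall t : R, 0 < t -> 0 < derive1 U t.
Hypothesis U_conc : forall t : R, 0 < t -> derive1 (derive1 U) t < 0.

Lemma ray_nondecreasing (x y : R) : 0 <= x -> x <= y -> U x <= U y.
Proof.
move=> x0; rewrite le_eqVlt => /predU1P[-> //|xy].
have [z /andP[xz _] e] := mvt_ray x0 xy.
by rewrite -subr_ge0 e mulr_ge0 ?subr_ge0 ?ltW // U_incr // (le_lt_trans x0).
Qed.

(** The mean value theorem on either side of [z] produces slopes at [c1 < c2]; a third application,
    to the derivative, orders these slopes. *)
Let concave_lt (x y l : R) : 0 <= x -> x < y -> 0 < l < 1 ->
  l * U x + (1 - l) * U y <= U (l * x + (1 - l) * y).
Proof.
move=> x0 xy l01; pose z := l * x + (1 - l) * y.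
have xz : x < z by rewrite /z; nra.
have zy : z < y by rewrite /z; nra.
have [c1 /andP[xc1 c1z] e1] := mvt_ray x0 xz.
have [c2 /andP[zc2 c2y] e2] := mvt_ray (ltW (le_lt_trans x0 xz)) zy.
have c12 : c1 < c2 by exact: lt_trans zc2.
have c10 : 0 < c1 by exact: le_lt_trans xc1.
have [c3 /andP[c13 _] e3] := mvt_derive c10 c12.
have u3 := U_conc (lt_trans c10 c13).
have le : derive1 U c2 <= derive1 U c1 by rewrite -subr_le0 e3; nra.
rewrite -/z -subr_ge0.
have -> : U z - (l * U x + (1 - l) * U y) = l * (U z - U x) - (1 - l) * (U y - U z) by ring.
have -> : l * (U z - U x) - (1 - l) * (U y - U z) =
   (l * (1 - l)) * (y - x) * (derive1 U c1 - derive1 U c2) by rewrite e1 e2 /z; ring.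
by rewrite mulr_ge0 ?subr_ge0 // mulr_ge0 ?mulr_ge0 //; lra.
Qed.

Lemma ray_concave (x y l : R) : 0 <= x -> 0 <= y -> 0 <= l <= 1 ->
  l * U x + (1 - l) * U y <= U (l * x + (1 - l) * y).
Proof.
move=> x0 y0 /andP[l0 l1].
have [->|ln0] := eqVneq l 0; first by rewrite !mul0r subr0 !mul1r !add0r.
have [->|ln1] := eqVneq l 1; first by rewrite subrr !mul0r !mul1r !addr0.
have l01 : 0 < l < 1 by rewrite !lt_neqAle l0 l1 eq_sym ln0 ln1.
have [xy|yx|->] := ltgtP x y; first exact: concave_lt.
  have l01' : 0 < 1 - l < 1 by lra.
  have := concave_lt y0 yx l01'; rewrite subKr.
  by rewrite (addrC ((1 - l) * U y)) (addrC ((1 - l) * y)).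
by rewrite -!mulrDl subrKC !mul1r.
Qed.

End ConcaveFunctions.

(** * Concavity of the value function *)

Section Concavity.
Variables (R : realType) (M : model R).
Notation mu := (@lebesgue_measure R).
Notation T := (delay M).
Notation r := (rate M).
Notation rho := (discount M).
Notation a := (memory M).
Notation f0 := (income M).
Notation U1 := (util1 M).
Notation U2 := (util2 M).
Notation ray := (`[0%R, +oo[%classic : set R).
Notation traj := (traj M).
Notation delayed := (delayed_term M).
Notation consume := (consumption M).
Notation DVM := (DV T r rho a f0 U1 U2).
Notation VM := (Vfun T r rho a f0 U1 U2).
Notation adm := (adm M).
Notation gain := (discounted_gain M).
Implicit Types (x dx c : R -> R) (eta zeta : Hpt R) (h s t : R).
Notation Hcomb l eta zeta := (Hadd (Hscale l eta) (Hscale (1 - l) zeta)).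

Lemma U1_mono (c c' : R) : 0 <= c -> c <= c' -> U1 c <= U1 c'.
Proof.
apply: ray_nondecreasing; [exact: util1_cont| |exact: util1_incr].
by move=> t /(@util1_diff _ M)[? []].
Qed.

Lemma U1_concave (c c' l : R) : 0 <= c -> 0 <= c' -> 0 <= l <= 1 ->
  l * U1 c + (1 - l) * U1 c' <= U1 (l * c + (1 - l) * c').
Proof.
apply: ray_concave; [exact: util1_cont| |exact: util1_concave].
by move=> t /(@util1_diff _ M)[? []].
Qed.

Lemma U2_mono (y y' : R) : 0 < y -> y <= y' -> U2 y <= U2 y'.
Proof.
move=> y0; rewrite le_eqVlt => /predU1P[-> //|yy']; exact/ltW/util2_incr.
Qed.

Lemma traj_comb eta1 x1 dx1 eta2 x2 dx2 h l : 0 <= h -> traj eta1 x1 dx1 h -> traj eta2 x2 dx2 h ->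
  traj (Hcomb l eta1 eta2) (fun t => l * x1 t + (1 - l) * x2 t)
    (fun t => l * dx1 t + (1 - l) * dx2 t) h.
Proof.
move=> h0 [e1 p1 d1 i1] [e2 p2 d2 i2]; split.
- by apply: inHD; exact: inHZ.
- by move=> t tT; rewrite p1 // p2.
- by apply: igD => //; exact: igZ.
- move=> t th; have st f : ig `[0, h] f -> ig `[0, t] f.
    by apply: ig_sub => // u; rewrite /= !in_itv /=; lra.
  have d1' := st _ d1; have d2' := st _ d2.
  rewrite i1 // i2 // RintD ?RintZ //; [rewrite /=; ring|exact: igZ|exact: igZ].
Qed.

Lemma delayed_comb eta1 x1 dx1 eta2 x2 dx2 h l t : 0 <= t <= h ->
  traj eta1 x1 dx1 h -> traj eta2 x2 dx2 h ->
  delayed (fun u => l * x1 u + (1 - l) * x2 u) t = l * delayed x1 t + (1 - l) * delayed x2 t.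
Proof.
move=> th t1 t2; have i1 := L2_mul (W12_L2 M) (traj_hist th t1).
have i2 := L2_mul (W12_L2 M) (traj_hist th t2).
rewrite /delayed_term -RintZ // -(RintZ (1 - l)) // -RintD //; [|exact: igZ|exact: igZ].
by apply: Rint_eq => xi _; ring.
Qed.

(** By joint concavity of [income], the consumption recovered from the combined path is at least the
    combination of the two consumptions; the surplus is harmless because [util1] is increasing. *)
Lemma adm_comb eta1 x1 dx1 eta2 x2 dx2 l : 0 <= l <= 1 -> adm eta1 x1 dx1 -> adm eta2 x2 dx2 ->
  adm (Hcomb l eta1 eta2) (fun t => l * x1 t + (1 - l) * x2 t) (fun t => l * dx1 t + (1 - l) * dx2 t)
  /\ forall t, 0 <= t -> l * gain x1 dx1 t + (1 - l) * gain x2 dx2 t <=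
      gain (fun t => l * x1 t + (1 - l) * x2 t) (fun t => l * dx1 t + (1 - l) * dx2 t) t.
Proof.
move=> l01 [t1 p1] [t2 p2].
have ge t : 0 <= t -> l * consume x1 dx1 t + (1 - l) * consume x2 dx2 t <=
    consume (fun t => l * x1 t + (1 - l) * x2 t) (fun t => l * dx1 t + (1 - l) * dx2 t) t.
  move=> t0; have [x10 c10] := p1 t t0; have [x20 c20] := p2 t t0.
  have tt : 0 <= t <= t by rewrite t0 lexx.
  rewrite /consumption (delayed_comb l tt (t1 t t0) (t2 t t0)).
  have := @income_concave _ M _ (delayed x1 t) _ (delayed x2 t) l (ltW x10) (ltW x20) l01.
  by lra.
have pos t : 0 <= t -> 0 < l * x1 t + (1 - l) * x2 t.
  by move=> t0; have [x10 _] := p1 t t0; have [x20 _] := p2 t t0; nra.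
have cp t : 0 <= t -> 0 <= l * consume x1 dx1 t + (1 - l) * consume x2 dx2 t.
  by move=> t0; have [_ c10] := p1 t t0; have [_ c20] := p2 t t0; nra.
split; first split.
- by move=> h h0; apply: traj_comb => //; [apply: t1|apply: t2].
- by move=> t t0; split; [exact: pos|apply: le_trans (ge t t0); exact: cp].
move=> t t0; rewrite /discounted_gain mulrCA (mulrCA (1 - l)) -mulrDr ler_wpM2l ?expR_ge0 //.
have [x10 c10] := p1 t t0; have [x20 c20] := p2 t t0.
have k1 := U1_concave c10 c20 l01; have k2 := U1_mono (cp t t0) (ge t t0).
have k3 := @util2_concave _ M _ _ _ x10 x20 l01.
by lra.
Qed.

(** A gain always lies below a multiple of e^(-rho t), so an integrable lower bound is enough for
    integrability. *)
Lemma gain_ig_ge eta x dx g : adm eta x dx -> ig ray g ->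
  (forall t, 0 <= t -> g t <= gain x dx t) ->
  ig ray (gain x dx) /\ Rintegral mu ray g <= Rintegral mu ray (gain x dx).
Proof.
move=> ad gi ge; have [K K0 [_ UK]] := util_bound M.
have gx : ig ray (gain x dx).
  apply: (@ig_le _ _ _ (fun t => `|g t| + K * expR (- (rho * t)))) => //.
  - exact: gain_meas ad.
  - move=> t; rewrite /= in_itv /= andbT => t0.
    have [x0 c0] := ad.2 t t0.
    have le1 : gain x dx t <= K * expR (- (rho * t)).
      by rewrite mulrC /discounted_gain ler_wpM2l ?expR_ge0 // UK.
    have := ge t t0; have := ler_norm (- g t); rewrite normrN => h1 h2.
    have p1 : 0 <= K * expR (- (rho * t)) by rewrite mulr_ge0 ?expR_ge0.
    by rewrite ler_norml; have := normr_ge0 (g t); lra.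
  - by apply: igD => //; [exact: ig_norm|exact: exp_ig].
split => //; apply: Rint_le => // t; rewrite /= in_itv /= andbT; exact: ge.
Qed.

Lemma V_concave eta zeta l : DVM eta -> DVM zeta -> 0 <= l <= 1 ->
  DVM (Hcomb l eta zeta) /\
  l * fine (VM eta) + (1 - l) * fine (VM zeta) <= fine (VM (Hcomb l eta zeta)).
Proof.
move=> D1 D2 l01.
suff H e : 0 < e -> DVM (Hcomb l eta zeta) /\
    l * fine (VM eta) + (1 - l) * fine (VM zeta) <= fine (VM (Hcomb l eta zeta)) + e.
  split; first by case: (H 1 ltr01).
  by apply/ler_addgt0Pr => e e0; case: (H e e0).
move=> e0; have [x1 [dx1 [a1 g1 lt1]]] := V_approx D1 e0.
have [x2 [dx2 [a2 g2 lt2]]] := V_approx D2 e0.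
have [ad ge] := adm_comb l01 a1 a2.
have gi : ig ray (fun t => l * gain x1 dx1 t + (1 - l) * gain x2 dx2 t).
  by apply: igD => //; exact: igZ.
have [gi' le] := gain_ig_ge ad gi ge.
have [D le'] := V_lower ad gi'; split => //.
move: le; rewrite RintD ?RintZ //; [|exact: igZ|exact: igZ].
move: lt1 lt2 le'; set V1 := fine (VM eta); set V2 := fine (VM zeta); set W := fine _.
set J1 := Rintegral _ _ _; set J2 := Rintegral _ _ _; set J := Rintegral _ _ _.
move: l01 => /andP[l0 l1]; clear -l0 l1 e0; move=> *; nra.
Qed.

End Concavity.

(** * A priori bounds for short times *)

Section Growth.
Variables (R : realType) (M : model R).
Notation mu := (@lebesgue_measure R).
Notation T := (delay M).
Notation r := (rate M).
Notation C := (lipc M).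
Notation a := (memory M).
Notation f0 := (income M).
Notation I := (`[- T, 0]%classic : set R).
Notation traj := (traj M).
Notation delayed := (delayed_term M).
Implicit Types (x dx c : R -> R) (eta zeta : Hpt R) (h s t : R).
Notation admissible_upto := (admissible_upto M).

(** The window [[t - T, t]] lies in [[-T, h]]; its part before 0 contributes the L^1 norm of the
    history, the rest at most [h * S]. *)
Lemma delayed_bound eta x dx h A S : 0 <= h -> traj eta x dx h ->
  0 <= A -> (forall t, t \in `[- T, 0] -> `|a t| <= A) ->
  (forall t, 0 <= t <= h -> `|x t| <= S) ->
  forall t, 0 <= t <= h ->
    `|delayed x t| <= A * (Rintegral mu I (fun u => `|eta.2 u|) + h * S).
Proof.
move=> h0 tr A0 aA xS t th.
have T0 := delay_gt0 M.
have hH := traj_hist th tr; have hi := L2_ig hH.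
have x2i : ig `[- T, h] x.
  apply: (@ig_le _ _ _ (fun u => x u ^+ 2 + 1)) => //.
  - exact: traj_meas h0 tr.
  - by move=> u _; rewrite ler_norml; have := sqr_ge0 (x u - 1); have := sqr_ge0 (x u + 1); nra.
  - by apply: igD => //; [exact: traj_sqr h0 tr|exact: ig_cst_itv].
have S0 : 0 <= S by apply: le_trans (xS t th); exact: normr_ge0.
apply: (le_trans (Rint_abs _ _)) => //; first exact: (L2_mul (W12_L2 M) hH).
apply: (@le_trans _ _ (A * Rintegral mu I (fun xi => `|x (t + xi)|))).
  rewrite -RintZ //; last exact: ig_norm.
  apply: Rint_le => //.
  - by apply: ig_norm => //; exact: (L2_mul (W12_L2 M) hH).
  - by apply: igZ => //; exact: ig_norm.
  - by move=> xi xiI; rewrite normrM ler_wpM2r // aA.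
apply: ler_wpM2l => //.
rewrite (Rint_itv_shift (f := fun u => `|x u|)); last first.
  apply: measurableT_comp => //; apply: measurable_funS (traj_meas h0 tr) => // u.
  by rewrite /= !in_itv /=; lra.
have ni : ig `[- T, h] (fun u => `|x u|) by exact: ig_norm.
apply: (@le_trans _ _ (Rintegral mu `[- T, h] (fun u => `|x u|))).
  by apply: Rint_subset_le => // u; rewrite /= !in_itv /=; lra.
rewrite (@Rint_split _ _ 0) //; last by rewrite oppr_le0 ltW.
apply: lerD.
  rewrite le_eqVlt; apply/orP; left; apply/eqP; apply: Rint_eq_co; first by rewrite oppr_le0 ltW.
  by case: tr => _ xe _ _ u uT; rewrite xe.
have -> : h * S = S * (h - 0) by ring.
rewrite -Rint_cst_itv //; apply: Rint_le => //.
- by apply: ig_sub ni => // u; rewrite /= !in_itv /=; lra.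
- exact: ig_cst_itv.
Qed.

(** The bounds are uniform over all consumptions: consumption only lowers the path, and positivity
    bounds it from below. An estimate at the time of the maximum therefore suffices. *)
Lemma apriori_bound eta : exists2 B : R, 0 < B & exists2 h0 : R, 0 < h0 &
  forall h x dx, 0 <= h <= h0 -> admissible_upto eta x dx h ->
  forall t, 0 <= t <= h -> x t <= B /\ `|r * x t + f0 (x t) (delayed x t)| <= B.
Proof.
have [A A0 aA] := W12_bounded M.
pose L : R := Rintegral mu I (fun u => `|eta.2 u|).
have L0 : 0 <= L by apply: Rint_ge0 => u _.
have C0 := lipc_ge0 M; have r0 := rate_gt0 M.
(* If the path is bounded by [S] and [h <= 1], the drift is at most [B1 * S + B0]. With [S] the
   maximum, [S <= eta.1 + h (B1 S + B0)], and [h B1 <= 1/2] allows half of [S] to be absorbed, which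
   gives [S <= S1]. *)
pose B0 : R := `|f0 0 0| + C * A * L; pose B1 : R := r + C + C * A.
have B00 : 0 <= B0 by rewrite addr_ge0 // !mulr_ge0.
have B10 : 0 < B1 by rewrite /B1 -addrA ltr_wpDr // addr_ge0 // mulr_ge0.
pose S1 : R := 2 * (`|eta.1| + B0).
have S10 : 0 <= S1 by rewrite mulr_ge0 // addr_ge0.
have BS : 0 <= B1 * S1 by rewrite mulr_ge0 // ltW.
exists (S1 + B1 * S1 + B0 + 1); first by lra.
have k0 : 0 < 1 / (2 * B1) by rewrite divr_gt0 // mulr_gt0.
exists (Num.min 1 (1 / (2 * B1))); first by rewrite lt_min ltr01.
move=> h x dx /andP[h0]; rewrite le_min => /andP[h1 hB] [tr pos].
have hB1 : h * B1 <= 1 / 2 by move: hB; rewrite ler_pdivlMr ?mulr_gt0 //; lra.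
have [s sI smax] := EVT_max h0 (traj_cont h0 tr).
pose S : R := x s.
have S0 : 0 < S by have [] := pos s sI.
have xS t : 0 <= t <= h -> `|x t| <= S.
  by move=> th; have [x0 _] := pos t th; rewrite gtr0_norm //; apply: smax; rewrite in_itv.
have drift t : 0 <= t <= h -> `|r * x t + f0 (x t) (delayed x t)| <= B1 * S + B0.
  move=> th; have [x0 _] := pos t th.
  have yb := delayed_bound h0 tr A0 aA xS th.
  have fl := f0_lipschitz M (x t) (delayed x t) 0 0; rewrite !subr0 in fl.
  have xt := xS t th.
  have e1 := ler_normD (r * x t) (f0 (x t) (delayed x t)).
  have e2 := ler_normD (f0 (x t) (delayed x t) - f0 0 0) (f0 0 0); rewrite subrK in e2.
  have e3 : `|r * x t| <= r * S by rewrite normrM gtr0_norm // ler_wpM2l // ltW.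
  have e4 : C * (`|x t| + `|delayed x t|) <= C * (S + A * (L + h * S)).
    by rewrite ler_wpM2l // lerD.
  have e5 : C * (S + A * (L + h * S)) <= C * S + C * A * L + C * A * S.
    have -> : C * (S + A * (L + h * S)) = C * S + C * A * L + C * A * (h * S) by ring.
    rewrite lerD2l; apply: ler_wpM2l; first exact: mulr_ge0.
    by rewrite ler_piMl // ltW.
  by rewrite /B1 /B0; lra.
have SS1 : S <= S1.
  have sI' : 0 <= s <= h by move: sI; rewrite in_itv.
  have [_ _ di xi] := tr.
  have : S <= eta.1 + s * (B1 * S + B0).
    rewrite {1}/S xi // lerD2l.
    have -> : s * (B1 * S + B0) = (B1 * S + B0) * (s - 0) by ring.
    rewrite -Rint_cst_itv; last by case/andP: sI'.
    apply: Rint_le => //.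
    - by apply: ig_sub di => // u; rewrite /= !in_itv /=; lra.
    - exact: ig_cst_itv.
    - move=> u; rewrite /= in_itv /= => us; have uh : 0 <= u <= h by lra.
      rewrite (dxE M x dx u); have [_ c0] := pos u uh.
      by have := ler_norm (r * x u + f0 (x u) (delayed x u)); have := drift u uh; lra.
  have := ler_norm eta.1; rewrite /S1.
  have sh : s * (B1 * S + B0) <= h * (B1 * S + B0).
    by apply: ler_wpM2r; [rewrite addr_ge0 // mulr_ge0 // ltW|lra].
  have hS : h * (B1 * S) <= 1 / 2 * S by rewrite mulrA; apply: ler_wpM2r => //; exact: ltW.
  have hB0 : h * B0 <= B0 by rewrite ler_piMl.
  by lra.
move=> t th; have [x0 _] := pos t th; split.
  have := xS t th; have := ler_norm (x t).
  have : 0 <= B1 * S1 by rewrite mulr_ge0 // ltW.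
  by lra.
apply: (le_trans (drift t th)).
have : B1 * S <= B1 * S1 by rewrite ler_wpM2l // ltW.
lra.
Qed.

Lemma exp_int (k t : R) : 0 <= t ->
  ig `[0, t] (fun s => k * expR (k * s)) /\
  Rintegral mu `[0, t] (fun s => k * expR (k * s)) = expR (k * t) - 1.
Proof.
move=> t0.
have ec : continuous (fun s : R => expR (k * s)).
  move=> s; apply: continuous_comp; last exact: continuous_expR.
  by apply: continuousM => //; exact: cst_continuous.
have fc : {within `[0, t], continuous (fun s => k * expR (k * s))}.
  by apply: within_contM; [exact: within_cont_cst|exact: continuous_subspaceT].
split; first exact: within_cont_ig.
move: t0; rewrite le_eqVlt => /predU1P[<-|t0].
  by rewrite Rint_point mulr0 expR0 subrr.
rewrite /Rintegral (@continuous_FTC2 _ _ (fun s => expR (k * s)) 0 t) //.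
- by rewrite mulr0 expR0.
- split.
  + by move=> s _; exact: ex_derive.
  + by apply/cvg_at_right_filter; exact: ec.
  + by apply/cvg_at_left_filter; exact: ec.
- move=> s _; rewrite derive1_comp // derive1E.
  have /funeqP -> := @derive_expR R.
  by rewrite derive1Ml // derive1_id mulr1 mulrC.
Qed.

End Growth.

(** * Strict growth of the value in the present wealth *)

Section LowerBounds.
Variables (R : realType) (M : model R).
Notation mu := (@lebesgue_measure R).
Notation T := (delay M).
Notation r := (rate M).
Notation rho := (discount M).
Notation C := (lipc M).
Notation a := (memory M).
Notation f0 := (income M).
Notation U1 := (util1 M).
Notation U2 := (util2 M).
Notation ray := (`[0%R, +oo[%classic : set R).
Notation traj := (traj M).
Notation delayed := (delayed_term M).
Notation consume := (consumption M).
Notation DVM := (DV T r rho a f0 U1 U2).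
Notation VM := (Vfun T r rho a f0 U1 U2).
Notation adm := (adm M).
Notation gain := (discounted_gain M).
Implicit Types (x dx c : R -> R) (eta zeta : Hpt R) (h s t : R).
Notation admissible_upto := (admissible_upto M).

Lemma traj_add eta1 x1 dx1 eta2 x2 dx2 h : 0 <= h -> traj eta1 x1 dx1 h -> traj eta2 x2 dx2 h ->
  traj (Hadd eta1 eta2) (fun t => x1 t + x2 t) (fun t => dx1 t + dx2 t) h.
Proof.
move=> h0 [e1 p1 d1 i1] [e2 p2 d2 i2]; split.
- exact: inHD.
- by move=> t tT; rewrite p1 // p2.
- exact: igD.
- move=> t th; have st f : ig `[0, h] f -> ig `[0, t] f.
    by apply: ig_sub => // u; rewrite /= !in_itv /=; lra.
  by rewrite i1 // i2 // RintD //; [rewrite /=; ring|exact: st|exact: st].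
Qed.

Lemma delayed_add eta1 x1 dx1 eta2 x2 dx2 h t : 0 <= t <= h ->
  traj eta1 x1 dx1 h -> traj eta2 x2 dx2 h ->
  delayed (fun u => x1 u + x2 u) t = delayed x1 t + delayed x2 t.
Proof.
move=> th t1 t2; have i1 := L2_mul (W12_L2 M) (traj_hist th t1).
have i2 := L2_mul (W12_L2 M) (traj_hist th t2).
by rewrite /delayed_term -RintD //; apply: Rint_eq => xi _; ring.
Qed.

Lemma HaddBK eta zeta : Hadd eta (Hsub zeta eta) = zeta.
Proof.
by case: zeta => z0 z1; congr pair; [|apply/funext => t]; rewrite /= addrC subrK.
Qed.

(** One explicit family serves three comparisons: a decaying bump in [V_slope], a pure exponential
    in [positive_history] (with [p] equal to the initial value) and a growing correction in [V_ball]
    (with [p] negative). *)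
Lemma traj_exp zeta (k p : R) h : 0 <= h -> inH T zeta ->
  traj zeta (fun t => if t < 0 then zeta.2 t else zeta.1 + p * (expR (k * t) - 1))
    (fun t => p * (k * expR (k * t))) h.
Proof.
move=> h0 zH; split => //.
- by move=> t /andP[_ ->].
- by apply: igZ => //; have [] := exp_int k h0.
- move=> t /andP[t0 _]; rewrite ltNge t0 /=; congr (_ + _).
  by have [i e] := exp_int k t0; rewrite RintZ // e.
Qed.

(** Increments of a concave function over a fixed length decrease to the right, so the increment at
    [x] is at least that at [N]; this in turn is at least [d] times the increment of length one. *)
Lemma U2_slope (x N d : R) : 0 < x -> x <= N -> 0 <= d <= 1 ->
  d * (U2 (N + 1) - U2 N) <= U2 (x + d) - U2 x.
Proof.
move=> x0 xN /andP[d0 d1].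
have [->|dn0] := eqVneq d 0; first by rewrite mul0r addr0 subrr.
have dp : 0 < d by rewrite lt_neqAle eq_sym dn0.
have N0 : 0 < N by exact: lt_le_trans xN.
have h1 : d * (U2 (N + 1) - U2 N) <= U2 (N + d) - U2 N.
  have d01 : 0 <= d <= 1 by rewrite d0.
  have N1 : 0 < N + 1 by lra.
  have := @util2_concave _ M _ _ _ N1 N0 d01.
  have -> : d * (N + 1) + (1 - d) * N = N + d by ring.
  by lra.
apply: (le_trans h1).
(* Both [x + d] and [N] lie between [x] and [N + d], with exchanged weights [q] and [1 - q]; adding
   the two concavity inequalities cancels the weights. *)
pose q : R := d / (N + d - x).
have Nx : 0 < N + d - x by lra.
have q01 : 0 <= q <= 1.
  by apply/andP; split; [rewrite divr_ge0 // ltW|rewrite /q ler_pdivrMr // mul1r; lra].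
have Nd : 0 < N + d by lra.
have := @util2_concave _ M _ _ _ Nd x0 q01.
have -> : q * (N + d) + (1 - q) * x = x + d by rewrite /q; field; lra.
have := @util2_concave _ M _ _ _ x0 Nd q01.
have -> : q * x + (1 - q) * (N + d) = N by rewrite /q; field; lra.
by lra.
Qed.

(** The bump [w] decays at the Lipschitz rate of the income: [- dw = C w] pays for the largest
    possible drop of income, so consumption does not decrease. The profit comes from [util2] on
    [[0, h]] alone, where the paths stay below the common bound [N]; hence [kap] does not depend on
    the near-optimal path. *)
Lemma V_slope eta : DVM eta -> exists2 kap : R, 0 < kap & forall k : R, 0 < k <= 1 ->
  DVM (Hadd eta (k, fun=> 0)) /\
  fine (VM eta) + kap * k <= fine (VM (Hadd eta (k, fun=> 0))).
Proof.
move=> D; have [N N0 [h h0 apr]] := apriori_bound M eta.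
pose q : R := expR (- C * h); pose kap : R := h * (expR (- (rho * h)) * (q * (U2 (N + 1) - U2 N))).
have q0 : 0 < q by exact: expR_gt0.
have UN : 0 < U2 (N + 1) - U2 N by rewrite subr_gt0; apply: util2_incr => //; lra.
exists kap; first by rewrite !mulr_gt0 // expR_gt0.
move=> k /andP[k0 k1].
suff H e : 0 < e -> DVM (Hadd eta (k, fun=> 0)) /\
    fine (VM eta) + kap * k <= fine (VM (Hadd eta (k, fun=> 0))) + e.
  split; first by case: (H 1 ltr01).
  by apply/ler_addgt0Pr => e e0; case: (H e e0).
move=> e0; have [x [dx [[tr pos] gi lt]]] := V_approx D e0.
have C0 := lipc_ge0 M; have rho0 := discount_gt0 M; have r0 := rate_gt0 M.
pose zeta : Hpt R := (k, fun=> 0).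
have zH : inH T zeta by exact: L2_cst.
pose w t : R := if t < 0 then zeta.2 t else zeta.1 + k * (expR (- C * t) - 1).
pose dw t : R := k * (- C * expR (- C * t)).
have trw s : 0 <= s -> traj zeta w dw s by move=> s0; exact: traj_exp.
have wE t : 0 <= t -> w t = k * expR (- C * t) by move=> t0; rewrite /w ltNge t0 /=; ring.
have w0 t : 0 <= w t.
  rewrite /w; case: ltP => // t0; have := expR_ge0 (- C * t).
  by move=> /(mulr_ge0 (ltW k0)); rewrite /zeta /=; lra.
pose x' t := x t + w t; pose dx' t := dx t + dw t.
have tr' s : 0 <= s -> traj (Hadd eta zeta) x' dx' s.
  by move=> s0; apply: traj_add => //; [exact: tr|exact: trw].
have cge t : 0 <= t -> consume x dx t <= consume x' dx' t.
  move=> t0; have [x0 _] := pos t t0; have tt : 0 <= t <= t by rewrite t0 lexx.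
  have dle : delayed x t <= delayed x' t.
    rewrite /x' (delayed_add tt (tr t t0) (trw t t0)) lerDl; apply: Rint_ge0 => xi xiI.
    by rewrite mulr_ge0 // memory_ge0.
  have x'0 : 0 <= x' t by rewrite addr_ge0 // ltW.
  have m1 := @income_mono _ M _ _ _ x'0 dle.
  have m2 := f0_lipschitz M (x' t) (delayed x t) (x t) (delayed x t).
  rewrite subrr normr0 addr0 ler_norml in m2.
  have -> : consume x' dx' t = r * x' t + f0 (x' t) (delayed x' t) - dx t - dw t.
    by rewrite /consumption /dx'; ring.
  have e1 : x' t - x t = w t by rewrite /x'; ring.
  have e2 : dw t = - C * w t by rewrite wE // /dw; ring.
  rewrite e1 ger0_norm // in m2.
  have e3 : x' t = x t + w t by [].
  have e4 : 0 <= r * w t by rewrite mulr_ge0 // ltW.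
  by rewrite /consumption e2 {1}e3; lra.
have ad : adm eta x dx by [].
have ad' : adm (Hadd eta zeta) x' dx'.
  split=> // t t0; have [x0 c0] := pos t t0; split; first by rewrite ltr_wpDr.
  exact: le_trans c0 (cge t t0).
have gge t : 0 <= t -> expR (- (rho * t)) * (U2 (x' t) - U2 (x t)) <= gain x' dx' t - gain x dx t.
  move=> t0; have [x0 c0] := pos t t0.
  rewrite /discounted_gain -mulrBr ler_wpM2l ?expR_ge0 //.
  by have := U1_mono M c0 (cge t t0); lra.
have gle t : 0 <= t -> gain x dx t <= gain x' dx' t.
  move=> t0; have [x0 c0] := pos t t0; rewrite -subr_ge0; apply: le_trans (gge t t0).
  by rewrite mulr_ge0 ?expR_ge0 // subr_ge0; apply: U2_mono => //; rewrite lerDl.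
have [gi' _] := gain_ig_ge ad' gi gle.
have [D' le'] := V_lower ad' gi'; split => //.
have h0' := ltW h0.
have sub : `[0, h]%classic `<=` ray by move=> t; rewrite /= !in_itv /= andbT => /andP[].
have gh : ig `[0, h] (gain x dx) by apply: ig_sub gi.
have gh' : ig `[0, h] (gain x' dx') by apply: ig_sub gi'.
have up : admissible_upto eta x dx h by split; [exact: tr|move=> t /andP[t0 _]; exact: pos].
have hh : 0 <= h <= h by rewrite h0' lexx.
have head : Rintegral mu `[0, h] (gain x dx) + kap * k <= Rintegral mu `[0, h] (gain x' dx').
  have -> : kap * k = expR (- (rho * h)) * (k * q * (U2 (N + 1) - U2 N)) * (h - 0).
    by rewrite /kap; ring.
  rewrite -Rint_cst_itv // -RintD //; last exact: ig_cst_itv.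
  apply: Rint_le => //; first by apply: igD => //; exact: ig_cst_itv.
  move=> t; rewrite /= in_itv /= => /andP[t0 th].
  rewrite -lerBrDl; apply: le_trans (gge t t0).
  have [x0 _] := pos t t0.
  have [xN _] := apr h x dx hh up t (introT andP (conj t0 th)).
  have kq1 : 0 <= k * q <= 1.
    rewrite mulr_ge0 ?(ltW k0) ?(ltW q0) //= mulr_ile1 // ?(ltW k0) ?(ltW q0) //.
    by rewrite /q expR_le1 mulNr oppr_le0 mulr_ge0.
  have s1 := U2_slope x0 xN kq1.
  have qw : k * q <= w t.
    rewrite wE // ler_wpM2l ?(ltW k0) // ler_expR !mulNr lerN2.
    by rewrite ler_wpM2l.
  have s2 : U2 (x t + k * q) <= U2 (x' t).
    by apply: U2_mono; [rewrite ltr_wpDr //; case/andP: kq1|rewrite lerD2l].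
  have s3 : expR (- (rho * h)) <= expR (- (rho * t)).
    by rewrite ler_expR lerN2 ler_wpM2l // ltW.
  apply: ler_pM => //.
  - by rewrite mulr_ge0 ?(ltW UN) //; case/andP: kq1.
  - by lra.
have tail : Rintegral mu ray (fun t => gain x dx (h + t)) <= Rintegral mu ray (fun t => gain x' dx' (h + t)).
  apply: Rint_le => //; [exact: ig_ray_shift|exact: ig_ray_shift|].
  by move=> t; rewrite /= in_itv /= andbT => t0; apply: gle; rewrite addr_ge0.
move: lt le'; rewrite (Rint_ray_cat h0' gi) (Rint_ray_cat h0' gi').
by move: head tail; set A1 := Rintegral _ _ _; set A2 := Rintegral _ _ _; set A3 := Rintegral _ _ _;
   set A4 := Rintegral _ _ _; rewrite -/zeta; lra.
Qed.

End LowerBounds.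

(** * Local lower bounds and continuity of the value function *)

Section Continuity.
Variables (R : realType) (M : model R).
Notation mu := (@lebesgue_measure R).
Notation T := (delay M).
Notation r := (rate M).
Notation rho := (discount M).
Notation C := (lipc M).
Notation a := (memory M).
Notation f0 := (income M).
Notation U1 := (util1 M).
Notation U2 := (util2 M).
Notation I := (`[- T, 0]%classic : set R).
Notation ray := (`[0%R, +oo[%classic : set R).
Notation traj := (traj M).
Notation delayed := (delayed_term M).
Notation consume := (consumption M).
Notation DVM := (DV T r rho a f0 U1 U2).
Notation VM := (Vfun T r rho a f0 U1 U2).
Notation adm := (adm M).
Notation gain := (discounted_gain M).
Implicit Types (x dx c : R -> R) (eta zeta : Hpt R) (h s t : R).
Notation admissible_upto := (admissible_upto M).

(** A negative value at the origin would persist at a small positive [y] by the Lipschitz bound,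
    against [income_pos]. *)
Lemma income00 : 0 <= f0 0 0.
Proof.
rewrite leNgt; apply/negP => f00; have C0 := lipc_ge0 M.
pose y : R := - f0 0 0 / (2 * (C + 1)).
have y0 : 0 < y by rewrite divr_gt0 ?oppr_gt0 // mulr_gt0 // ltr_wpDl.
have := @income_pos _ M _ y0; have := f0_lipschitz M 0 0 0 y.
rewrite subrr normr0 add0r sub0r normrN (gtr0_norm y0) ler_norml.
have : y * (2 * (C + 1)) = - f0 0 0 by rewrite /y divfK // gt_eqF // mulr_gt0 // ltr_wpDl.
nra.
Qed.

Lemma income_ge (x y : R) : 0 <= x -> 0 <= y -> - (C * x) <= f0 x y.
Proof.
move=> x0 y0; have := f0_lipschitz M x y 0 y.
rewrite subrr normr0 addr0 subr0 (ger0_norm x0) ler_norml.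
by have := @income_mono _ M 0 _ _ (lexx 0) y0; have := income00; lra.
Qed.

Lemma util2_ig : ig ray (fun t => expR (- (rho * t)) * U2 (expR (- (C * t)))).
Proof.
have [K UK] := util2_bounded M.
have ec k : continuous (fun t : R => expR (- (k * t))).
  move=> t; apply: continuous_comp; last exact: continuous_expR.
  by apply: continuousN; apply: continuousM => //; exact: cst_continuous.
have cm : {within ray, continuous (fun t => expR (- (rho * t)) * U2 (expR (- (C * t))))}.
  apply: within_contM; first exact: continuous_subspaceT.
  have /within_contP c2 := @util2_cont _ M.
  have c1 : {within ray, continuous (fun t : R => expR (- (C * t)))} by exact: continuous_subspaceT.
  move/within_contP in c1; apply/within_contP => t tI e e0.
  have xt : `]0%R, +oo[%classic (expR (- (C * t))) by rewrite /= in_itv /= andbT expR_gt0.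
  have [d d0 dh] := c2 _ xt e e0; have [d' d'0 dh'] := c1 t tI d d0.
  exists d' => // s sI /(dh' s sI); apply: dh.
  by rewrite /= in_itv /= andbT expR_gt0.
have mf := within_cont_meas (measurable_itv _) cm.
apply: integrable_of_funepos => //; [exact/measurable_EFinP| |exact: util2_int].
have /integrableP[km] := exp_ig M `|K|; apply: le_lt_trans.
apply: ge0_le_integral => //.
- by apply: measurable_funepos; exact/measurable_EFinP.
- exact: measurableT_comp.
- move=> t _; rewrite funeposE /= -EFin_max lee_fin.
  rewrite ge_max normr_ge0 andbT; apply: le_trans (ler_norm _).
  rewrite mulrC ler_wpM2r ?expR_ge0 //.
  by apply: le_trans (ler_norm _); apply: UK; exact: expR_gt0.
Qed.

(** The path [eta.1 * e^((r - C) t)] is admissible, because with a nonnegative past the income is at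
    least [- C x]. From [t0 = 1 / (r kap)] on, [kap e^(r t) >= 1], so the path dominates e^(-Ct) and
    [util2_int] applies; before [t0] it stays above [k0]. The resulting bound [low] involves only
    [kap]. *)
Lemma positive_history kap : 0 < kap -> exists K : R, forall eta, inH T eta -> kap <= eta.1 ->
  (forall t, - T <= t < 0 -> 0 <= eta.2 t) -> DVM eta /\ K <= fine (VM eta).
Proof.
move=> kap0; have r0 := rate_gt0 M; have C0 := lipc_ge0 M.
have [K K0 [UK _]] := util_bound M.
pose t0 : R := 1 / (r * kap).
have t00 : 0 < t0 by rewrite divr_gt0 // mulr_gt0.
pose k0 : R := kap * expR (- (C * t0)).
have k00 : 0 < k0 by rewrite mulr_gt0 // expR_gt0.
pose low t : R := (- (K + `|U2 k0|)) * expR (- (rho * t)) - `|expR (- (rho * t)) * U2 (expR (- (C * t)))|.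
have lowi : ig ray low by apply: igB => //; [exact: exp_ig|apply: ig_norm => //; exact: util2_ig].
exists (Rintegral mu ray low) => eta eH keta epos.
pose k : R := r - C.
pose x t : R := if t < 0 then eta.2 t else eta.1 + eta.1 * (expR (k * t) - 1).
pose dx t : R := eta.1 * (k * expR (k * t)).
have tr h : 0 <= h -> traj eta x dx h by move=> h0; exact: traj_exp.
have e0 : 0 < eta.1 by exact: lt_le_trans keta.
have xE t : 0 <= t -> x t = eta.1 * expR (k * t) by move=> tp; rewrite /x ltNge tp /=; ring.
have xp t : 0 <= t -> 0 < x t by move=> tp; rewrite xE // mulr_gt0 // expR_gt0.
have xp' t : - T <= t -> 0 <= x t.
  move=> tT; case: (leP 0 t) => tp; first exact: ltW (xp t tp).
  by rewrite /x tp; apply: epos; rewrite tT.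
have ad : adm eta x dx.
  split => // t tp; split; first exact: xp.
  have y0 : 0 <= delayed x t.
    apply: Rint_ge0 => xi xiI; rewrite mulr_ge0 ?memory_ge0 //.
    by apply: xp'; move: xiI; rewrite /= in_itv /=; lra.
  have := income_ge (ltW (xp t tp)) y0.
  have -> : consume x dx t = r * x t + f0 (x t) (delayed x t) - k * x t.
    by rewrite /consumption; congr (_ - _); rewrite xE // /dx; ring.
  by rewrite /k; lra.
have ge t : 0 <= t -> low t <= gain x dx t.
  move=> tp; have [xt ct] := ad.2 t tp.
  have := UK _ ct; rewrite ler_norml => /andP[u1 _].
  have u2 : - `|U2 k0| - `|U2 (expR (- (C * t)))| <= U2 (x t).
    have n1 := ler_norm (- U2 k0); have n2 := ler_norm (- U2 (expR (- (C * t)))).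
    rewrite !normrN in n1 n2.
    have n3 := normr_ge0 (U2 k0); have n4 := normr_ge0 (U2 (expR (- (C * t)))).
    have xlow : kap * expR (r * t) * expR (- (C * t)) <= x t.
      rewrite xE // -mulrA -expRD (_ : r * t - C * t = k * t); last by rewrite /k; ring.
      by rewrite ler_wpM2r // expR_ge0.
    case: (leP t t0) => tt0.
      suff : U2 k0 <= U2 (x t) by lra.
      apply: U2_mono => //; apply: le_trans xlow.
      rewrite /k0 ler_pM //.
      - exact: ltW.
      - by rewrite ler_pMr // -[X in X <= _]expR0 ler_expR mulr_ge0 // ltW.
      - by rewrite ler_expR lerN2 ler_wpM2l.
    suff : U2 (expR (- (C * t))) <= U2 (x t) by lra.
    apply: U2_mono; first exact: expR_gt0.
    apply: le_trans xlow; rewrite ler_pMl ?expR_gt0 //.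
    apply: (@le_trans _ _ (kap * (1 + r * t0))); last first.
      rewrite ler_wpM2l ?(ltW kap0) //; apply: le_trans (expR_ge1Dx _) _.
      by rewrite ler_expR ler_wpM2l ?(ltW r0) // ltW.
    rewrite (_ : kap * (1 + r * t0) = kap + 1); last by rewrite /t0; field; lra.
    by rewrite lerDr ltW.
  rewrite /low normrM ger0_norm ?expR_ge0 // /discounted_gain.
  rewrite (mulrC (- _)) -mulrBr ler_wpM2l ?expR_ge0 //; lra.
have [gi le] := gain_ig_ge ad lowi ge.
have [D le'] := V_lower ad gi; split => //; exact: le_trans le'.
Qed.

(** The perturbed history may be negative, but after a time [T] it is forgotten: the corrected path
    stays above [m / 2] on [[0, T]], so at time [T] its whole history is positive and
    [positive_history] takes over. *)
Lemma V_ball eta : DVM eta -> exists2 d : R, 0 < d & exists K : R, forall eta', inH T eta' ->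
  Hnorm T (Hsub eta' eta) < d -> DVM eta' /\ K <= fine (VM eta').
Proof.
move=> D; have [x [dx [ad _ _]]] := V_approx D ltr01; have [tr pos] := ad.
have T0 := ltW (delay_gt0 M); have C0 := lipc_ge0 M; have r0 := rate_gt0 M.
have [A A0 aA] := W12_bounded M.
have [K1 K10 [UK _]] := util_bound M.
have [s sI smin] := EVT_min T0 (traj_cont T0 (tr T T0)).
pose m : R := x s.
have m0 : 0 < m by have [] := pos s; move: sI; rewrite in_itv /= => /andP[].
have m20 : 0 < m / 2 by rewrite divr_gt0.
have [K2 PH] := positive_history m20.
pose N1 : R := Hnorm T (0, fun=> 1).
have N10 : 0 <= N1 by exact: Hnorm_ge0.
(* With [|w| <= n e^(kt)] and [|delayed w| <= A (N1 + T) n e^(kt)], interest and income drop by at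
   most [k n e^(kt)], which is exactly [- dw]. Here [N1 * n] bounds the L^1 norm of [zeta.2]. *)
pose k : R := r + C + C * A * (N1 + T).
have k0 : 0 < k.
  by rewrite /k -addrA ltr_wpDr // addr_ge0 // mulr_ge0 ?mulr_ge0 ?addr_ge0.
(* This radius keeps [n e^(kT)], and with it the correction [w] on [[0, T]], below [m / 2]. *)
exists ((m / 2) * expR (- (k * T))); first by rewrite mulr_gt0 // expR_gt0.
exists (- ((K1 + `|U2 (m / 2)|) * T) - `|K2|) => eta' eH' small.
have eH := traj_inH (tr 0 (lexx 0)).
pose zeta := Hsub eta' eta; have zH : inH T zeta by exact: inHB.
pose n : R := Hnorm T zeta.
have n0 : 0 <= n by exact: Hnorm_ge0.
have nsmall : n * expR (k * T) <= m / 2.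
  move: small => /ltW; rewrite -/zeta -/n -(ler_pM2r (expR_gt0 (k * T))).
  by rewrite -(mulrA (m / 2)) -expRD addNr expR0 mulr1.
pose w t : R := if t < 0 then zeta.2 t else zeta.1 + (- n) * (expR (k * t) - 1).
pose dw t : R := (- n) * (k * expR (k * t)).
have trw h : 0 <= h -> traj zeta w dw h by move=> h0; exact: traj_exp.
have z1 : `|zeta.1| <= n by exact: Hnorm_fst.
have wb t : 0 <= t -> `|w t| <= n * expR (k * t).
  move=> t0; have : 1 <= expR (k * t) by rewrite -[X in X <= _]expR0 ler_expR mulr_ge0 // ltW.
  rewrite -subr_ge0 => /(mulr_ge0 n0) e1.
  have -> : w t = zeta.1 + (- n) * (expR (k * t) - 1) by rewrite /w ltNge t0.
  by move: z1; rewrite !ler_norml => /andP[z11 z12]; lra.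
have zint : Rintegral mu I (fun u => `|zeta.2 u|) <= N1 * n.
  have zn : inH T ((0, fun u => `|zeta.2 u|) : Hpt R).
    split; first by apply: measurableT_comp => //; exact: L2_meas zH.
    apply: eq_ig (L2_sqr zH) => // u _; by rewrite real_normK ?num_real.
  have on : inH T ((0, fun=> 1) : Hpt R) by exact: L2_cst.
  have := cauchy_schwarz on zn; rewrite /Hinner mulr0 add0r => cs.
  apply: le_trans (le_trans (ler_norm _) _); last apply: (le_trans cs).
    by rewrite le_eqVlt; apply/orP; left; apply/eqP/Rint_eq => u _ /=; rewrite mul1r.
  rewrite -/N1 ler_wpM2l // -ler_sqr ?nnegrE ?Hnorm_ge0 // !HnormE expr0n add0r.
  rewrite ler_wpDl ?sqr_ge0 // le_eqVlt; apply/orP; left; apply/eqP/Rint_eq => u _ /=.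
  by rewrite real_normK ?num_real.
have yb t : 0 <= t <= T -> `|delayed w t| <= A * (N1 + T) * (n * expR (k * t)).
  move=> /andP[t0 tT].
  have ww u : 0 <= u <= t -> `|w u| <= n * expR (k * t).
    move=> /andP[u0 ut]; apply: (le_trans (wb u u0)).
    by rewrite ler_wpM2l // ler_expR ler_wpM2l // ltW.
  have tt : 0 <= t <= t by rewrite t0 lexx.
  apply: (le_trans (delayed_bound t0 (trw t t0) A0 aA ww tt)).
  rewrite -(mulrA A); apply: ler_wpM2l => //; rewrite (mulrDl N1); apply: lerD.
    apply: (le_trans zint); apply: ler_wpM2l => //.
    rewrite ler_peMr // -[X in X <= _]expR0 ler_expR mulr_ge0 // ltW //.
  by apply: ler_wpM2r => //; rewrite mulr_ge0 // expR_ge0.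
pose x' t := x t + w t; pose dx' t := dx t + dw t.
have tr' : traj eta' x' dx' T.
  by rewrite -(HaddBK eta eta'); apply: traj_add => //; [exact: tr|exact: trw].
have x'm t : 0 <= t <= T -> m / 2 <= x' t.
  move=> /andP[t0 tT]; have : m <= x t by apply: smin; rewrite in_itv /= t0.
  have : `|w t| <= m / 2.
    apply: (le_trans (wb t t0)); apply: le_trans nsmall.
    by rewrite ler_wpM2l // ler_expR ler_wpM2l // ltW.
  by rewrite ler_norml /x'; lra.
have up : admissible_upto eta' x' dx' T.
  split => // t tT; split; first exact: lt_le_trans (x'm t tT).
  have [t0 tT'] := andP tT; have tt : 0 <= t <= t by rewrite t0 lexx.
  have [x0 c0] := pos t t0; apply: (le_trans c0).
  have fl := f0_lipschitz M (x' t) (delayed x' t) (x t) (delayed x t).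
  have e1 : x' t - x t = w t by rewrite /x'; ring.
  have e2 : delayed x' t - delayed x t = delayed w t.
    by rewrite /x' (delayed_add tt (tr t t0) (trw t t0)); ring.
  rewrite e1 e2 ler_norml in fl; case/andP: fl => fl _.
  have wt := wb t t0; have yt := yb t tT.
  have cwt : C * (`|w t| + `|delayed w t|) <=
      C * (n * expR (k * t) + A * (N1 + T) * (n * expR (k * t))).
    by rewrite ler_wpM2l // lerD.
  have rw : - (r * (n * expR (k * t))) <= r * w t.
    by rewrite -mulrN ler_wpM2l ?(ltW r0) //; move: wt; rewrite ler_norml => /andP[].
  have e3 : - dw t = k * (n * expR (k * t)) by rewrite /dw; ring.
  rewrite -subr_ge0 /consumption /dx' {1}/x'.
  move: cwt rw e3 fl; rewrite /k; lra.
have H2 : DVM (hist x' T) /\ K2 <= fine (VM (hist x' T)).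
  apply: PH; first by apply: traj_hist tr'; rewrite T0 lexx.
    by apply: x'm; rewrite T0 lexx.
  move=> t /andP[t1 t2]; apply: le_trans (ltW m20) _; apply: x'm; apply/andP; lra.
have [D2 l2] := H2.
have [D' le] := dpp_concat T0 up D2; split => //; apply: le_trans le.
apply: lerD.
  have -> : - ((K1 + `|U2 (m / 2)|) * T) = - (K1 + `|U2 (m / 2)|) * (T - 0) by ring.
  rewrite -Rint_cst_itv //; apply: Rint_le => //.
  - exact: ig_cst_itv.
  - exact: gain_upto_ig up.
  - move=> t; rewrite /= in_itv /= => tT; have [x0 c0] := up.2 t tT.
    have := UK _ c0; rewrite ler_norml => /andP[u1 _].
    have u2 : U2 (m / 2) <= U2 (x' t) by apply: U2_mono => //; exact: x'm.
    have n1 := ler_norm (- U2 (m / 2)); rewrite normrN in n1.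
    have t0 : 0 <= t by case/andP: tT.
    have q1 : expR (- (rho * t)) <= 1.
      by rewrite expR_le1 oppr_le0 mulr_ge0 // ltW // discount_gt0.
    have q0 := expR_ge0 (- (rho * t)).
    have p : 0 <= K1 + `|U2 (m / 2)| by rewrite addr_ge0.
    rewrite /discounted_gain; apply: (@le_trans _ _ (expR (- (rho * t)) * - (K1 + `|U2 (m / 2)|))).
      by rewrite mulrN lerN2 ler_piMl.
    by rewrite ler_wpM2l //; lra.
have q1 : expR (- (rho * T)) <= 1.
  by rewrite expR_le1 oppr_le0 mulr_ge0 // ltW // discount_gt0.
have q0 := expR_ge0 (- (rho * T)).
have n1 := ler_norm (- K2); rewrite normrN in n1.
apply: (@le_trans _ _ (expR (- (rho * T)) * - `|K2|)).
  by rewrite mulrN lerN2 ler_piMl.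
by rewrite ler_wpM2l //; lra.
Qed.

(* A concave function that is bounded above, and bounded below near a point, is
   continuous there: [eta'] is compared with the points at distance [d] on both
   sides of the line through [eta] and [eta']. *)
Lemma V_continuous : cont_on T DVM (fun eta => fine (VM eta)).
Proof.
move=> eta D e e0.
have [d d0 [K1 KP]] := V_ball D.
have [K2 K2P] := gain_bound M.
have up zeta : DVM zeta -> fine (VM zeta) <= K2 + 1.
  move=> Dz; have [x [dx [ad gi lt]]] := V_approx Dz ltr01.
  by have := K2P _ _ _ ad gi; lra.
have eH : inH T eta by case: D => _ [].
pose B : R := `|K2| + `|K1| + 2.
have B0 : 0 < B by rewrite ltr_wpDl // addr_ge0.
pose q : R := Num.min (1 / 2) (e / (2 * B)).
have q0 : 0 < q by rewrite lt_min; apply/andP; split => //; rewrite divr_gt0 // mulr_gt0.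
have q1 : q <= 1 / 2 by rewrite ge_min lexx.
have qB : q * B <= e / 2.
  have : q <= e / (2 * B) by rewrite ge_min lexx orbT.
  by rewrite ler_pdivlMr ?mulr_gt0 //; lra.
exists (q * d) => [|eta' D' near]; first exact: mulr_gt0.
have eH' : inH T eta' by case: D' => _ [].
have zH : inH T (Hsub eta' eta) by exact: inHB.
have side (sgn : R) : `|sgn| = 1 ->
    let z := Hadd eta (Hscale (sgn / q) (Hsub eta' eta)) in DVM z /\ K1 <= fine (VM z).
  move=> s1 z; apply: KP; first by apply: inHD => //; exact: inHZ.
  rewrite (@eq_Hnorm _ _ _ (Hscale (sgn / q) (Hsub eta' eta))).
  - rewrite HnormZ // normrM s1 mul1r normfV (gtr0_norm q0) mulrC ltr_pdivrMr //.
    by rewrite mulrC.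
  - by rewrite /= addrC addKr.
  - by move=> t _ /=; rewrite addrC addKr.
have [Dp Vp] := side 1 (normr1 _).
have [Dm Vm] := side (-1) (normrN1 _).
have qu : 0 <= q <= 1 by apply/andP; split; [exact: ltW|lra].
have [_ c1] := V_concave Dp D qu.
have e1 : Hadd (Hscale q (Hadd eta (Hscale (1 / q) (Hsub eta' eta)))) (Hscale (1 - q) eta) = eta'.
  case: (eta') => z0 z1; congr pair; [|apply/funext => t]; rewrite /=; field; exact: lt0r_neq0.
rewrite e1 in c1.
have qn0 : q != 0 by exact: lt0r_neq0.
have q1n0 : 1 + q != 0 by apply: lt0r_neq0; lra.
(* The weight for which [eta] is the combination of the far point on the opposite side and of
   [eta']; since [p <= q], the bound [q * B <= e / 2] serves both inequalities. *)
pose p : R := q / (1 + q).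
have pu : 0 <= p <= 1.
  apply/andP; split; first by rewrite divr_ge0 // ?(ltW q0) //; lra.
  by rewrite /p ler_pdivrMr; lra.
have [_ c2] := V_concave Dm D' pu.
have e2 : Hadd (Hscale p (Hadd eta (Hscale (-1 / q) (Hsub eta' eta)))) (Hscale (1 - p) eta') = eta.
  case: (eta) => z0 z1; congr pair; [|apply/funext => t]; rewrite /p /=; field; exact/andP.
rewrite e2 in c2.
have pq : p <= q by rewrite /p ler_pdivrMr; nra.
have p0 : 0 <= p by case/andP: pu.
move: (up _ D) (up _ D') c1 c2 Vp Vm; set V0 := fine (VM eta); set V' := fine (VM eta').
set W1 := fine _; set W2 := fine _ => u0 u1 c1 c2 Vp Vm.
have n1 := ler_norm K2; have n2 := ler_norm (- K1); rewrite normrN in n2.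
have b1 : V0 - W1 <= B by rewrite /B; lra.
have b2 : V' - W2 <= B by rewrite /B; lra.
have m1 : q * (V0 - W1) <= q * B by rewrite ler_wpM2l // ltW.
have m2 : p * (V' - W2) <= q * B.
  by apply: (@le_trans _ _ (p * B)); [rewrite ler_wpM2l|rewrite ler_wpM2r // ltW].
by rewrite ltr_norml; apply/andP; split; lra.
Qed.

End Continuity.

(** * Test functions along trajectories *)

Section FastCauchySequences.
Context d (X : measurableType d) (R : realType).
Variable mu : {measure set X -> \bar R}.
Variables (D : set X) (Z : nat -> X -> R).
Hypothesis mD : measurable D.
Hypothesis mZ : forall n, measurable_fun D (Z n).
Hypothesis Zfast : forall k,
  (\int[mu]_(x in D) ((Z k.+1 x - Z k x) ^+ 2)%:E <= ((9 ^- k) : R)%:E)%E.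

(** The weights [4 ^+ k] are a compromise: the integral of the sum [W] is at most the sum of
    [(4/9)^k], that is 9/5, and where [W] is finite, consecutive terms differ by at most
    [sqrt W * 2^-k], which gives pointwise convergence. *)
Let w k x : \bar R := (4 ^+ k * (Z k.+1 x - Z k x) ^+ 2)%:E.
Let W x : \bar R := (\sum_(k <oo) w k x)%E.

Let w0 k x : (0 <= w k x)%E.
Proof. by rewrite lee_fin; apply: mulr_ge0; [exact: exprn_ge0|exact: sqr_ge0]. Qed.

Let mw k : measurable_fun D (w k).
Proof.
apply/measurable_EFinP; apply: measurable_funM; first exact: measurable_cst.
by apply: measurable_funX; exact: measurable_funB.
Qed.

Let mW : measurable_fun D W.
Proof. by apply: ge0_emeasurable_sum => // k x _ _; exact: w0. Qed.

Let geom (n : nat) : \sum_(0 <= k < n) ((4 / 9) ^+ k : R) <= 9 / 5.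
Proof.
suff -> : \sum_(0 <= k < n) ((4 / 9) ^+ k : R) = 9 / 5 * (1 - (4 / 9) ^+ n).
  have : 0 <= (4 / 9 : R) ^+ n by rewrite exprn_ge0 // divr_ge0.
  by lra.
elim: n => [|n IH]; first by rewrite big_nil expr0 subrr mulr0.
by rewrite big_nat_recr //= IH exprS; field.
Qed.

Let intW : (\int[mu]_(x in D) W x <= (9 / 5)%:E)%E.
Proof.
rewrite integral_nneseries //.
apply: lime_le; first by apply: is_cvg_nneseries => k _ _; apply: integral_ge0.
apply: nearW => n.
apply: (@le_trans _ _ (\sum_(0 <= k < n) ((4 / 9) ^+ k : R)%:E)%E); last first.
  by rewrite sumEFin lee_fin; exact: geom.
apply: lee_sum => k _; rewrite /w.
under eq_integral do rewrite EFinM.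
rewrite ge0_integralZl_EFin ?exprn_ge0 //; last first.
- by apply/measurable_EFinP; apply: measurable_funX; exact: measurable_funB.
- by move=> x _; rewrite lee_fin sqr_ge0.
apply: (@le_trans _ _ ((4 ^+ k)%:E * ((9 ^- k) : R)%:E)%E).
  by apply: lee_wpmul2l => //; rewrite lee_fin exprn_ge0.
by rewrite -EFinM lee_fin expr_div_n.
Qed.

Let step x : (W x < +oo)%E ->
  exists s : R, [/\ 0 <= s, (s ^+ 2)%:E = W x & forall k, `|Z k.+1 x - Z k x| <= s * 2 ^- k].
Proof.
move=> Wx; have W0 : (0 <= W x)%E by apply: nneseries_ge0 => k _ _; exact: w0.
have Wf : W x \is a fin_num by rewrite ge0_fin_numE.
exists (Num.sqrt (fine (W x))); split; first exact: sqrtr_ge0.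
  by rewrite sqr_sqrtr ?fine_ge0 // fineK.
move=> k; have le : (w k x <= W x)%E.
  have := @nneseries_lim_ge R (fun k => w k x) xpredT 0 k.+1 (fun k _ _ => w0 k x).
  by apply: le_trans; rewrite big_nat_recr //= leeDr // sume_ge0.
rewrite -ler_sqr ?nnegrE ?mulr_ge0 ?sqrtr_ge0 ?invr_ge0 ?exprn_ge0 //.
rewrite exprMn sqr_sqrtr ?fine_ge0 // real_normK ?num_real //.
have e4 : (4 ^+ k : R) = (2 ^+ k) ^+ 2 by rewrite -exprM mulnC exprM; congr (_ ^+ _); ring.
rewrite exprVn -e4 ler_pdivlMr ?exprn_gt0 // mulrC -lee_fin fineK //.
Qed.

Let tail x (s : R) : 0 <= s -> (forall k, `|Z k.+1 x - Z k x| <= s * 2 ^- k) ->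
  forall n m, (n <= m)%N -> `|Z m x - Z n x| <= 2 * s * 2 ^- n.
Proof.
move=> s0 H n m nm.
suff : `|Z m x - Z n x| <= 2 * s * (2 ^- n - 2 ^- m).
  have : 0 <= 2 * s * 2 ^- m by rewrite !mulr_ge0 // invr_ge0 exprn_ge0.
  by lra.
rewrite -(subnKC nm); elim: (m - n)%N => [|j IH]; first by rewrite addn0 !subrr normr0 mulr0.
rewrite addnS; have := ler_distD (Z (n + j)%N x) (Z (n + j).+1 x) (Z n x).
have := H (n + j)%N.
have -> : 2 ^- (n + j).+1 = 2 ^- (n + j) / 2 :> R by rewrite exprS invfM mulrC.
by lra.
Qed.

Let cvgZ x : (W x < +oo)%E -> cvgn (fun n => Z n x).
Proof.
move=> /step[s [s0 _ H]].
have c : cvgn (series (fun k => Z k.+1 x - Z k x)).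
  apply: normed_cvg; apply: (@series_le_cvg _ _ (geometric s (1 / 2))).
  - by move=> n; exact: normr_ge0.
  - by move=> n; rewrite /geometric /= mulr_ge0 // exprn_ge0 // divr_ge0.
  - by move=> n; rewrite /geometric /= div1r exprVn; exact: H.
  - by apply: is_cvg_geometric_series; rewrite gtr0_norm ?divr_gt0 // ltr_pdivrMr // mul1r ltr1n.
have -> : (fun n => Z n x) = (fun n => Z 0%N x + series (fun k => Z k.+1 x - Z k x) n).
  by apply/funext => n; rewrite /series /= telescope_sumr // addrC subrK.
by apply: is_cvgD => //; exact: is_cvg_cst.
Qed.

Lemma fast_cauchy_limit : exists z : X -> R, measurable_fun D z /\
  exists c : R, forall n, (\int[mu]_(x in D) ((z x - Z n x) ^+ 2)%:E <= (c * 4 ^- n)%:E)%E.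
Proof.
(* The default value 0 is harmless: where [W = +oo], the pointwise bound by a positive multiple of
   [W] holds trivially, so no null set has to be removed. *)
pose z x : R := if (W x < +oo)%E then limn (fun n => Z n x) else 0.
exists z.
have mz : measurable_fun D z.
  apply: (@measurable_fun_cvg _ _ _ _ (fun n x => if (W x < +oo)%E then Z n x else 0)).
    move=> n; apply: measurable_fun_if => //.
    - by apply: measurable_fun_lte => //; exact: measurable_cst.
    - by apply: measurable_funS (mZ n) => //; exact: subIsetl.
  move=> x Dx; rewrite /z; case: ifP => Wx; last exact: cvg_cst.
  exact: cvgZ.
split => //; exists (4 * (9 / 5)) => n.
apply: (@le_trans _ _ (\int[mu]_(x in D) ((4 * 4 ^- n : R)%:E * W x))%E); last first.
  rewrite ge0_integralZl_EFin //; last first.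
    by move=> x _; apply: nneseries_ge0 => k _ _; exact: w0.
  apply: (@le_trans _ _ ((4 * 4 ^- n : R)%:E * (9 / 5)%:E)%E).
    by apply: lee_wpmul2l => //; rewrite lee_fin mulr_ge0 // invr_ge0 exprn_ge0.
  by rewrite -EFinM lee_fin mulrAC.
apply: ge0_le_integral => //.
- by move=> x _; rewrite lee_fin sqr_ge0.
- by apply/measurable_EFinP; apply: measurable_funX; exact: measurable_funB.
- by apply: emeasurable_funM => //; exact: measurable_cst.
move=> x Dx; rewrite /z; case: ifPn => [Wx|]; last first.
  rewrite -leNgt leye_eq => /eqP ->; rewrite gt0_muley ?leey // lte_fin mulr_gt0 // invr_gt0 exprn_gt0.
have [s [s0 <- H]] := step Wx; have tl := tail s0 H.
rewrite -EFinM lee_fin.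
have lim : `|limn (fun n => Z n x) - Z n x| <= 2 * s * 2 ^- n.
  apply/ler_addgt0Pr => e e0.
  have /cvgrPdist_lt/(_ _ e0)[m _ mh] := cvgZ Wx.
  have := mh (maxn m n) (leq_maxl _ _); have := tl _ _ (leq_maxr m n).
  have := ler_distD (Z (maxn m n) x) (limn (fun n => Z n x)) (Z n x) => /=.
  by lra.
rewrite -real_normK ?num_real //.
have e4 : (4 ^- n : R) = (2 ^- n) ^+ 2 by rewrite exprVn -exprM mulnC exprM; congr (_ ^+ _)^-1; ring.
rewrite e4; have -> : 4 * (2 ^- n) ^+ 2 * s ^+ 2 = (2 * s * 2 ^- n) ^+ 2 by ring.
by rewrite ler_sqr ?nnegrE // !mulr_ge0 // invr_ge0 exprn_ge0.
Qed.

End FastCauchySequences.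

(** * Fubini's theorem on a rectangle *)

Section FubiniRectangle.
Context d1 d2 (T1 : measurableType d1) (T2 : measurableType d2) (R : realType).
Variable m1 : {sigma_finite_measure set T1 -> \bar R}.
Variable m2 : {sigma_finite_measure set T2 -> \bar R}.
Local Open Scope ereal_scope.

(** Extended by zero outside the rectangle, [F] is integrable on the product: its inner L^1 norms
    are at most [K], and [A] has finite measure. *)
Lemma fubini_rectangle (A : set T1) (B : set T2) (F : T1 -> T2 -> R) (K : R) :
  measurable A -> measurable B -> m1 A < +oo ->
  measurable_fun setT (fun z : T1 * T2 => F z.1 z.2) ->
  (forall s, A s -> \int[m2]_(y in B) `|(F s y)%:E| <= K%:E) ->
  \int[m1]_(s in A) \int[m2]_(y in B) (F s y)%:E = \int[m2]_(y in B) \int[m1]_(s in A) (F s y)%:E.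
Proof.
move=> mA mB Afin mF FK.
pose G : T1 * T2 -> \bar R := (fun z => (F z.1 z.2)%:E) \_ (A `*` B).
have GE s y : G (s, y) = if (s \in A) && (y \in B) then (F s y)%:E else 0.
  by rewrite /G patchE in_setX.
have mG : measurable_fun setT G.
  apply/(measurable_restrictT _ _).1; first exact: measurableX.
  by apply: measurable_funTS; exact/measurable_EFinP.
have in2 (f : R -> \bar R) s : f 0%R = 0 -> \int[m2]_y f (fine (G (s, y))) =
    if s \in A then \int[m2]_(y in B) f (F s y) else 0.
  move=> f0; case: ifP => sA.
    rewrite [RHS]integral_mkcond; apply: eq_integral => y _.
    by rewrite patchE GE sA /=; case: ifP.
  by rewrite integral0_eq // => y _; rewrite GE sA.
have in1 y : \int[m1]_s G (s, y) = if y \in B then \int[m1]_(s in A) (F s y)%:E else 0.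
  case: ifP => yB.
    rewrite [RHS]integral_mkcond; apply: eq_integral => s _.
    by rewrite patchE GE yB andbT; case: ifP.
  by rewrite integral0_eq // => s _; rewrite GE yB andbF.
have Gf s y : (fine (G (s, y)))%:E = G (s, y) by rewrite GE; case: ifP.
have GI : (m1 \x m2).-integrable setT G.
  apply/integrable12ltyP => //.
  apply: (@le_lt_trans _ _ (\int[m1]_(s in A) K%:E)); last first.
    have h : K%:E * m1 A < +oo.
      by rewrite -[m1 A]fineK ?ge0_fin_numE ?measure_ge0 // -EFinM ltry.
    by rewrite integral_cst.
  rewrite [leRHS]integral_mkcond; apply: ge0_le_integral => //.
  - by move=> s _; apply: integral_ge0.
  - by apply: (measurable_fun_fubini_tonelli_F (abse \o G)) => //=; exact: measurableT_comp.
  - by apply/(measurable_restrictT _ _).1 => //; exact: measurable_cst.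
  move=> s _; rewrite patchE.
  under eq_integral do rewrite -Gf.
  rewrite (in2 (fun u => `|u%:E|)) /= ?normr0 //.
  by case: ifP => // /set_mem /FK.
have := Fubini GI.
rewrite (eq_integral ((fun s => \int[m2]_(y in B) (F s y)%:E) \_ A)); last first.
  move=> s _; rewrite patchE -(in2 EFin) //; apply: eq_integral => y _; exact/esym/Gf.
rewrite -integral_mkcond => ->.
rewrite (eq_integral ((fun y => \int[m1]_(s in A) (F s y)%:E) \_ B)); last first.
  by move=> y _; rewrite patchE in1.
by rewrite -integral_mkcond.
Qed.

End FubiniRectangle.

Lemma eint_eq (R : realType) (D : set R) (f g : R -> \bar R) : (forall x, D x -> f x = g x) ->
  (\int[@lebesgue_measure R]_(x in D) f x = \int[@lebesgue_measure R]_(x in D) g x)%E.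
Proof. by move=> fg; apply: eq_integral => x; rewrite inE => /fg. Qed.

(** * The integrated history and the adjoint of A *)

Section WeakForm.
Variables (R : realType) (M : model R).
Notation mu := (@lebesgue_measure R).
Notation T := (delay M).
Notation r := (rate M).
Notation I := (`[- T, 0]%classic : set R).
Notation traj := (traj M).
Implicit Types (x dx c : R -> R) (eta zeta : Hpt R) (h s t : R).

Lemma traj_ig eta x dx h : 0 <= h -> traj eta x dx h -> ig `[- T, h] x.
Proof.
move=> h0 tr; apply: (@ig_le _ _ _ (fun u => x u ^+ 2 + 1)) => //.
- exact: traj_meas h0 tr.
- by move=> u _; rewrite ler_norml; have := sqr_ge0 (x u - 1); have := sqr_ge0 (x u + 1); nra.
- by apply: igD => //; [exact: traj_sqr h0 tr|exact: ig_cst_itv].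
Qed.

(** This is the integral of the histories X(s) over [[0, h]], written in the form [z0 - int_xi^0 g]
    that [adjA] accepts, with [g] the second component of X(h) - eta. It thus lies in the domain of
    [A], and [A] maps it to [(r * z0, g)]. *)
Definition hist_integral eta x h : Hpt R :=
  let z0 := Rintegral mu `[0, h] x in
  (z0, fun xi => z0 - Rintegral mu `[xi, 0] (fun u => x (h + u) - eta.2 u)).

(** Both sides are the integral of [x] over [[xi, h + xi]]: the common part of the windows [[0, h]]
    and [[xi, h + xi]] cancels. *)
Lemma hist_integralE eta x dx h xi : 0 <= h -> traj eta x dx h -> - T <= xi <= 0 ->
  (hist_integral eta x h).2 xi = Rintegral mu `[0, h] (fun s => x (s + xi)).
Proof.
move=> h0 tr xiI /=; have xi_ig := traj_ig h0 tr; have T0 := delay_gt0 M.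
have sub u v : - T <= u -> v <= h -> ig `[u, v] x.
  by move=> uT vh; apply: ig_sub xi_ig => // w; rewrite /= !in_itv /=; lra.
have s1 : Rintegral mu `[xi, h] x = Rintegral mu `[xi, 0] x + Rintegral mu `[0, h] x.
  by apply: Rint_split; [lra|lra|apply: sub; lra].
have s2 : Rintegral mu `[xi, h] x = Rintegral mu `[xi, h + xi] x + Rintegral mu `[h + xi, h] x.
  by apply: Rint_split; [lra|lra|apply: sub; lra].
have e1 : Rintegral mu `[xi, 0] (fun u => x (h + u) - eta.2 u) =
    Rintegral mu `[h + xi, h] x - Rintegral mu `[xi, 0] x.
  have e2 : Rintegral mu `[xi, 0] (fun u => x (h + u) - eta.2 u) =
      Rintegral mu `[xi, 0] (fun u => x (h + u) - x u).
    apply: Rint_eq_co; first by case/andP: xiI.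
    by case: tr => _ xe _ _ u uI; rewrite (xe u) //; lra.
  rewrite e2 RintB //.
  - congr (_ - _); rewrite Rint_itv_shift ?addr0 //.
    by apply: ig_meas; apply: sub; lra.
  - by apply: (ig_itv_shift (f := x)); rewrite addr0; apply: sub; lra.
  - by apply: sub; lra.
have e3 : Rintegral mu `[0, h] (fun s => x (s + xi)) = Rintegral mu `[xi, h + xi] x.
  rewrite (Rint_eq (g := fun s => x (xi + s))); last by move=> s _; rewrite addrC.
  rewrite Rint_itv_shift addr0 (addrC xi) //.
  by apply: ig_meas; apply: sub; lra.
by rewrite e1 e3; move: s1 s2; clear; lra.
Qed.

Lemma hist_diff_L2 eta x dx h : 0 <= h -> traj eta x dx h ->
  L2 T (fun u => x (h + u) - eta.2 u).
Proof.
move=> h0 tr; have hh : 0 <= h <= h by rewrite h0 lexx.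
by apply: L2B; [exact: (traj_hist hh tr)|exact: traj_inH tr].
Qed.

Lemma inH_hist_integral eta x dx h : 0 <= h -> traj eta x dx h -> inH T (hist_integral eta x h).
Proof.
move=> h0 tr; pose g u := x (h + u) - eta.2 u.
have gi : ig I g := L2_ig (hist_diff_L2 h0 tr); have T0 := delay_gt0 M.
have Tle : - T <= 0 by rewrite oppr_le0 ltW.
pose G xi := (Rintegral mu `[0, h] x - Rintegral mu I g) + Rintegral mu `[- T, xi] g.
have GE xi : - T <= xi <= 0 -> G xi = (hist_integral eta x h).2 xi.
  move=> /andP[x1 x2]; rewrite /G /= -/g (@Rint_split _ (- T) xi 0) //; ring.
have Gc : {within I, continuous G}.
  by apply: within_contD; [exact: within_cont_cst|exact: parameterized_integral_continuous].
apply: (@eq_L2 _ _ G) => //.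
split; first exact: within_cont_meas.
by apply: (@within_cont_ig _ (fun xi => G xi * G xi)); exact: within_contM.
Qed.

Lemma Hinner_hist_cont eta x dx zeta q h : 0 <= h -> traj eta x dx h -> inH T zeta -> inH T q ->
  {within `[0, h], continuous (fun s => Hinner T (Hsub (hist x s) zeta) q)}.
Proof.
move=> h0 tr zH qH; apply/within_contP => s sI e e0.
have N0 := Hnorm_ge0 T q.
have e1 : 0 < e / (Hnorm T q + 1) by rewrite divr_gt0 // ltr_wpDl.
have [d d0 dh] := traj_hist_cont h0 tr e1; exists d => // t tI st.
have sH : inH T (hist x s) by apply: traj_hist tr; move: sI; rewrite /= in_itv.
have tH : inH T (hist x t) by apply: traj_hist tr; move: tI; rewrite /= in_itv.
have := dh s t sI tI st; rewrite ltr_pdivlMr; last by rewrite ltr_wpDl.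
have -> : Hinner T (Hsub (hist x s) zeta) q - Hinner T (Hsub (hist x t) zeta) q =
    Hinner T (Hsub (hist x s) (hist x t)) q by rewrite !HinnerBl //; ring.
have := cauchy_schwarz (inHB sH tH) qH.
have := Hnorm_ge0 T (Hsub (hist x s) (hist x t)); nra.
Qed.

(** Cutting [x], [eta.2] and [q.2] off outside their intervals makes the integrand measurable on the
    plane. Its inner L^1 norms are bounded by Cauchy-Schwarz, uniformly in [s] because the norm of
    X(s) - eta is continuous on [[0, h]]. *)
Lemma hist_fubini eta x dx q h : 0 <= h -> traj eta x dx h -> inH T q ->
  Rintegral mu `[0, h] (fun s => Rintegral mu I (fun xi => (x (s + xi) - eta.2 xi) * q.2 xi)) =
  Rintegral mu I (fun xi => ((hist_integral eta x h).2 xi - h * eta.2 xi) * q.2 xi).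
Proof.
move=> h0 tr qH; have T0 := delay_gt0 M; have eH := traj_inH tr.
have xI := traj_ig h0 tr.
have subx u v : - T <= u -> v <= h -> ig `[u, v] x.
  by move=> uT vh; apply: ig_sub xI => // w; rewrite /= !in_itv /=; lra.
pose xp := x \_ `[- T, h]; pose e1 := eta.2 \_ I; pose q1 := q.2 \_ I.
pose F s xi := (xp (s + xi) - e1 xi) * q1 xi.
have FE s xi : 0 <= s <= h -> - T <= xi <= 0 -> F s xi = (x (s + xi) - eta.2 xi) * q.2 xi.
  move=> sI xiI; rewrite /F /xp /e1 /q1 !patchE !mem_set //=.
  by rewrite in_itv /=; lra.
have mp : measurable_fun setT (fun z : R * R => F z.1 z.2).
  have m1 : measurable_fun setT (fun z : R * R => z.1 + z.2).
    by apply: measurable_funD; [exact: measurable_fst|exact: measurable_snd].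
  have m2 : measurable_fun setT xp.
    by apply/(measurable_restrictT _ _).1 => //; exact: ig_meas xI.
  have m3 : measurable_fun setT e1.
    by apply/(measurable_restrictT _ _).1 => //; exact: L2_meas eH.
  have m4 : measurable_fun setT q1.
    by apply/(measurable_restrictT _ _).1 => //; exact: L2_meas qH.
  apply: measurable_funM; first apply: measurable_funB.
  - exact: measurableT_comp m2 m1.
  - exact: measurableT_comp m3 measurable_snd.
  - exact: measurableT_comp m4 measurable_snd.
have Di s : 0 <= s <= h -> ig I (fun xi => (x (s + xi) - eta.2 xi) * q.2 xi).
  by move=> sI; apply: L2_mul => //; apply: L2B => //; exact: (traj_hist sI tr).
have xbd : exists2 B : R, 0 <= B & forall s, 0 <= s <= h -> Hnorm T (Hsub (hist x s) eta) <= B.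
  have c1 : {within `[0, h], continuous (fun s => Hnorm T (Hsub (hist x s) eta))}.
    apply/within_contP => s sI e e0; have [d d0 dh] := traj_hist_cont h0 tr e0.
    exists d => // t tI st; apply: le_lt_trans (dh s t sI tI st).
    have sH : inH T (hist x s) by apply: traj_hist tr; move: sI; rewrite /= in_itv.
    have tH : inH T (hist x t) by apply: traj_hist tr; move: tI; rewrite /= in_itv.
    have stH := inHB sH tH; have tsH := inHB tH sH.
    have seH := inHB sH eH; have teH := inHB tH eH.
    have k1 := Hnorm_triangle stH teH; have k2 := Hnorm_triangle tsH seH.
    have E u v : Hadd (Hsub u v) (Hsub v eta) = Hsub u eta.
      by congr pair; [|apply/funext => w]; rewrite /= addrA subrK.
    rewrite !E in k1 k2; rewrite (HnormBC tH sH) in k2.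
    by rewrite ler_norml; lra.
  have [c cI cmax] := EVT_max h0 c1.
  exists (Hnorm T (Hsub (hist x c) eta)); first exact: Hnorm_ge0.
  by move=> s sI; apply: cmax; rewrite in_itv.
have [B B0 BP] := xbd.
have intF s : 0 <= s <= h -> (\int[mu]_(xi in I) `|(F s xi)%:E| <= (B * Hnorm T q)%:E)%E.
  move=> sI.
  rewrite (@eint_eq _ _ _ (fun xi => (`|(x (s + xi) - eta.2 xi) * q.2 xi|)%:E)); last first.
    by move=> xi; rewrite /= in_itv /= => xiI; rewrite FE.
  rewrite EFin_Rintegral //; last by apply: ig_norm => //; exact: Di.
  rewrite lee_fin; have sH := traj_hist sI tr.
  have aH : inH T ((0, fun xi => `|x (s + xi) - eta.2 xi|) : Hpt R).
    have [m1 m2] := inHB sH eH; split; first exact: measurableT_comp.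
    by apply: eq_ig m2 => // u _; rewrite real_normK ?num_real.
  have bH : inH T ((0, fun xi => `|q.2 xi|) : Hpt R).
    have [m1 m2] := qH; split; first exact: measurableT_comp.
    by apply: eq_ig m2 => // u _; rewrite real_normK ?num_real.
  have := cauchy_schwarz aH bH; rewrite /Hinner mulr0 add0r /= => cs.
  apply: (@le_trans _ _ (Hnorm T ((0, fun xi => `|x (s + xi) - eta.2 xi|) : Hpt R) *
     Hnorm T ((0, fun xi => `|q.2 xi|) : Hpt R))).
    apply: le_trans cs; apply: le_trans (ler_norm _).
    by rewrite le_eqVlt; apply/orP; left; apply/eqP/Rint_eq => u _; rewrite normrM.
  have nle (u : R) f : Hnorm T ((0, fun xi => `|f xi|) : Hpt R) <= Hnorm T (u, f).
    rewrite -ler_sqr ?nnegrE ?Hnorm_ge0 // !HnormE expr0n add0r.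
    rewrite ler_wpDl ?sqr_ge0 // le_eqVlt; apply/orP; left; apply/eqP/Rint_eq => v _ /=.
    by rewrite real_normK ?num_real.
  apply: ler_pM; rewrite ?Hnorm_ge0 //.
    by apply: le_trans (BP s sI); exact: nle.
  by case: (q) qH => q0 q2 _; exact: nle.
have fub := @fubini_rectangle _ _ (measurableTypeR R) (measurableTypeR R) R mu mu
  `[0, h]%classic I F (B * Hnorm T q) (measurable_itv _) (measurable_itv _) _ mp.
have {}fub : (\int[mu]_(s in `[0%R, h]) \int[mu]_(xi in I) (F s xi)%:E =
              \int[mu]_(xi in I) \int[mu]_(s in `[0%R, h]) (F s xi)%:E)%E.
  apply: fub => [|s]; last by rewrite /= in_itv; exact: intF.
  by rewrite /= lebesgue_measure_itv /=; case: ifP => // _; rewrite -EFinD ltry.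
clear mp intF xbd BP.
rewrite /Rintegral; congr fine; move: fub.
rewrite (@eint_eq _ _ _ (fun s => (Rintegral mu I (fun xi => (x (s + xi) - eta.2 xi) * q.2 xi))%:E)); last first.
  move=> s; rewrite /= in_itv /= => sI; rewrite -EFin_Rintegral //; last exact: Di.
  by apply: eint_eq => xi; rewrite /= in_itv /= => xiI; rewrite FE.
move=> ->; apply: eint_eq => xi; rewrite /= in_itv /= => xiI.
have xxi : ig `[0, h] (fun s => x (s + xi)).
  apply: (@eq_ig _ _ (fun s => x (xi + s))) => //; first by move=> s _; rewrite addrC.
  by apply: (ig_itv_shift (f := x)); apply: subx; lra.
rewrite (@eint_eq _ _ _ (fun s => (q.2 xi * (x (s + xi) - eta.2 xi))%:E)); last first.
  by move=> s; rewrite /= in_itv /= => sI; rewrite FE // mulrC.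
rewrite EFin_Rintegral //; last by apply: igZ => //; apply: igB => //; exact: ig_cst_itv.
congr EFin; have /= -> := hist_integralE h0 tr xiI; rewrite RintZ // ?RintB // ?Rint_cst_itv //; try exact: ig_cst_itv; last first.
  by apply: igB => //; exact: ig_cst_itv.
ring.
Qed.

Lemma hist_integral_Hinner eta x dx q h : 0 <= h -> traj eta x dx h -> inH T q ->
  Hinner T (hist_integral eta x h) q - h * Hinner T eta q =
  Rintegral mu `[0, h] (fun s => Hinner T (Hsub (hist x s) eta) q).
Proof.
move=> h0 tr qH; have T0 := delay_gt0 M; have eH := traj_inH tr.
have zH := inH_hist_integral h0 tr; have xi0 := within_cont_ig (traj_cont h0 tr).
have diff_ig : ig `[0, h] (fun s => x s - eta.1).
  by apply: igB; [exact: measurable_itv|exact: xi0|exact: ig_cst_itv].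
have inner_cont := Hinner_hist_cont h0 tr eH qH.
have lhs1 : Rintegral mu `[0, h] (fun s => Hinner T (Hsub (hist x s) eta) q) =
    (Rintegral mu `[0, h] x - h * eta.1) * q.1 +
    Rintegral mu `[0, h] (fun s => Rintegral mu I (fun xi => (x (s + xi) - eta.2 xi) * q.2 xi)).
  have i1 : ig `[0, h] (fun s => q.1 * (x s - eta.1)) by exact: igZ.
  have i2 : ig `[0, h] (fun s => Rintegral mu I (fun xi => (x (s + xi) - eta.2 xi) * q.2 xi)).
    apply: (@eq_ig _ _ (fun s => Hinner T (Hsub (hist x s) eta) q - q.1 * (x s - eta.1))) => //.
      by move=> s _; rewrite /Hinner /=; ring.
    by apply: igB; [exact: measurable_itv|exact: within_cont_ig|exact: i1].
  rewrite (Rint_eq (g := fun s => q.1 * (x s - eta.1) +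
      Rintegral mu I (fun xi => (x (s + xi) - eta.2 xi) * q.2 xi))); last first.
    by move=> s _; rewrite /Hinner /= mulrC.
  rewrite (RintD _ i1 i2) // (RintZ _ _ diff_ig) // (RintB _ xi0 (ig_cst_itv _ _ _ _ _)) //.
  by rewrite Rint_cst_itv //; ring.
rewrite lhs1 (hist_fubini h0 tr qH).
have -> : Rintegral mu I (fun xi => ((hist_integral eta x h).2 xi - h * eta.2 xi) * q.2 xi) =
    Rintegral mu I (fun xi => (hist_integral eta x h).2 xi * q.2 xi) -
    h * Rintegral mu I (fun xi => eta.2 xi * q.2 xi).
  have i3 : ig I (fun xi => (hist_integral eta x h).2 xi * q.2 xi) by exact: L2_mul.
  have i4 : ig I (fun xi => eta.2 xi * q.2 xi) by exact: L2_mul.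
  rewrite -RintZ // -RintB //; last exact: igZ.
  by apply: Rint_eq => xi _; ring.
by rewrite /Hinner /=; ring.
Qed.

(** In [adjA] the first component of [A z] is [r * z0], whereas X(h) - eta has first component
    [x h - eta.1]; the term with [p.1] is this discrepancy. What remains is the integral of the
    pairings of X(s) - eta with [q], each at most [e] times the norm of [q]. *)
Lemma increment_dual eta x dx p q h e : 0 <= h -> traj eta x dx h -> inH T p -> inH T q ->
  adjA T r p q -> (forall s, 0 <= s <= h -> Hnorm T (Hsub (hist x s) eta) <= e) ->
  `|Hinner T (Hsub (hist x h) eta) p - h * Hinner T eta q
    - p.1 * (x h - eta.1 - r * Rintegral mu `[0, h] x)| <= h * (e * Hnorm T q).
Proof.
move=> h0 tr pH qH adj eP; have eH := traj_inH tr.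
have zE : Hinner T (Hsub (hist x h) eta) p - h * Hinner T eta q
    - p.1 * (x h - eta.1 - r * Rintegral mu `[0, h] x)
    = Hinner T (hist_integral eta x h) q - h * Hinner T eta q.
  have := adj (Rintegral mu `[0, h] x) _ (hist_diff_L2 h0 tr).
  rewrite -/(hist_integral eta x h) => <-.
  by rewrite /Hinner /=; ring.
rewrite zE (hist_integral_Hinner h0 tr qH).
have -> : h * (e * Hnorm T q) = (e * Hnorm T q) * (h - 0) by ring.
apply: Rint_le_abs_cst => //.
  by apply: within_cont_ig; exact: Hinner_hist_cont h0 tr eH qH.
move=> s sI; have sH := traj_hist sI tr.
apply: (le_trans (cauchy_schwarz (inHB sH eH) qH)).
by rewrite ler_wpM2r ?Hnorm_ge0 // eP.
Qed.

End WeakForm.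

(** * Completeness of L^2 and the gliding hump *)

Section Completeness.
Variables (R : realType) (T : R).
Notation mu := (@lebesgue_measure R).
Notation I := (`[- T, 0]%classic : set R).
Notation emb f := ((0, f) : Hpt R).
Notation N f := (Hnorm T (emb f)).

Lemma int_sqr_norm f : L2 T f -> (\int[mu]_(x in I) (f x ^+ 2)%:E = (N f ^+ 2)%:E)%E.
Proof.
move=> fL; rewrite EFin_Rintegral //; last exact: L2_sqr.
by rewrite HnormE expr0n add0r.
Qed.

Lemma normB_triangle f g h : L2 T f -> L2 T g -> L2 T h ->
  N (fun t => f t - h t) <= N (fun t => f t - g t) + N (fun t => g t - h t).
Proof.
move=> fL gL hL; have a1 : inH T (emb (fun t => f t - g t)) by exact: L2B.
have a2 : inH T (emb (fun t => g t - h t)) by exact: L2B.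
apply: le_trans (Hnorm_triangle a1 a2); rewrite le_eqVlt; apply/orP; left; apply/eqP.
by apply: eq_Hnorm => [|t _] /=; ring.
Qed.

(** The limit first comes with the rate [2^-n] and an unspecified constant. The triangle inequality
    through a distant term [Z m] replaces this by the exact tail of the geometric series; its
    constant is what [gliding_hump] needs. *)
Lemma L2_complete (Z : nat -> R -> R) : (forall n, L2 T (Z n)) ->
  (forall k, N (fun t => Z k.+1 t - Z k t) <= 3 ^- k) ->
  exists2 z, L2 T z & forall n, N (fun t => z t - Z n t) <= 3 / 2 * 3 ^- n.
Proof.
move=> ZL Zf.
have ZB n m : L2 T (fun t => Z n t - Z m t) by exact: L2B.
have [z mz [c cP]] : exists2 z : R -> R, measurable_fun I z & exists c : R, forall n,
    (\int[mu]_(x in I) ((z x - Z n x) ^+ 2)%:E <= (c * 4 ^- n)%:E)%E.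
  have [|||z [mz zP]] := @fast_cauchy_limit _ (measurableTypeR R) R mu I Z.
  - exact: measurable_itv.
  - by move=> n; exact: L2_meas (ZL n).
  - move=> k; rewrite (int_sqr_norm (ZB k.+1 k)) lee_fin.
    have -> : (9 ^- k : R) = (3 ^- k) ^+ 2.
      by rewrite exprVn -exprM mulnC exprM; congr (_ ^+ _)^-1; ring.
    by rewrite ler_sqr ?nnegrE ?Hnorm_ge0 // invr_ge0 exprn_ge0.
  by exists z.
have zB n : L2 T (fun t => z t - Z n t).
  have m1 : measurable_fun I (fun t => z t - Z n t).
    by apply: measurable_funB => //; exact: L2_meas.
  split => //; apply: ig_ge0_finite => //.
  - by apply: measurable_funX.
  - by move=> t _; exact: sqr_ge0.
  - by apply: le_lt_trans (cP n) _; exact: ltry.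
have zL : L2 T z.
  by apply: (@eq_L2 _ _ (fun t => (z t - Z 0%N t) + Z 0%N t)); [move=> t _; ring|exact: L2D].
exists z => // n; apply/ler_addgt0Pr => e e0.
have c0 : 0 <= c.
  by have := le_trans (@integral_ge0 _ (measurableTypeR R) R mu I _ (fun x _ => _)) (cP 0%N);
     rewrite expr0 invr1 mulr1 lee_fin; apply => x; rewrite lee_fin sqr_ge0.
pose s : R := Num.sqrt c.
have zn m : N (fun t => z t - Z m t) <= s * 2 ^- m.
  rewrite -ler_sqr ?nnegrE ?Hnorm_ge0 ?mulr_ge0 ?sqrtr_ge0 ?invr_ge0 ?exprn_ge0 //.
  rewrite exprMn (sqr_sqrtr c0) -lee_fin -(int_sqr_norm (zB m)).
  have <- : (4 ^- m : R) = (2 ^- m) ^+ 2.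
    by rewrite exprVn -exprM mulnC exprM; congr (_ ^+ _)^-1; ring.
  exact: cP.
have tail m : (n <= m)%N -> N (fun t => Z m t - Z n t) <= 3 / 2 * (3 ^- n - 3 ^- m).
  move=> nm; rewrite -(subnKC nm); elim: (m - n)%N => [|j IH].
    rewrite addn0 subrr mulr0 (_ : N _ = 0) //.
    rewrite (@eq_Hnorm _ _ _ (Hscale 0 (emb (Z n)))) ?HnormZ ?normr0 ?mul0r //=.
    - exact: ZL.
    - by rewrite mul0r.
    - by move=> t _; rewrite subrr mul0r.
  have := normB_triangle (ZL (n + j).+1) (ZL (n + j)%N) (ZL n); rewrite addnS.
  have := Zf (n + j)%N.
  have -> : 3 ^- (n + j).+1 = 3 ^- (n + j) / 3 :> R by rewrite exprS invfM mulrC.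
  by lra.
have [m nm small] : exists2 m, (n <= m)%N & s * 2 ^- m < e.
  pose k := Num.bound (s / e); exists (maxn n k); first exact: leq_maxl.
  have s0 : 0 <= s / e by rewrite divr_ge0 ?sqrtr_ge0 // ltW.
  have k1 : s / e < k%:R by have := archi_boundP s0.
  have k2 : (k%:R : R) <= 2 ^+ maxn n k.
    rewrite -natrX ler_nat; apply: leq_trans (leq_maxr n k) _.
    exact/ltnW/ltn_expl.
  rewrite ltr_pdivrMr ?exprn_gt0 // mulrC -ltr_pdivrMr //.
  exact: lt_le_trans k1 k2.
have := normB_triangle zL (ZL m) (ZL n); have := zn m; have := tail m nm.
have : 0 <= 3 ^- m :> R by rewrite invr_ge0 exprn_ge0.
by lra.
Qed.

(** The vector [z] is a sum of terms of norm [3^-k] along the [q k]. The sign of the term [k] is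
    that of the pairing reached so far, so the pairing with [q k] becomes at least [3^-k * N (q k)];
    the later terms have total norm at most [3^-k / 2] and destroy at most half of it. *)
Lemma gliding_hump (q : nat -> R -> R) : (forall k, L2 T (q k)) ->
  (forall k, k.+1%:R * 3 ^+ k <= N (q k)) ->
  exists2 z, L2 T z & forall k, k.+1%:R / 2 <= `|Hinner T (emb (q k)) (emb z)|.
Proof.
move=> qL qk.
pose ip f g := Hinner T (emb f) (emb g).
pose sg (b : bool) : R := if b then 1 else -1.
pose w k f : R := sg (0 <= ip (q k) f) * (3 ^- k / N (q k)).
pose Z := fix Z n := if n is k.+1 then (fun t : R => Z k t + w k (Z k) * q k t) else (fun=> 0 : R).
have q0 k : 0 < N (q k).
  by apply: lt_le_trans (qk k); rewrite mulr_gt0 ?exprn_gt0.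
have ZL n : L2 T (Z n).
  by elim: n => [|k IH] /=; [exact: L2_cst|apply: L2D => //; exact: L2Z].
have w_abs k f : `|w k f| = 3 ^- k / N (q k).
  have p0 : 0 <= 3 ^- k / N (q k) by rewrite divr_ge0 ?Hnorm_ge0 ?invr_ge0 ?exprn_ge0.
  by rewrite normrM (ger0_norm p0) /sg; case: ifP => _; rewrite ?normrN normr1 mul1r.
have step k : N (fun t => Z k.+1 t - Z k t) <= 3 ^- k.
  rewrite (@eq_Hnorm _ _ _ (Hscale (w k (Z k)) (emb (q k)))) /=.
  - rewrite HnormZ; last exact: qL.
    by rewrite w_abs divfK // gt_eqF.
  - by rewrite mulr0.
  - by move=> t _; rewrite addrAC subrr add0r.
have [z zL zP] := L2_complete ZL step; exists z => // k.
have main : 3 ^- k * N (q k) <= `|ip (q k) (Z k.+1)|.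
  have -> : ip (q k) (Z k.+1) = ip (q k) (Z k) + w k (Z k) * N (q k) ^+ 2.
    have i1 : inH T (Hscale (w k (Z k)) (emb (q k))) by apply: inHZ; exact: qL.
    rewrite /ip HinnerC Hnorm_sqr -HinnerZl; [|exact: qL|exact: qL].
    rewrite (HinnerC _ (emb (q k)) (emb (Z k))) -HinnerDl //; [|exact: ZL|exact: qL].
    by congr Hinner; congr pair; rewrite /= mulr0 addr0.
  have -> : w k (Z k) * N (q k) ^+ 2 = sg (0 <= ip (q k) (Z k)) * (3 ^- k * N (q k)).
    by rewrite /w -!mulrA expr2 mulKf // gt_eqF.
  have p0 : 0 <= 3 ^- k * N (q k) by rewrite mulr_ge0 ?Hnorm_ge0 ?invr_ge0 ?exprn_ge0.
  rewrite /sg; case: ifP => [s0|/negbT]; last rewrite -ltNge => s0.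
    by rewrite mul1r (ger0_norm (addr_ge0 s0 p0)) lerDr.
  by rewrite mulN1r ler0_norm; lra.
have diff : `|ip (q k) z - ip (q k) (Z k.+1)| <= N (q k) * (3 ^- k / 2).
  rewrite /ip !(HinnerC _ (emb (q k))) -HinnerBl; [|exact: zL|exact: ZL|exact: qL].
  have i1 : inH T (Hsub (emb z) (emb (Z k.+1))) by apply: inHB; [exact: zL|exact: ZL].
  have i2 : inH T (emb (q k)) by exact: qL.
  apply: le_trans (cauchy_schwarz i1 i2) _.
  rewrite mulrC; apply: ler_wpM2l; first exact: Hnorm_ge0.
  rewrite /Hsub /= subrr; apply: le_trans (zP k.+1) _.
  by rewrite exprS invfM; lra.
have k3 : k.+1%:R <= 3 ^- k * N (q k).
  by rewrite mulrC ler_pdivlMr ?exprn_gt0.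
have := ler_normB (ip (q k) z) (ip (q k) z - ip (q k) (Z k.+1)).
by rewrite subKr; move: main diff k3; rewrite -/(ip _ _); lra.
Qed.

End Completeness.

(** * Local bounds and mean values for test functions *)

Section TestFunctions.
Variables (R : realType) (T r : R) (phi : Hpt R -> R) (grad Astar : Hpt R -> Hpt R).
Hypothesis tf : test_fun T r phi grad Astar.
Implicit Types (eta zeta : Hpt R).

Lemma grad_inH eta : inH T eta -> inH T (grad eta). Proof. by case: tf => + _ => /[apply][[]]. Qed.

Lemma Astar_inH eta : inH T eta -> inH T (Astar eta). Proof. by case: tf => + _ => /[apply][[]]. Qed.

Lemma phi_frechet eta (e : R) : inH T eta -> 0 < e -> exists2 d : R, 0 < d &
  forall zeta, inH T zeta -> Hnorm T zeta < d ->
    `|phi (Hadd eta zeta) - phi eta - Hinner T (grad eta) zeta| <= e * Hnorm T zeta.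
Proof. by case: tf => _ [h _] eH e0; have [d d0 dP] := h eta eH e e0; exists d. Qed.

Lemma grad_cont eta (e : R) : inH T eta -> 0 < e -> exists2 d : R, 0 < d &
  forall eta', inH T eta' -> Hnorm T (Hsub eta' eta) < d ->
    Hnorm T (Hsub (grad eta') (grad eta)) < e.
Proof. by case: tf => _ [_ [h _]] eH e0; have [d d0 dP] := h eta eH e e0; exists d. Qed.

Lemma grad_adj eta : inH T eta -> adjA T r (grad eta) (Astar eta).
Proof. by case: tf => _ [_ [_ [h _]]]; exact: h. Qed.

Lemma Astar_weak_cvg eta (u : nat -> Hpt R) zeta : inH T eta -> (forall n, inH T (u n)) ->
  (forall n, Hnorm T (Hsub (u n) eta) < n.+1%:R^-1) -> inH T zeta ->
  (fun n => Hinner T (Astar (u n)) zeta) @ \oo --> Hinner T (Astar eta) zeta.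
Proof.
case: tf => _ [_ [_ [_ w]]] eH uH un zH; apply: w => //.
apply: (squeeze_cvgr _ (cvg_cst 0) (@cvg_harmonic R)).
by apply: nearW => n; rewrite Hnorm_ge0 ltW.
Qed.

Lemma Astar_weak_cont eta zeta (e : R) : inH T eta -> inH T zeta -> 0 < e ->
  exists2 d : R, 0 < d & forall eta', inH T eta' -> Hnorm T (Hsub eta' eta) < d ->
    `|Hinner T (Astar eta') zeta - Hinner T (Astar eta) zeta| < e.
Proof.
move=> eH zH e0; apply: contrapT => no.
have P n : exists u, [/\ inH T u, Hnorm T (Hsub u eta) < n.+1%:R^-1 &
    e <= `|Hinner T (Astar u) zeta - Hinner T (Astar eta) zeta|].
  apply: contrapT => no'; apply: no; exists n.+1%:R^-1; first by rewrite invr_gt0.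
  by move=> u h1 h2; rewrite ltNge; apply/negP => h3; apply: no'; exists u.
have [u uP] := choice P.
have /cvgrPdist_lt /(_ e e0) [N _ /(_ N (leqnn N))] /= :=
  @Astar_weak_cvg eta u zeta eH (fun n => let: And3 h _ _ := uP n in h)
    (fun n => let: And3 _ h _ := uP n in h) zH.
by rewrite distrC; case: (uP N) => _ _; lra.
Qed.

(** Otherwise some sequence tending to [eta] has images of norm at least [(n + 1) 3^n], and the hump
    vector gives unbounded pairings, against weak convergence. The hump concerns the L^2 component
    only; the scalar one is controlled by testing against [(1, 0)]. *)
Lemma Astar_bounded eta : inH T eta -> exists d K : R, 0 < d /\
  forall eta', inH T eta' -> Hnorm T (Hsub eta' eta) < d -> Hnorm T (Astar eta') <= K.
Proof.
move=> eH; have [d1 d10 h1] := Astar_weak_cont eH (L2_cst T 0 : inH T (1, fun=> 0)) ltr01.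
have ip1 zeta : Hinner T zeta (1, fun=> 0) = zeta.1.
  rewrite /Hinner /= (@Rint_eq _ _ _ (fun=> 0 : R)).
    by rewrite mulr1 /Rintegral integral0 addr0.
  by move=> t _; rewrite mulr0.
have [[d [K [d0 dK]]]|no] := pselect (exists d K : R, 0 < d /\
    forall eta', inH T eta' -> Hnorm T (Hsub eta' eta) < d ->
      Hnorm T ((0, (Astar eta').2) : Hpt R) <= K).
  exists (Num.min d d1), (`|(Astar eta).1| + 1 + K); split; first by rewrite lt_min d0.
  move=> eta' eH'; rewrite lt_min => /andP[/(dK _ eH') k1 /(h1 _ eH')]; rewrite !ip1 => k2.
  have e1 : Astar eta' = Hadd (Hscale (Astar eta').1 (1, fun=> 0)) (0, (Astar eta').2).
    by apply/pair_eqP; rewrite /= mulr1 addr0 eqxx /=; apply/eqP/funext => t /=; rewrite mulr0 add0r.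
  have i1 : inH T ((1, fun=> 0) : Hpt R) := L2_cst T 0.
  have i2 : inH T ((0, (Astar eta').2) : Hpt R) by exact: Astar_inH eH'.
  have := Hnorm_triangle (inHZ (Astar eta').1 i1) i2; rewrite -e1 => /le_trans; apply.
  apply: lerD => //; rewrite HnormZ //.
  have -> : Hnorm T ((1, fun=> 0) : Hpt R) = 1 by rewrite /Hnorm ip1 sqrtr1.
  rewrite mulr1; have := ler_normD ((Astar eta').1 - (Astar eta).1) (Astar eta).1.
  by rewrite subrK; lra.
have P n : exists u, [/\ inH T u, Hnorm T (Hsub u eta) < n.+1%:R^-1 &
    n.+1%:R * 3 ^+ n <= Hnorm T ((0, (Astar u).2) : Hpt R)].
  apply: contrapT => no'; apply: no; exists n.+1%:R^-1, (n.+1%:R * 3 ^+ n).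
  split; first by rewrite invr_gt0.
  by move=> u k1 k2; rewrite leNgt; apply/negP => k3; apply: no'; exists u; split => //; exact: ltW.
have [u uP] := choice P.
have qL n : L2 T (Astar (u n)).2 by apply: Astar_inH; case: (uP n).
have qN n : n.+1%:R * 3 ^+ n <= Hnorm T ((0, (Astar (u n)).2) : Hpt R) by case: (uP n).
have [z zL zP] := gliding_hump qL qN.
have zH : inH T ((0, z) : Hpt R) by [].
have /cvgrPdist_lt /(_ 1 ltr01) [N _ NP] :=
  @Astar_weak_cvg eta u (0, z) eH (fun n => let: And3 h _ _ := uP n in h)
    (fun n => let: And3 _ h _ := uP n in h) zH.
set L := Hinner T (Astar eta) _ in NP.
pose k := Num.bound (2 * (`|L| + 1)).
have kb : 2 * (`|L| + 1) < k%:R.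
  have k0 : 0 <= 2 * (`|L| + 1) by rewrite mulr_ge0 // addr_ge0.
  by have := archi_boundP k0.
have := NP (maxn N k) (leq_maxl _ _); have := zP (maxn N k).
have -> : Hinner T (0, (Astar (u (maxn N k))).2) (0, z) = Hinner T (Astar (u (maxn N k))) (0, z).
  by rewrite /Hinner /= mul0r mulr0.
have kk : (k%:R : R) <= (maxn N k).+1%:R.
  by rewrite ler_nat; apply: leq_trans (leq_maxr N k) _.
rewrite /= distrC; set y := Hinner _ _ _; have := ler_normD (y - L) L.
by rewrite subrK; move: kk kb; rewrite -natr1; lra.
Qed.

Lemma mvt_segment eta zeta : inH T eta -> inH T zeta ->
  exists2 th : R, 0 <= th <= 1 &
    phi (Hadd eta zeta) - phi eta = Hinner T (grad (Hadd eta (Hscale th zeta))) zeta.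
Proof.
move=> eH zH.
pose pt th := Hadd eta (Hscale th zeta).
have ptH th : inH T (pt th) by apply: inHD => //; exact: inHZ.
pose psi th := phi (pt th).
have dq (t : R) : (fun h : R => h^-1 *: ((psi \o shift t) (h *: 1) - psi t)) @ 0^' -->
    Hinner T (grad (pt t)) zeta.
  apply/cvgrPdist_le => e e0.
  have n1 : 0 < Hnorm T zeta + 1 by rewrite ltr_wpDl ?Hnorm_ge0.
  have [d d0 dP] := phi_frechet (ptH t) (divr_gt0 e0 n1).
  have dn : 0 < d / (Hnorm T zeta + 1) by rewrite divr_gt0.
  near=> h.
  have h0 : h != 0 by near: h; exact: nbhs_dnbhs_neq.
  have hd : `|h| < d / (Hnorm T zeta + 1) by near: h; exact: dnbhs0_lt.
  have hn : 0 < `|h| by rewrite normr_gt0.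
  have := dP _ (inHZ h zH); rewrite HnormZ // HinnerC HinnerZl //; last exact: grad_inH.
  have -> : Hadd (pt t) (Hscale h zeta) = pt (h + t).
    by congr pair; [|apply/funext => u]; rewrite /=; ring.
  move: hd; rewrite ltr_pdivlMr // => hd.
  have hz : `|h| * Hnorm T zeta < d by lra.
  move=> /(_ hz); rewrite (HinnerC _ zeta).
  have -> : (psi \o shift t) (h *: 1) = psi (h + t) by rewrite /= /GRing.scale /= mulr1.
  rewrite -/(psi _) -/(psi _).
  set L := Hinner _ _ _; set D := psi _ - psi _ => k.
  rewrite /GRing.scale /=.
  have -> : L - h^-1 * D = - (h^-1 * (D - h * L)) by field.
  rewrite normrN normrM normfV ler_pdivrMl //; apply: le_trans k _.
  rewrite mulrCA; apply: ler_wpM2l; first exact: normr_ge0.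
  rewrite mulrAC ler_pdivrMr //; apply: ler_wpM2l; [exact: ltW|lra].
have der (t : R) : is_derive t (1 : R) psi (Hinner T (grad (pt t)) zeta).
  apply: DeriveDef; last by apply: cvg_lim => //; exact: dq.
  by apply/cvg_ex; eexists; exact: dq.
have pcont : {within `[(0 : R), 1], continuous psi}.
  by apply: derivable_within_continuous => t _; case: (der t).
have [c cI] := MVT_segment ler01 (fun t _ => der t) pcont.
rewrite subr0 mulr1 => cE; exists c; first by move: cI; rewrite in_itv.
have e1 : pt 1 = Hadd eta zeta.
  by congr pair; [|apply/funext => u]; rewrite /= mul1r.
have e0 : pt 0 = eta.
  rewrite /pt; case: (eta) => e1' e2; congr pair; [|apply/funext => u]; rewrite /= mul0r addr0 //.
by move: cE; rewrite /psi e1 e0.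
Unshelve. all: by end_near.
Qed.
End TestFunctions.

(** * The increment of a test function along a path *)

Section Increment.
Variables (R : realType) (M : model R).
Notation mu := (@lebesgue_measure R).
Notation T := (delay M).
Notation r := (rate M).
Notation traj := (traj M).
Implicit Types (x dx c : R -> R) (eta zeta : Hpt R) (h s t : R).
Variables (phi : Hpt R -> R) (grad Astar : Hpt R -> Hpt R).
Hypothesis tf : test_fun T r phi grad Astar.

(** The gradient is taken at the intermediate point [pt] of the mean value theorem, whence a slope
    [p] close to, but different from, that at [eta]. Weak continuity handles the pairing of
    [Astar pt] with the fixed vector [eta]; local boundedness handles its pairings with X(s) -
    eta. *)
Lemma phi_increment eta (e : R) : inH T eta -> 0 < e -> exists2 d : R, 0 < d &
  forall x dx h, 0 <= h -> traj eta x dx h ->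
    (forall s, 0 <= s <= h -> Hnorm T (Hsub (hist x s) eta) <= d) ->
    exists2 p : R, `|p - (grad eta).1| <= e &
      `|phi (hist x h) - phi eta - h * Hinner T eta (Astar eta)
        - p * (x h - eta.1 - r * Rintegral mu `[0, h] x)| <= e * h.
Proof.
move=> eH e0; have e2 : 0 < e / 2 by rewrite divr_gt0.
have [d1 [K [d10 KP]]] := Astar_bounded tf eH.
have [d2 d20 wP] := Astar_weak_cont tf eH eH e2.
have [d3 d30 gP] := grad_cont tf eH e0.
pose K' := `|K| + 1; have K0 : 0 < K' by rewrite ltr_wpDl.
(* The last entry makes [d * K' <= e / 2], where [K'] bounds the norm of [Astar pt]; the halves in
   the other entries turn weak inequalities into the strict ones needed. *)
pose d := Num.min (Num.min (d1 / 2) (d2 / 2)) (Num.min (d3 / 2) (e / (2 * K'))).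
have d0 : 0 < d by rewrite !lt_min !divr_gt0 ?mulr_gt0.
have [dd1 dd2 dd3 dd4] : [/\ d < d1, d < d2, d < d3 & d <= e / (2 * K')].
  split; last by rewrite !ge_min lexx !orbT.
  - by apply: (@le_lt_trans _ _ (d1 / 2)); [rewrite !ge_min lexx|lra].
  - by apply: (@le_lt_trans _ _ (d2 / 2)); [rewrite !ge_min lexx !orbT|lra].
  - by apply: (@le_lt_trans _ _ (d3 / 2)); [rewrite !ge_min lexx !orbT|lra].
exists d => // x dx h h0 tr near.
have hI : 0 <= h <= h by rewrite h0 lexx.
have xH := traj_hist hI tr; have DH := inHB xH eH.
have [th th1 thE] := mvt_segment tf eH DH.
set D := Hsub (hist x h) eta in DH th thE th1.
set pt := Hadd eta (Hscale th D) in thE.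
have ptH : inH T pt by apply: inHD => //; exact: inHZ.
have ptn : Hnorm T (Hsub pt eta) <= d.
  have -> : Hsub pt eta = Hscale th D.
    by congr pair; [|apply/funext => u]; rewrite /=; ring.
  rewrite HnormZ // ger0_norm; last by case/andP: th1.
  apply: le_trans (near h hI); rewrite -/D; have := Hnorm_ge0 T D; have := th1; nra.
have ApH := Astar_inH tf ptH.
have adj := grad_adj tf ptH.
have inc := increment_dual h0 tr (grad_inH tf ptH) ApH adj near.
exists (grad pt).1.
  have := Hnorm_fst T (Hsub (grad pt) (grad eta)); have := gP _ ptH (le_lt_trans ptn dd3).
  by rewrite /=; lra.
have An := KP _ ptH (le_lt_trans ptn dd1).
have w := wP _ ptH (le_lt_trans ptn dd2).
have Dpt : phi (hist x h) - phi eta = Hinner T D (grad pt).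
  rewrite HinnerC -thE; congr (phi _ - _).
  by rewrite /D; case: (eta) => u v; congr pair; [|apply/funext => t]; rewrite /=; ring.
rewrite Dpt.
have dK : d * Hnorm T (Astar pt) <= e / 2.
  have -> : e / 2 = e / (2 * K') * K' by field; rewrite gt_eqF.
  have AK : Hnorm T (Astar pt) <= K' by apply: le_trans An _; have := ler_norm K; rewrite /K'; lra.
  apply: ler_pM => //; [exact: ltW|exact: Hnorm_ge0].
move: inc; rewrite -/D (HinnerC _ eta (Astar pt)) (HinnerC _ eta (Astar eta)).
move: w dK; set A := Hinner T (Astar pt) eta; set B := Hinner T (Astar eta) eta.
set G := Hinner T D _; set Q := (grad pt).1 * _ => w dK inc.
have -> : G - h * B - Q = (G - h * A - Q) + h * (A - B) by ring.
apply: le_trans (ler_normD _ _) _; rewrite normrM (ger0_norm h0).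
have k1 : h * `|A - B| <= h * (e / 2) by apply: ler_wpM2l => //; exact: ltW.
have k2 : h * (d * Hnorm T (Astar pt)) <= h * (e / 2) by apply: ler_wpM2l.
have -> : e * h = h * (e / 2) + h * (e / 2) by field.
by apply: lerD => //; apply: le_trans inc k2.
Qed.

End Increment.

(** * First-order expansion along paths near their starting point *)

Section LocalExpansion.
Variables (R : realType) (M : model R).
Notation mu := (@lebesgue_measure R).
Notation T := (delay M).
Notation r := (rate M).
Notation C := (lipc M).
Notation a := (memory M).
Notation f0 := (income M).
Notation U2 := (util2 M).
Notation I := (`[- T, 0]%classic : set R).
Notation traj := (traj M).
Notation delayed := (delayed_term M).
Notation consume := (consumption M).
Implicit Types (x dx c : R -> R) (eta zeta : Hpt R) (h s t : R).

Lemma Hnorm_sup_le eta (k : R) : inH T eta -> `|eta.1| <= k ->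
  (forall t, - T <= t <= 0 -> `|eta.2 t| <= k) -> Hnorm T eta <= k * (1 + T).
Proof.
move=> eH e1 e2; have T0 := ltW (delay_gt0 M); have k0 : 0 <= k := le_trans (normr_ge0 _) e1.
rewrite -ler_sqr ?nnegrE ?Hnorm_ge0 ?mulr_ge0 ?addr_ge0 // HnormE.
have sq (y : R) : `|y| <= k -> y ^+ 2 <= k ^+ 2.
  by move=> yk; rewrite -[y ^+ 2]real_normK ?num_real // ler_sqr ?nnegrE.
have i1 : Rintegral mu I (fun t => eta.2 t ^+ 2) <= k ^+ 2 * (0 - - T).
  rewrite -Rint_cst_itv; last by rewrite oppr_le0.
  apply: Rint_le => //; [exact: L2_sqr|exact: ig_cst_itv|].
  by move=> t /=; rewrite in_itv /= => /e2 /sq.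
rewrite sub0r opprK in i1; rewrite exprMn.
have -> : k ^+ 2 * (1 + T) ^+ 2 = k ^+ 2 + (k ^+ 2 * T + (k ^+ 2 * T + k ^+ 2 * T ^+ 2)) by ring.
have kT : 0 <= k ^+ 2 * T by rewrite mulr_ge0 ?sqr_ge0.
apply: lerD; first exact: sq.
apply: le_trans i1 _; rewrite lerDl addr_ge0 // mulr_ge0 ?sqr_ge0 //.
Qed.

Lemma Hnorm_hist0 eta x dx h zeta : 0 <= h -> traj eta x dx h ->
  Hnorm T (Hsub zeta (hist x 0)) = Hnorm T (Hsub zeta eta).
Proof.
move=> h0 tr; rewrite /Hnorm /Hinner /= (traj0 h0 tr); congr (Num.sqrt (_ + _)).
apply: Rint_eq_co => [|t tI]; first by rewrite oppr_le0 ltW // delay_gt0.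
by case: tr => _ x1 _ _; rewrite add0r x1.
Qed.

Lemma traj_ray eta (b : R) h : inH T eta -> 0 <= h ->
  traj eta (fun t => if t < 0 then eta.2 t else eta.1 + b * t) (fun=> b) h.
Proof.
move=> eH h0; split => //.
- by move=> t /andP[_ t0]; rewrite t0.
- exact: ig_cst_itv.
- move=> t /andP[t0 _]; rewrite ltNge t0 /= Rint_cst_itv // subr0 //.
Qed.

(** Every path is compared with the one that stays at [eta.1] after time 0. The modulus of
    continuity of that single path depends on [eta] only, so [k] is uniform in [x]; the difference
    of the two paths vanishes at negative times. *)
Lemma hist_close eta (e : R) : inH T eta -> 0 < e -> exists2 k : R, 0 < k &
  forall x dx h, h <= k -> traj eta x dx h -> (forall s, 0 <= s <= h -> `|x s - eta.1| <= k) ->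
  forall s, 0 <= s <= h -> Hnorm T (Hsub (hist x s) eta) < e.
Proof.
move=> eH e0; have T0 := delay_gt0 M; have e2 : 0 < e / 2 by rewrite divr_gt0.
have g1 := traj_ray 0 eH (ler01 : 0 <= 1 :> R); move: g1; set g := (X in traj eta X) => gt.
have [d d0 dP] := traj_hist_cont ler01 gt e2.
have k1 : 0 < e / (2 * (1 + T)) by rewrite divr_gt0 // mulr_gt0 // addr_gt0.
exists (Num.min (Num.min (d / 2) 1) (e / (2 * (1 + T)))).
  by rewrite !lt_min divr_gt0 ?ltr01.
move=> x dx h; rewrite !le_min => /andP[/andP[hd h1] _] tr near s sI.
have sI1 : 0 <= s <= 1 by lra.
have h0 : 0 <= h by lra.
have H1 := traj_hist sI tr; have H2 := traj_hist sI1 gt.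
have H3 : inH T (hist g 0) by apply: traj_hist gt; rewrite lexx ler01.
have n1 : Hnorm T (Hsub (hist g s) eta) < e / 2.
  rewrite -(Hnorm_hist0 _ ler01 gt); apply: dP; rewrite ?in_itv /= ?lexx ?ler01 //.
  by rewrite subr0 ger0_norm; lra.
have cl (u : R) : - T <= u <= s -> `|x u - g u| <= e / (2 * (1 + T)).
  move=> uI; rewrite /g; case: ifP => [u0|/negbT].
    case: tr => _ x1 _ _; rewrite x1; last by case/andP: uI => ->.
    by rewrite subrr normr0; exact: ltW.
  rewrite -leNgt => u0; rewrite mul0r addr0.
  have uI' : 0 <= u <= h by lra.
  by have := near u uI'; rewrite !le_min => /andP[].
have n2 : Hnorm T (Hsub (hist x s) (hist g s)) <= e / 2.
  have -> : e / 2 = e / (2 * (1 + T)) * (1 + T) by field; lra.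
  apply: Hnorm_sup_le => [||t tI] /=; first exact: inHB.
    by apply: cl; lra.
  by apply: cl; lra.
have -> : Hsub (hist x s) eta = Hadd (Hsub (hist x s) (hist g s)) (Hsub (hist g s) eta).
  by congr pair; [|apply/funext => u]; rewrite /=; ring.
by apply: le_lt_trans (Hnorm_triangle (inHB H1 H2) (inHB H2 eH)) _; lra.
Qed.

Lemma income_close eta (e : R) : inH T eta -> 0 < e -> exists2 k : R, 0 < k &
  forall x dx h, h <= k -> traj eta x dx h -> (forall s, 0 <= s <= h -> `|x s - eta.1| <= k) ->
  forall s, 0 <= s <= h -> `|f0 (x s) (delayed x s) - fH T a f0 eta| <= e.
Proof.
move=> eH e0; have C0 := lipc_ge0 M; have N0 := Hnorm_ge0 T ((0, a) : Hpt R).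
pose q := (C + 1) * (1 + Hnorm T ((0, a) : Hpt R)).
have q0 : 0 < q by rewrite mulr_gt0 //; lra.
have eq0 : 0 < e / q by rewrite divr_gt0.
have [k k0 kP] := hist_close eH eq0; exists k => // x dx h hk tr near s sI.
have n := kP x dx h hk tr near s sI; have sH := traj_hist sI tr.
have l := delayed_lip sH eH; have l1 := Hnorm_fst T (Hsub (hist x s) eta).
apply: le_trans (f0_lipschitz M _ _ _ _) _.
rewrite /= -/(delayed x s) in l; rewrite /= in l1.
move: n; rewrite ltr_pdivlMr //; move: l l1 (Hnorm_ge0 T (Hsub (hist x s) eta)).
rewrite /q; set N := Hnorm T (Hsub _ _); set A := Hnorm T _ in N0 *; set D := `|delayed x s - _|.
set X := `|_ - _| => l l1 n0 nq.
have : C * (X + D) <= C * (N * (1 + A)) by apply: ler_wpM2l => //; lra.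
have : 0 <= N * (1 + A) by apply: mulr_ge0 => //; lra.
lra.
Qed.

Lemma net_increment eta x dx h : 0 <= h -> traj eta x dx h ->
  x h - eta.1 - r * Rintegral mu `[0, h] x =
  Rintegral mu `[0, h] (fun s => f0 (x s) (delayed x s)) - Rintegral mu `[0, h] (consume x dx).
Proof.
move=> h0 tr; have ci := consume_ig h0 tr; have xc := traj_cont h0 tr.
have fi := within_cont_ig (@f0_within_cont _ M _ _ _ xc (delayed_cont h0 tr)).
have xi := within_cont_ig xc.
have xh : x h = eta.1 + Rintegral mu `[0, h] dx by case: tr => _ _ _; apply; rewrite h0 lexx.
have e : Rintegral mu `[0, h] dx = Rintegral mu `[0, h]
    (fun s => (r * x s + f0 (x s) (delayed x s)) - consume x dx s).
  by apply: Rint_eq => s _; exact: dxE.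
have ri : ig `[0, h] (fun s => r * x s) by exact: igZ.
have rf : ig `[0, h] (fun s => r * x s + f0 (x s) (delayed x s)) by exact: igD.
have e1 : Rintegral mu `[0, h] dx = r * Rintegral mu `[0, h] x +
    Rintegral mu `[0, h] (fun s => f0 (x s) (delayed x s)) - Rintegral mu `[0, h] (consume x dx).
  by rewrite e -RintZ // -RintD // -RintB.
by rewrite xh e1; ring.
Qed.

Variables (phi : Hpt R -> R) (grad Astar : Hpt R -> Hpt R).
Hypothesis tf : test_fun T r phi grad Astar.

(** The error is proportional to [h] plus the total consumption, since the deviation of the slope
    multiplies the latter and the consumption rate has no bound. *)
Lemma local_expansion eta (e : R) : inH T eta -> 0 < eta.1 -> 0 < e -> exists2 k : R, 0 < k &
  forall x dx h, 0 <= h <= k -> admissible_upto M eta x dx h ->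
    (forall s, 0 <= s <= h -> `|x s - eta.1| <= k) ->
  [/\ Hnorm T (Hsub (hist x h) eta) < e,
      forall s, 0 <= s <= h -> `|U2 (x s) - U2 eta.1| <= e &
      `|phi (hist x h) - phi eta - h * (Hinner T eta (Astar eta) + fH T a f0 eta * (grad eta).1)
        + (grad eta).1 * Rintegral mu `[0, h] (consume x dx)|
      <= e * (h + Rintegral mu `[0, h] (consume x dx))].
Proof.
move=> eH e1 e0; set F := fH T a f0 eta; set p := (grad eta).1.
(* [m] bounds the errors in the increment of [phi], in the slope and in the income. Together they
   cost at most [m (1 + |p| + m + |F|)] per unit of time and [m] per unit of consumption. *)
pose m := e / (3 * (1 + `|F| + `|p| + e)).
have den : 0 < 1 + `|F| + `|p| + e by have := normr_ge0 F; have := normr_ge0 p; lra.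
have m0 : 0 < m by rewrite divr_gt0 // mulr_gt0.
have mE : 3 * (m * (1 + `|F| + `|p| + e)) = e by rewrite /m; field; rewrite gt_eqF.
have [d d0 dP] := phi_increment tf eH m0.
have [k1 k10 P1] := hist_close eH d0; have [k2 k20 P2] := hist_close eH e0.
have [k3 k30 P3] := income_close eH m0.
have [k4 k40 P4] : exists2 k : R, 0 < k & forall y, `|y - eta.1| <= k -> 0 < y -> `|U2 y - U2 eta.1| <= e.
  have /within_contP c2 := @util2_cont _ M.
  have etaI : `]0%R, +oo[%classic eta.1 by rewrite /= in_itv /= andbT.
  have [k4 k40 P4] := c2 _ etaI e e0; exists (k4 / 2) => [|y yk y0]; first by rewrite divr_gt0.
  have yI : `]0%R, +oo[%classic y by rewrite /= in_itv /= andbT.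
  by rewrite distrC ltW //; apply: P4 => //; rewrite distrC; lra.
exists (Num.min (Num.min k1 k2) (Num.min k3 k4)) => [|x dx h]; first by rewrite !lt_min k10 k20 k30.
rewrite !le_min => /andP[h0 /andP[/andP[h1 h2] /andP[h3 h4]]] [tr pos] near.
have near1 s : 0 <= s <= h -> [/\ `|x s - eta.1| <= k1, `|x s - eta.1| <= k2,
    `|x s - eta.1| <= k3 & `|x s - eta.1| <= k4].
  by move=> /near; rewrite !le_min => /andP[/andP[? ?] /andP[? ?]]; split.
have hh : 0 <= h <= h by rewrite h0 lexx.
split.
- by apply: (P2 x dx h h2 tr) => // s /near1[].
- by move=> s sI; apply: P4; [case: (near1 s sI)|case: (pos s sI)].
have [s sI|q qp qi] := dP x dx h h0 tr.
  by apply/ltW; apply: (P1 x dx h h1 tr) => // t /near1[].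
move: qi; rewrite (net_increment h0 tr); set c := Rintegral mu _ (consume x dx).
set f := Rintegral mu _ _; set E := Hinner _ _ _; set dphi := phi _ - phi _ => qi.
have fi := within_cont_ig (@f0_within_cont _ M _ _ _ (traj_cont h0 tr) (delayed_cont h0 tr)).
have fF : `|f - h * F| <= m * h.
  have -> : h * F = Rintegral mu `[0, h] (fun=> F) by rewrite Rint_cst_itv // subr0 mulrC.
  rewrite -RintB //; last exact: ig_cst_itv.
  rewrite -{2}[h]subr0; apply: Rint_le_abs_cst => //; first by apply: igB => //; exact: ig_cst_itv.
  by move=> s sI; apply: (P3 x dx h h3 tr) => // t /near1[].
have c0 : 0 <= c by apply: Rint_ge0 => s; rewrite /= in_itv /= => /pos[].
have -> : dphi - h * (E + F * p) + p * c =
  (dphi - h * E - q * (f - c)) + q * (f - h * F) + h * F * (q - p) - (q - p) * c by ring.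
have qn : `|q| <= `|p| + m by have := ler_normD (q - p) p; rewrite subrK; lra.
have t1 : `|q * (f - h * F)| <= (`|p| + m) * (m * h) by rewrite normrM; apply: ler_pM.
have t2 : `|h * F * (q - p)| <= h * `|F| * m.
  by rewrite !normrM (ger0_norm h0); apply: ler_wpM2l => //; rewrite mulr_ge0.
have t3 : `|(q - p) * c| <= m * c by rewrite normrM (ger0_norm c0); apply: ler_wpM2r.
apply: le_trans (ler_normB _ _) _; apply: le_trans (lerD (ler_normD _ _) (lexx _)) _.
apply: le_trans (lerD (lerD (ler_normD _ _) (lexx _)) (lexx _)) _.
clearbody f E dphi c.
have me : m <= e / 3 by rewrite -mE; have := normr_ge0 F; have := normr_ge0 p; clear -m0 e0; nra.
have b1 : (m + (`|p| + m) * m + `|F| * m) * h <= e * h.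
  apply: ler_wpM2r => //; rewrite -[leRHS]mE; have := normr_ge0 F; have := normr_ge0 p; clear -m0 e0 me; nra.
have b2 : m * c <= e * c by apply: ler_wpM2r => //; clear -me e0; lra.
by clear -qi t1 t2 t3 b1 b2; lra.
Qed.

End LocalExpansion.

(** * The viscosity inequalities *)

Lemma le_vanishing_slack (R : realType) (A B S k : R) : 0 < k ->
  (forall h : R, 0 < h <= k -> A <= B + h * S) -> A <= B.
Proof.
move=> k0 H; apply/ler_addgt0Pr => e e0.
have S1 : 0 < `|S| + 1 by rewrite ltr_wpDl.
pose h := Num.min k (e / (`|S| + 1)).
have hI : 0 < h <= k by rewrite /h lt_min k0 divr_gt0 //= ge_min lexx.
apply: le_trans (H h hI) _; rewrite lerD2l.
have he : h * (`|S| + 1) <= e by rewrite -ler_pdivlMr // /h ge_min lexx orbT.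
case/andP: hI => h0 _; have := ler_norm S; nra.
Qed.

Lemma expRN_bounds (R : realType) (y : R) : 0 <= y ->
  [/\ 1 - y <= expR (- y), expR (- y) <= 1 & expR (- y) <= 1 - y + y ^+ 2].
Proof.
move=> y0; have y1 : 0 < 1 + y by lra.
split; [exact: expR_ge1Dx|by rewrite -expR0 ler_expR oppr_le0|].
have -> : expR (- y) = (expR y)^-1 by rewrite expRN.
apply: (@le_trans _ _ (1 + y)^-1).
  by rewrite lef_pV2 ?posrE ?expR_gt0 // expR_ge1Dx.
rewrite -[leLHS]mul1r ler_pdivrMr //.
have -> : (1 - y + y ^+ 2) * (1 + y) = 1 + y ^+ 3 by ring.
by rewrite lerDl exprn_ge0.
Qed.

(** Dynamic programming divided by [h], with [g] the running gain, [w] the value at the start and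
    [d] a lower bound for its increment. The remainder of the expansion of e^(-bh) is kept explicit,
    so that [le_vanishing_slack] can remove it. *)
Lemma discounted_limit (R : realType) (h b w g m d G : R) : 0 < h -> 0 <= b ->
  g + expR (- (b * h)) * (w + d) <= w -> h * (m - b * h * `|m|) <= g -> h * G <= d ->
  m + G <= b * w + h * (b * `|m| + b * `|G| + b ^+ 2 * `|w|).
Proof.
move=> h0 b0; have y0 : 0 <= b * h by rewrite mulr_ge0 // ltW.
have [q1 q2 q3] := expRN_bounds y0; move: q1 q2 q3; set q := expR _ => q1 q2 q3 H mg Gd.
have q0 : 0 <= q by exact: expR_ge0.
have k1 : h * G - h * (b * h * `|G|) <= q * d.
  have : q * (h * G) <= q * d by exact: ler_wpM2l.
  have : (1 - q) * `|h * G| <= b * h * `|h * G| by apply: ler_wpM2r => //; lra.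
  have : (1 - q) * (h * G) <= (1 - q) * `|h * G|.
    by apply: ler_wpM2l; [lra|exact: ler_norm].
  by rewrite normrM (gtr0_norm h0); lra.
have k2 : (1 - q) * w <= b * h * w + (b * h) ^+ 2 * `|w|.
  have : (b * h - (1 - q)) * (- w) <= (b * h - (1 - q)) * `|w|.
    by apply: ler_wpM2l; [lra|rewrite -normrN; exact: ler_norm].
  have : (b * h - (1 - q)) * `|w| <= (b * h) ^+ 2 * `|w| by apply: ler_wpM2r => //; lra.
  by lra.
rewrite -(ler_pM2l h0); move: H mg k1 k2; rewrite exprMn; lra.
Qed.

Lemma discounted_ge (R : realType) (b s h y : R) : 0 <= b -> 0 <= s <= h ->
  y - b * h * `|y| <= expR (- (b * s)) * y.
Proof.
move=> b0 /andP[s0 sh]; have y0 : 0 <= b * s by rewrite mulr_ge0.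
have [q1 q2 _] := expRN_bounds y0; have sb : b * s <= b * h by apply: ler_wpM2l.
have : (1 - expR (- (b * s))) * y <= (1 - expR (- (b * s))) * `|y|.
  by apply: ler_wpM2l; [lra|exact: ler_norm].
have : (1 - expR (- (b * s))) * `|y| <= b * h * `|y| by apply: ler_wpM2r => //; lra.
lra.
Qed.

(** * The supersolution inequality *)

Section Supersolution.
Variables (R : realType) (M : model R).
Notation mu := (@lebesgue_measure R).
Notation T := (delay M).
Notation r := (rate M).
Notation rho := (discount M).
Notation a := (memory M).
Notation f0 := (income M).
Notation U1 := (util1 M).
Notation U2 := (util2 M).
Notation delayed := (delayed_term M).
Notation consume := (consumption M).
Notation DVM := (DV T r rho a f0 U1 U2).
Notation VM := (Vfun T r rho a f0 U1 U2).
Implicit Types (x dx c : R -> R) (eta zeta : Hpt R) (h s t : R).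

Variables (phi : Hpt R -> R) (grad Astar : Hpt R -> Hpt R).
Hypothesis tf : test_fun T r phi grad Astar.

(** A fixed rate [c0] is realised only approximately: on a path with constant derivative the
    recovered consumption lies in [[c0, c0 + 2 e]], and [e] is sent to 0 after [h]. *)
Lemma super_bound eta (c0 del : R) : DVM eta -> 0 <= c0 -> 0 < del ->
  (forall zeta, DVM zeta -> Hnorm T (Hsub zeta eta) < del ->
    fine (VM eta) - phi eta <= fine (VM zeta) - phi zeta) ->
  Hinner T eta (Astar eta) + fH T a f0 eta * (grad eta).1 + U2 eta.1
    + (U1 c0 - (grad eta).1 * c0) <= rho * fine (VM eta).
Proof.
move=> D c00 del0 min; have [e1 [eH _]] := D.
have r0 := rate_gt0 M; have rho0 := ltW (discount_gt0 M).
set F := fH T a f0 eta; set p := (grad eta).1; set E := Hinner _ _ _; set w := fine _.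
(* The factor of [e] collects the losses in [m] and [G] below, with [e * e <= e]. *)
apply: (@le_vanishing_slack _ _ _ (1 + 2 * `|p| + (1 + c0 + 2)) 1) => // e /andP[e0 e_le1].
have [dV dV0 [KV VP]] := V_ball D.
have dm0 : 0 < Num.min del dV by rewrite lt_min del0.
have e20 : 0 < e / 2 by rewrite divr_gt0.
have [k1 k10 P1] := hist_close eH dm0; have [k2 k20 P2] := income_close eH e20.
have [k3 k30 P3] := local_expansion tf eH e1 e0.
(* [eta.1 / 2] keeps the path positive, and [e / (2 * r)] keeps the variation of the interest term
   below [e / 2]. *)
pose k := Num.min (Num.min (Num.min k1 k2) k3) (Num.min (eta.1 / 2) (e / (2 * r))).
have k0 : 0 < k by rewrite !lt_min k10 k20 k30 !divr_gt0 ?mulr_gt0.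
have kle : [/\ k <= k1, k <= k2, k <= k3, k <= eta.1 / 2 & k <= e / (2 * r)].
  by rewrite /k; split; rewrite !ge_min lexx ?orbT.
case: kle => kk1 kk2 kk3 kk4 kk5.
(* The surplus [e] in [b] covers the errors [e / 2] in interest and [e / 2] in income, so
   consumption is at least [c0], and in particular nonnegative when [c0 = 0]. *)
pose b := r * eta.1 + F - c0 - e; pose x t := if t < 0 then eta.2 t else eta.1 + b * t.
pose m := U1 c0 + U2 eta.1 - e.
pose G := E + F * p - p * c0 - 2 * e * `|p| - e * (1 + c0 + 2 * e).
have b1 : 0 < 1 + `|b| by rewrite ltr_pwDl.
suff : m + G <= rho * w.
  have e2 : e * e <= e by rewrite -[leRHS]mulr1 ler_pM2l.
  by rewrite /m /G; lra.
have kb0 : 0 < k / (1 + `|b|) by rewrite divr_gt0.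
apply: (@le_vanishing_slack _ _ _ (rho * `|m| + rho * `|G| + rho ^+ 2 * `|w|) _ kb0) => h /andP[h0 hk].
have hkb : h * (1 + `|b|) <= k by rewrite -ler_pdivlMr.
have hk' : h <= k by apply: le_trans hkb; rewrite ler_pMr // lerDl.
have h0' := ltW h0; have tr := traj_ray b eH h0'.
rewrite -/x in tr.
have xb s : 0 <= s <= h -> `|x s - eta.1| <= k.
  move=> /andP[s0 sh]; rewrite /x ltNge s0 /= addrAC subrr add0r normrM (ger0_norm s0).
  by have := normr_ge0 b; nra.
have near k' s : k <= k' -> 0 <= s <= h -> `|x s - eta.1| <= k'.
  by move=> kk /xb xs; exact: le_trans xs kk.
have fb s : 0 <= s <= h -> `|f0 (x s) (delayed x s) - F| <= e / 2.
  move=> sI; apply: (P2 x (fun=> b) h (le_trans hk' kk2) tr) => // u; exact: near.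
have cb s : 0 <= s <= h -> c0 <= consume x (fun=> b) s <= c0 + 2 * e.
  move=> sI; have f := fb s sI.
  have rx : `|r * (x s - eta.1)| <= e / 2.
    rewrite normrM (gtr0_norm r0); have -> : e / 2 = r * (e / (2 * r)) by field; lra.
    by apply: ler_wpM2l; [exact: ltW|exact: near].
  by move: f rx; rewrite !ler_norml /consumption /b; clear; lra.
have up : admissible_upto M eta x (fun=> b) h.
  split => // s sI; split.
    by have := xb s sI; rewrite ler_norml; clear -kk4 e1; lra.
  by have /andP[+ _] := cb s sI; exact: le_trans.
have hI : 0 <= h <= h by rewrite h0' lexx.
have h3 : 0 <= h <= k3 by rewrite h0' (le_trans hk' kk3).
have [_ U2c dphi] := P3 x _ h h3 up (fun s => near k3 s kk3).
have hn := P1 x _ h (le_trans hk' kk1) tr (fun s => near k1 s kk1) h hI.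
have xH := traj_hist hI tr.
move: hn; rewrite lt_min => /andP[hn1 hn2].
have [DX _] := VP _ xH hn2.
have dp := min _ DX hn1.
have [_] := dpp_concat h0' up DX; rewrite -/w.
set g := (X in X + _ <= _) => dpp.
have gm : h * (m - rho * h * `|m|) <= g.
  have -> : h * (m - rho * h * `|m|) = Rintegral mu `[0, h] (fun=> m - rho * h * `|m|).
    by rewrite Rint_cst_itv // subr0 mulrC.
  apply: Rint_le => //; [exact: ig_cst_itv|exact: gain_upto_ig h0' up|].
  move=> s; rewrite /= in_itv /= => sI.
  apply: le_trans (discounted_ge m rho0 sI) _; rewrite /discounted_gain.
  apply: ler_wpM2l; first exact: expR_ge0.
  have /andP[cs _] := cb s sI; have := U1_mono M c00 cs; have := U2c s sI.
  by rewrite ler_norml /m; clear; lra.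
set d := phi (hist x h) - phi eta in dphi.
have Gd : h * G <= d.
  set c := Rintegral _ _ _ in dphi.
  have ci := consume_ig h0' tr.
  have c1 : h * c0 <= c.
    have -> : h * c0 = Rintegral mu `[0, h] (fun=> c0) by rewrite Rint_cst_itv // subr0 mulrC.
    apply: Rint_le => //; first exact: ig_cst_itv.
    by move=> s; rewrite /= in_itv /= => /cb /andP[].
  have c2 : c <= h * (c0 + 2 * e).
    have -> : h * (c0 + 2 * e) = Rintegral mu `[0, h] (fun=> c0 + 2 * e).
      by rewrite Rint_cst_itv // subr0 mulrC.
    apply: Rint_le => //; first exact: ig_cst_itv.
    by move=> s; rewrite /= in_itv /= => /cb /andP[].
  have pc : p * (c - h * c0) <= `|p| * (h * (2 * e)).
    apply: le_trans (ler_norm _) _; rewrite normrM; apply: ler_wpM2l => //.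
    by rewrite ger0_norm ?subr_ge0 // lerBlDr -mulrDr (addrC (2 * e)).
  have ec : e * (h + c) <= e * (h + h * (c0 + 2 * e)).
    by apply: ler_wpM2l; [exact: ltW|rewrite lerD2l].
  move: dphi; rewrite ler_norml => /andP[dphi _].
  rewrite /G; move: dphi pc ec; rewrite -/E -/F -/p; clearbody c d E F p; clear; lra.
apply: (discounted_limit h0 rho0 _ gm Gd).
apply: le_trans dpp; rewrite lerD2l; apply: ler_wpM2l; first exact: expR_ge0.
by rewrite /d; move: dp; rewrite -/w; clear; lra.
Qed.

End Supersolution.

Lemma value_supersolution (R : realType) (M : model R) :
  visc_super (delay M) (rate M) (discount M) (memory M) (income M) (util1 M) (util2 M)
    (DV (delay M) (rate M) (discount M) (memory M) (income M) (util1 M) (util2 M))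
    (fun eta => fine (Vfun (delay M) (rate M) (discount M) (memory M) (income M) (util1 M) (util2 M) eta)).
Proof.
move=> phi grad Astar tf eta D [del del0 min].
rewrite /hjb_rhs -leeBrDl // -EFinB.
apply: ge_ereal_sup => _ [c c0 <-]; rewrite lee_fin lerBrDl.
by apply: (super_bound tf D _ del0 min); move: c0; rewrite /= in_itv /= andbT.
Qed.

Lemma discounted_le (R : realType) (b s h y : R) : 0 <= b -> 0 <= s <= h ->
  expR (- (b * s)) * y <= y + b * h * `|y|.
Proof. by move=> b0 sI; have := discounted_ge (- y) b0 sI; rewrite normrN; lra. Qed.

Lemma discounted_le2 (R : realType) (b h w : R) : 0 <= b -> 0 <= h ->
  expR (- (b * h)) * w <= w - b * h * w + (b * h) ^+ 2 * `|w|.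
Proof.
move=> b0 h0; have y0 : 0 <= b * h by rewrite mulr_ge0.
have [q1 _ q3] := expRN_bounds y0; move: q1 q3; set q := expR _ => q1 q3.
have : (q - (1 - b * h)) * w <= (q - (1 - b * h)) * `|w|.
  by apply: ler_wpM2l; [lra|exact: ler_norm].
have : (q - (1 - b * h)) * `|w| <= (b * h) ^+ 2 * `|w| by apply: ler_wpM2r => //; lra.
lra.
Qed.

(** * The subsolution inequality *)

Section Subsolution.
Variables (R : realType) (M : model R).
Notation mu := (@lebesgue_measure R).
Notation T := (delay M).
Notation r := (rate M).
Notation rho := (discount M).
Notation a := (memory M).
Notation f0 := (income M).
Notation U1 := (util1 M).
Notation U2 := (util2 M).
Notation I := (`[- T, 0]%classic : set R).
Notation delayed := (delayed_term M).
Notation consume := (consumption M).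
Notation DVM := (DV T r rho a f0 U1 U2).
Notation VM := (Vfun T r rho a f0 U1 U2).
Notation adm := (adm M).
Implicit Types (x dx c : R -> R) (eta zeta : Hpt R) (h s t : R).

(** The clock, elapsed time plus total consumption, is continuous, starts at 0 and has reached [k]
    by time [k]. *)
Lemma stopping_time eta x dx (k : R) : 0 < k -> adm eta x dx ->
  exists2 h : R, 0 <= h <= k & h + Rintegral mu `[0, h] (consume x dx) = k.
Proof.
move=> k0 [tr pos]; have k0' := ltW k0; have ci := consume_ig k0' (tr k k0').
pose Phi t := t + Rintegral mu `[0, t] (consume x dx).
have Phic : {within `[0, k], continuous Phi}.
  apply: within_contD; last exact: parameterized_integral_continuous.
  by apply: continuous_subspaceT => t; exact: cvg_id.
have Ik : 0 <= Rintegral mu `[0, k] (consume x dx).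
  by apply: Rint_ge0 => s; rewrite /= in_itv /= => /andP[/pos[]].
have P0 : Phi 0 = 0 by rewrite /Phi Rint_point addr0.
have between : Num.min (Phi 0) (Phi k) <= k <= Num.max (Phi 0) (Phi k).
  by rewrite P0 /Phi ge_min le_max k0' lerDl Ik orbT.
by have [h hI hE] := IVT k0' Phic between; exists h => //; move: hI; rewrite in_itv.
Qed.

Lemma traj_deviation eta x dx h (B : R) : 0 <= h -> 0 <= B -> admissible_upto M eta x dx h ->
  (forall t, 0 <= t <= h -> `|r * x t + f0 (x t) (delayed x t)| <= B) ->
  forall s, 0 <= s <= h -> `|x s - eta.1| <= B * h + Rintegral mu `[0, h] (consume x dx).
Proof.
move=> h0 B0 [tr pos] dB s /andP[s0 sh]; have ci := consume_ig h0 tr.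
have [_ _ di xE] := tr; rewrite xE ?s0 // addrAC subrr add0r.
have sub : `[0, s]%classic `<=` `[0, h]%classic by move=> u /=; rewrite !in_itv /=; lra.
have dis : ig `[0, s] dx by apply: ig_sub di.
have cis : ig `[0, s] (consume x dx) by apply: ig_sub ci.
apply: le_trans (Rint_abs _ dis) _ => //.
apply: (@le_trans _ _ (Rintegral mu `[0, s] (fun u => B + consume x dx u))).
  apply: Rint_le => //; [exact: ig_norm|by apply: igD => //; exact: ig_cst_itv|].
  move=> u; rewrite /= in_itv /= => uI; have uI' : 0 <= u <= h by lra.
  have [_ c0] := pos u uI'; rewrite (dxE M x dx u).
  by apply: le_trans (ler_normB _ _) _; rewrite (ger0_norm c0) lerD2r; exact: dB.
rewrite RintD //; last exact: ig_cst_itv.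
rewrite Rint_cst_itv // subr0; apply: lerD; first exact: ler_wpM2l.
apply: Rint_subset_le => // u; rewrite /= in_itv /= => uI.
by case: (pos u uI).
Qed.

Variables (phi : Hpt R -> R) (grad Astar : Hpt R -> Hpt R).
Hypothesis tf : test_fun T r phi grad Astar.

(** At a local maximum of V - phi the increments of [phi] dominate those of V, so [phi] inherits the
    slope [kap] from [V_slope], up to the differentiation error [kap / 2]. *)
Lemma max_slope_gt0 eta (del : R) : DVM eta -> 0 < del ->
  (forall zeta, DVM zeta -> Hnorm T (Hsub zeta eta) < del ->
    fine (VM zeta) - phi zeta <= fine (VM eta) - phi eta) -> 0 < (grad eta).1.
Proof.
move=> D del0 max; have [_ [eH _]] := D; have [kap kap0 sl] := V_slope D.
have kap2 : 0 < kap / 2 by rewrite divr_gt0.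
have [d d0 dP] := phi_frechet tf eH kap2.
pose k : R := Num.min 1 (Num.min (d / 2) (del / 2)).
have k0 : 0 < k by rewrite !lt_min ltr01 !divr_gt0.
have [k1 kd kdel] : [/\ k <= 1, k <= d / 2 & k <= del / 2].
  by rewrite /k; split; rewrite !ge_min lexx ?orbT.
have kI : 0 < k <= 1 by rewrite k0.
have [Dk vk] := sl k kI.
have zH : inH T ((k, fun=> 0) : Hpt R) := L2_cst T 0.
have i0 (f : R -> R) : Rintegral mu I (fun t => f t * 0) = 0.
  rewrite (@Rint_eq _ _ _ (fun=> 0 : R)); last by move=> t _; rewrite mulr0.
  by rewrite /Rintegral integral0.
have kn : Hnorm T ((k, fun=> 0) : Hpt R) = k.
  by rewrite /Hnorm /Hinner /= i0 addr0 -expr2 sqrtr_sqr gtr0_norm.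
have e1 : Hnorm T (Hsub (Hadd eta (k, fun=> 0)) eta) = k.
  by rewrite -[RHS]kn; apply: eq_Hnorm => [|t _] /=; ring.
have := max _ Dk; rewrite e1 => /(_ _) mx.
have kdel' : k < del by lra.
have kd' : k < d by lra.
have := dP _ zH; rewrite kn => /(_ kd').
rewrite /Hinner /= i0 addr0 ler_norml => /andP[_ up].
have mx' := mx kdel'; rewrite -(pmulr_lgt0 _ k0).
have : 0 < kap / 2 * k by rewrite mulr_gt0.
lra.
Qed.

(** The combination, with weights [1 - th] and [th = 4 d / p], of [U1 c - p c <= Hm] and [U1 c <= K]
    lowers the slope from [p] to [p - 4 d] at a cost of order [d]. *)
Lemma util1_tilt (p d Hm K c : R) : 0 < p -> 0 <= d <= p / 4 -> 0 <= K ->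
  (forall c : R, 0 <= c -> `|U1 c| <= K) -> (forall c : R, 0 <= c -> U1 c - p * c <= Hm) ->
  0 <= c -> U1 c <= Hm + d * (8 * K / p) + (p - 2 * d) * c.
Proof.
move=> p0 /andP[d0 dp] K0 UK UH c0.
pose th := 4 * d / p.
have th0 : 0 <= th by rewrite /th; apply: divr_ge0; [lra|exact: ltW].
have th1 : th <= 1 by rewrite /th ler_pdivrMr //; lra.
have thp : th * p = 4 * d by rewrite /th divfK // gt_eqF.
have u1 : (1 - th) * (U1 c - p * c) <= (1 - th) * Hm by apply: ler_wpM2l; [lra|exact: UH].
have u2 : th * U1 c <= th * K.
  by apply: ler_wpM2l => //; apply: le_trans (UK c c0); exact: ler_norm.
have HK : - K <= Hm.
  have := UH 0 (lexx 0); have := UK 0 (lexx 0); rewrite mulr0 subr0 ler_norml; lra.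
have tK : th * (K - Hm) <= th * (2 * K) by apply: ler_wpM2l => //; lra.
have -> : d * (8 * K / p) = th * (2 * K) by rewrite /th; field; rewrite gt_eqF.
have pc : th * p * c = 4 * d * c by rewrite thp.
have dc : 0 <= d * c by apply: mulr_ge0.
lra.
Qed.

(** A defect [nu] is contradicted as follows. Tilting reserves [2 d] per unit of consumption, of
    which the expansion error uses at most [d]; per unit of time the errors use at most half of
    [nu]. Up to the stopping time the path thus loses at least [min (nu / 4) d] times
    [h + C' = kap], more than its distance [eps] from optimality. *)
Lemma sub_bound eta (del Hm : R) : DVM eta -> 0 < del ->
  (forall zeta, DVM zeta -> Hnorm T (Hsub zeta eta) < del ->
    fine (VM zeta) - phi zeta <= fine (VM eta) - phi eta) ->
  (forall c : R, 0 <= c -> U1 c - (grad eta).1 * c <= Hm) ->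
  rho * fine (VM eta) <= Hinner T eta (Astar eta) + fH T a f0 eta * (grad eta).1 + U2 eta.1 + Hm.
Proof.
move=> D del0 max UH; have [e1 [eH _]] := D.
have p0 := max_slope_gt0 D del0 max; have rho0 := ltW (discount_gt0 M).
have [K K0 [UK _]] := util_bound M.
move: UH p0; set F := fH T a f0 eta; set p := (grad eta).1; set E := Hinner _ _ _.
set w := fine _ => UH p0.
rewrite leNgt; apply/negP => neg; pose nu : R := rho * w - (E + F * p + U2 eta.1 + Hm).
have nu0 : 0 < nu by rewrite /nu; lra.
pose S : R := 8 * K / p.
have S0 : 0 <= S by rewrite /S divr_ge0 ?mulr_ge0 // ltW.
have [d [d0 dp dS]] : exists d : R, [/\ 0 < d, d <= p / 4 & d * S <= nu / 4].
  have S1 : 0 < S + 1 by rewrite ltr_wpDl.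
  exists (Num.min (p / 4) (nu / (4 * (S + 1)))); set d := Num.min _ _.
  have d0 : 0 < d by rewrite lt_min !divr_gt0 // mulr_gt0.
  split=> //; first by rewrite ge_min lexx.
  have : d * (4 * (S + 1)) <= nu by rewrite -ler_pdivlMr ?mulr_gt0 // ge_min lexx orbT.
  lra.
pose e : R := Num.min (Num.min d del) (nu / 16).
have e0 : 0 < e by rewrite lt_min lt_min d0 del0 divr_gt0.
have [ed edel enu] : [/\ e <= d, e <= del & e <= nu / 16].
  by rewrite /e; split; rewrite !ge_min lexx ?orbT.
have [k k0 kP] := local_expansion tf eH e1 e0.
have [B B0 [h1 h10 BP]] := apriori_bound M eta.
pose m : R := Hm + d * S + U2 eta.1 + e.
pose L : R := `|E + F * p| + p + e.
have L0 : 0 <= L by rewrite /L; have := normr_ge0 (E + F * p); lra.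
pose Q : R := rho * `|m| + rho * L + rho ^+ 2 * `|w|.
have Q0 : 0 <= Q by rewrite /Q; apply: addr_ge0; [apply: addr_ge0|]; rewrite mulr_ge0 ?sqr_ge0.
(* The entry with [B + 1] keeps the stopped path within [k] of [eta.1]; the last one keeps the
   second-order discounting errors, gathered in [Q], below [nu / 8] per unit of time. *)
pose kap : R := Num.min (Num.min k h1) (Num.min (k / (B + 1)) (nu / (8 * (Q + 1)))).
have Q1 : 0 < Q + 1 by rewrite ltr_wpDl.
have B1 : 0 < B + 1 by lra.
have kap0 : 0 < kap by rewrite !lt_min k0 h10 !divr_gt0 // mulr_gt0.
have [kapk kaph kapB' kapQ'] : [/\ kap <= k, kap <= h1, kap <= k / (B + 1) &
    kap <= nu / (8 * (Q + 1))].
  by rewrite /kap; split; rewrite !ge_min lexx ?orbT.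
have kapB : kap * (B + 1) <= k by rewrite -ler_pdivlMr.
have kapQ : kap * Q <= nu / 8.
  have : kap * (8 * (Q + 1)) <= nu by rewrite -ler_pdivlMr ?mulr_gt0.
  lra.
(* Half of the loss forced below. It is fixed before the path is chosen, which is possible because
   the clock stops at [kap] for every path. *)
pose eps : R := Num.min (nu / 4) d * kap / 2.
have md0 : 0 < Num.min (nu / 4) d by rewrite lt_min divr_gt0.
have eps0 : 0 < eps by rewrite /eps divr_gt0 // mulr_gt0.
have [x [dx [ad gi Jw]]] := V_approx D eps0.
have [h /andP[h0 hk] hC] := stopping_time kap0 ad.
have [tr pos] := ad.
have up : admissible_upto M eta x dx h.
  by split; [exact: tr|move=> t /andP[t0 _]; exact: pos].
move: hC; set C' := Rintegral _ _ _ => hC.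
have C0 : 0 <= C' by apply: Rint_ge0 => s; rewrite /= in_itv /= => /andP[/pos[]].
have hI1 : 0 <= h <= h1 by lra.
have dev s : 0 <= s <= h -> `|x s - eta.1| <= k.
  move=> sI; apply: le_trans (traj_deviation h0 (ltW B0) up _ sI) _.
    by move=> t tI; case: (BP h x dx hI1 up t tI).
  rewrite -/C'; have : B * h <= B * kap by apply: ler_wpM2l => //; exact: ltW.
  lra.
have hIk : 0 <= h <= k by lra.
have [hn U2c dphi] := kP x dx h hIk up dev.
have [DX dpp] := dpp_shift h0 ad gi.
have mx := max _ DX (lt_le_trans hn edel).
move: dphi dpp mx Jw; rewrite -/w -/E -/F -/p -/C' ler_norml => /andP[_ dphi].
set v := fine (VM (hist x h)); set J := (X in X <= _ -> _); set g := (X in _ <= X + _ -> _).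
move=> dpp mx Jw.
have {}Jw : w - eps < J by exact: Jw.
clear max D kP BP ad gi DX hn dev neg; clearbody v J E F w p.
have hh : 0 <= h <= h by rewrite h0 lexx.
have p2d : 0 <= p - 2 * d by clear -dp p0; lra.
have gm : g <= h * (m + rho * h * `|m|) + (p - 2 * d) * C'.
  have ci := consume_ig h0 (tr h h0).
  have -> : h * (m + rho * h * `|m|) + (p - 2 * d) * C' =
      Rintegral mu `[0, h] (fun s => m + rho * h * `|m| + (p - 2 * d) * consume x dx s).
    rewrite RintD //; [|exact: ig_cst_itv|exact: igZ].
    by rewrite Rint_cst_itv // RintZ // subr0; congr (_ + _); exact: mulrC.
  apply: Rint_le => //; first exact: gain_upto_ig h0 up.
    by apply: igD => //; [exact: ig_cst_itv|exact: igZ].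
  move=> s; rewrite /= in_itv /= => sI; rewrite /discounted_gain.
  have [_ c0] := pos s (proj1 (andP sI)).
  have ut := util1_tilt p0 (introT andP (conj (ltW d0) dp)) K0 UK UH c0.
  have U2s := U2c s sI; rewrite ler_norml in U2s.
  have b1 : U1 (consume x dx s) + U2 (x s) <= m + (p - 2 * d) * consume x dx s.
    by rewrite /m; move: ut U2s; rewrite -/S; clear; lra.
  apply: (@le_trans _ _ (expR (- (rho * s)) * (m + (p - 2 * d) * consume x dx s))).
    by apply: ler_wpM2l; first exact: expR_ge0.
  rewrite mulrDr; apply: lerD; first exact: discounted_le.
  rewrite -[leRHS]mul1r; apply: ler_wpM2r; first exact: mulr_ge0.
  by rewrite -expR0 ler_expR oppr_le0 mulr_ge0 //; case/andP: sI.
clearbody g C'.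
pose Bd : R := h * (E + F * p) - p * C' + e * (h + C').
have vB : v <= w + Bd by rewrite /Bd; clear -mx dphi; lra.
have C'k : C' <= kap by rewrite -hC lerDr.
have BdL : `|Bd| <= kap * L.
  apply: le_trans (ler_normD _ _) _; apply: le_trans (lerD (ler_normB _ _) (lexx _)) _.
  rewrite normrM (ger0_norm h0) (ger0_norm (_ : 0 <= p * C')); last by rewrite mulr_ge0 // ltW.
  have eC : 0 <= e * (h + C') by rewrite mulr_ge0 ?addr_ge0 // ltW.
  rewrite (ger0_norm eC).
  have i1 : h * `|E + F * p| <= kap * `|E + F * p| by apply: ler_wpM2r.
  have i2 : p * C' <= p * kap by apply: ler_wpM2l => //; exact: ltW.
  by rewrite hC /L; clear -i1 i2; lra.
have q0 := expR_ge0 (- (rho * h)).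
have s1 : expR (- (rho * h)) * v <= expR (- (rho * h)) * w + expR (- (rho * h)) * Bd.
  by rewrite -mulrDr; apply: ler_wpM2l.
have s2 := discounted_le2 w rho0 h0.
have s3 := discounted_le Bd rho0 hh.
have s4 : rho * h * `|Bd| <= rho * h * (kap * L) by apply: ler_wpM2l => //; exact: mulr_ge0.
have s5 : h * (rho * h * `|m|) <= h * (rho * kap * `|m|).
  by apply: ler_wpM2l => //; apply: ler_wpM2r => //; apply: ler_wpM2l.
have s6 : (rho * h) ^+ 2 * `|w| <= h * (rho ^+ 2 * kap * `|w|).
  have -> : (rho * h) ^+ 2 * `|w| = h * (rho ^+ 2 * h * `|w|) by ring.
  by apply: ler_wpM2l => //; apply: ler_wpM2r => //; apply: ler_wpM2l => //; exact: sqr_ge0.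
have s7 : h * (kap * Q) <= h * (nu / 8) by apply: ler_wpM2l.
have hQ : h * (kap * Q) = h * (rho * kap * `|m|) + rho * h * (kap * L) + h * (rho ^+ 2 * kap * `|w|).
  by rewrite /Q; ring.
have s8 : h * (d * S) <= h * (nu / 4) by apply: ler_wpM2l.
have s9 : h * e <= h * (nu / 16) by apply: ler_wpM2l.
have s10 : C' * e <= C' * d by apply: ler_wpM2l.
(* Of [h * nu], a quarter goes to the tilt [d * S], an eighth to the two occurrences of [e] and an
   eighth to [Q]. *)
have key : h * (nu / 4) + d * C' < eps.
  have hm : h * m = h * Hm + h * (d * S) + h * U2 eta.1 + h * e by rewrite /m; ring.
  have hnu : h * nu = h * (rho * w) - h * (E + F * p) - h * U2 eta.1 - h * Hm by rewrite /nu; ring.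
  have hB : Bd = h * (E + F * p) - p * C' + h * e + C' * e by rewrite /Bd; ring.
  move: Jw dpp s1 s2 s3 s4 s5 s6 s7 s8 s9 s10 hQ gm hm hnu hB.
  have hnu0 : 0 <= h * nu by rewrite mulr_ge0 // ltW.
  move: hnu0; clear; lra.
have f1 : Num.min (nu / 4) d * h <= h * (nu / 4).
  by rewrite mulrC; apply: ler_wpM2l => //; rewrite ge_min lexx.
have f2 : Num.min (nu / 4) d * C' <= d * C' by apply: ler_wpM2r => //; rewrite ge_min lexx orbT.
have epsE : eps * 2 = Num.min (nu / 4) d * h + Num.min (nu / 4) d * C'.
  by rewrite -mulrDr hC /eps divfK.
by clear -key f1 f2 epsE eps0; lra.
Qed.

End Subsolution.

(** With a positive slope and bounded [util1] the Hamiltonian is finite, so the inequality reduces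
    to one between real numbers. *)
Lemma value_subsolution (R : realType) (M : model R) :
  visc_sub (delay M) (rate M) (discount M) (memory M) (income M) (util1 M) (util2 M)
    (DV (delay M) (rate M) (discount M) (memory M) (income M) (util1 M) (util2 M))
    (fun eta => fine (Vfun (delay M) (rate M) (discount M) (memory M) (income M) (util1 M) (util2 M) eta)).
Proof.
move=> phi grad Astar tf eta D [del del0 max].
have p0 := max_slope_gt0 tf D del0 max; have [K K0 [UK _]] := util_bound M.
have HamK : (Ham (util1 M) (grad eta).1 <= K%:E)%E.
  apply: ge_ereal_sup => _ [c cI <-].
  have c0 : 0 <= c by move: cI; rewrite /= in_itv /= andbT.
  rewrite lee_fin; have := UK c c0; rewrite ler_norml => /andP[_].
  have : 0 <= (grad eta).1 * c by rewrite mulr_ge0 // ltW.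
  lra.
have Ham_ge c : 0 <= c -> ((util1 M c - (grad eta).1 * c)%:E <= Ham (util1 M) (grad eta).1)%E.
  by move=> c0; apply: ereal_sup_ubound; exists c => //; rewrite /= in_itv /= andbT.
have Hfin : Ham (util1 M) (grad eta).1 \is a fin_num.
  rewrite fin_numE; apply/andP; split.
    rewrite gt_eqF //; exact: lt_le_trans (ltNyr _) (Ham_ge 0 (lexx 0)).
  by rewrite lt_eqF //; exact: le_lt_trans HamK (ltry _).
rewrite /hjb_rhs -(fineK Hfin) -EFinD lee_fin.
apply: (sub_bound tf D del0 max) => c c0.
by rewrite -lee_fin (fineK Hfin); exact: Ham_ge.
Qed.

Theorem theorem4p2 (R : realType) (T r rho Cf0 : R)
  (a : R -> R) (f0 : R -> R -> R) (U1 U2 : R -> R) :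
  0 < T -> 0 < r -> 0 < rho ->
  (* a in W^{1,2}_{-T}, a >= 0, a(-T) = 0 *)
  W12 T a -> (forall t, t \in `[- T, 0] -> 0 <= a t) -> a (- T) = 0 ->
  (* f0 jointly concave on [0,oo) x R *)
  (forall (x1 y1 x2 y2 l : R), 0 <= x1 -> 0 <= x2 -> 0 <= l <= 1 ->
     l * f0 x1 y1 + (1 - l) * f0 x2 y2
       <= f0 (l * x1 + (1 - l) * x2) (l * y1 + (1 - l) * y2)) ->
  (* nondecreasing in its second variable *)
  (forall x y y' : R, 0 <= x -> y <= y' -> f0 x y <= f0 x y') ->
  (* Lipschitz with constant Cf0 *)
  0 <= Cf0 ->
  (forall x y x' y' : R, 0 <= x -> 0 <= x' ->
     `| f0 x y - f0 x' y' | <= Cf0 * (`| x - x' | + `| y - y' |)) ->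
  (forall y : R, 0 < y -> 0 < f0 0 y) ->
  (* extension to x < 0 *)
  (forall x y : R, x < 0 -> f0 x y = f0 0 y) ->
  (* U1 in C([0,oo)) /\ C^2((0,oo)), U1' > 0, U1'(0+) = +oo, U1'' < 0, bounded *)
  {within (`[0%R, +oo[%classic : set R), continuous U1} ->
  (forall t : R, 0 < t ->
     derivable U1 t 1 /\ derivable (derive1 U1) t 1 /\ {for t, continuous (derive1 (derive1 U1))}) ->
  (forall t : R, 0 < t -> 0 < (derive1 U1) t) ->
  (derive1 U1) x @[x --> 0^'+] --> +oo ->
  (forall t : R, 0 < t -> (derive1 (derive1 U1)) t < 0) ->
  (exists M : R, forall c : R, 0 <= c -> `| U1 c | <= M) ->
  (* U2 in C((0,oo)), increasing, concave, bounded above, integrability condition *)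
  {within (`]0%R, +oo[%classic : set R), continuous U2} ->
  (forall x y : R, 0 < x -> x < y -> U2 x < U2 y) ->
  (forall x y l : R, 0 < x -> 0 < y -> 0 <= l <= 1 ->
     l * U2 x + (1 - l) * U2 y <= U2 (l * x + (1 - l) * y)) ->
  (exists M : R, forall x : R, 0 < x -> U2 x <= M) ->
  (\int[@lebesgue_measure R]_(t in (`[0%R, +oo[%classic : set R))
      ((expR (- (rho * t)) * U2 (expR (- (Cf0 * t))))%:E) > -oo)%E ->
  visc_sol T r rho a f0 U1 U2 (DV T r rho a f0 U1 U2)
    (fun eta => fine (Vfun T r rho a f0 U1 U2 eta)).
Proof.
move=> T0 r0 rho0 aW a0 _ f0conc f0mono C0 f0lip f0pos f0neg U1c U1d U1i _ U1conc U1b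
  U2c U2i U2conc U2b U2int.
pose M := Model T0 r0 rho0 aW a0 f0conc f0mono C0 f0lip f0pos f0neg U1c U1d U1i U1conc U1b
  U2c U2i U2conc U2b U2int.
split; first exact: (@V_continuous R M).
by split; [exact: (@value_subsolution R M)|exact: (@value_supersolution R M)].
Qed.
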